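(* Let $F$ be an infinite field and let $A$ be a representable affine PI-algebra over $F$. Then the Zariski closure of $A$ has a representation, with a corresponding full quiver, all of whose polynomial relations are consequences of proportional gluing.
   Context: Let $F$ be a field and $K$ an algebraically closed field containing $F$. An $F$-algebra is affine if it is finitely generated, and a PI-algebra if it satisfies a nontrivial polynomial identity. It is representable if it embeds as an $F$-subalgebra of $M_n(K)$ for some $n$ and a suitable such $K$. Representations $\rho\colon A\to M_n(K)$ are always taken to be faithful, and one identifies $A$ with $\rho(A)$. The Zariski closure of $A$ is the closure of $\rho(A)$ in the Zariski topology of $M_n(K)=K^{n^2}$; $A$ is Zariski closed if $\rho(A)$ equals its closure. The polynomial relations of $\rho(A)$ are the polynomials $f\in K[\lambda_{ij}: 1\le i,j\le n]$ that vanish at the matrix entries of every element of $\rho(A)$. A polynomial relation is a consequence of a set of relations if it is formally implied by them. $J$ denotes the Jacobson radical. Wedderburn block form. Let $A$ be Zariski closed. Then $A=S\oplus J$ with $S\cong A/J$ a subalgebra and $A/J= A_1\times\cdots\times A_k$, $A_u\cong M_{n_u}(F_u)$, where each $F_u$ is a field with $F\subseteq F_u\subseteq K$ that is either finite or equal to $K$. A representation $\rho\colon A\to M_n(K)$ is in Wedderburn block form if there are $s_1,\dots,s_k\ge 1$ with $n=\sum_u s_un_u$ and disjoint diagonal blocks $A_u^{(i)}$ ($1\le u\le k$, $1\le i\le s_u$) containing the diagonal, $A_u^{(i)}$ having size $n_u\times n_u$ and being isomorphic to $A_u$, such that $\rho$ restricts to an embedding $A_u\to A_u^{(1)}\times\cdots\times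 A_u^{(s_u)}$ whose composite with each projection is an isomorphism $A_u\to A_u^{(i)}$, and $\rho(J)$ lies in the sum of the strictly upper triangular blocks (above the diagonal blocks). Blocks with the same $u$ are called (diagonally) glued; over an infinite $F$ this gluing is identical (corresponding entries are equal). Full quiver. Given a representation in Wedderburn block form, let $B_1,\dots,B_\ell$ be the diagonal blocks in order along the diagonal, with unit elements $e_1,\dots,e_\ell\in M_n(K)$. The full quiver is the directed graph with vertices $1,\dots,\ell$ (each labelled by its matrix degree, its field, and a roman numeral, glued blocks carrying the same roman numeral), with an arrow $r\to s$ ($r<s$, no loops) if and only if $e_r\rho(A)e_s\neq 0$, and with gluing between blocks recorded. Proportional gluing between the blocks $(r,s)$ and $(r',s')$ means that there is $\nu\in K$ such that for every element of $\rho(A)$ the entries in the block $(r',s')$ are each $\nu$ times the respective entries in the block $(r,s)$; it is called identical gluing when $\nu=1$. All polynomial relations are consequences of proportional gluing when, apart from the vanishing of the entries in blocks that are zero on $\rho(A)$, they are consequences of proportional gluing between blocks (including identical gluing of diagonal blocks). *)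

(* Defs.v *)
From HB Require Import structures.
From mathcomp Require Import all_boot all_order all_algebra.
From mathcomp Require Import boolp classical_sets cardinality.
From mathcomp Require Import finmap mpoly.
From mathcomp Require monalg.

Set Implicit Arguments.
Unset Strict Implicit.
Unset Printing Implicit Defensive.

Import GRing.Theory.

Local Open Scope ring_scope.
Local Open Scope classical_set_scope.

Definition subalgebra (F : fieldType) (B : algType F) (P : set B) : Prop :=
  [/\ P 1,
      forall x y, P x -> P y -> P (x + y),
      forall x y, P x -> P y -> P (x * y)
    & forall (a : F) x, P x -> P (a *: x)].

Definition affine (F : fieldType) (A : algType F) : Prop :=
  exists gens : seq A, forall P : set A,
    subalgebra P -> (forall x, x \in gens -> P x) -> P = setT.

(* {malg F[{fmonom nat}]} is the free associative unital algebra over F on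
   countably many variables: monomials are words in nat.  The import is local
   because the polynomial notations of monalg clash with those of mpoly. *)
Section PolynomialIdentities.
Import monalg.

Definition nc_eval (F : fieldType) (A : algType F) (a : nat -> A)
    (f : {malg F[{fmonom nat}]}) : A :=
  \sum_(w <- (msupp f : seq {fmonom nat})) mcoeff w f *: \prod_(i <- (w : seq nat)) a i.

Definition PI_algebra (F : fieldType) (A : algType F) : Prop :=
  exists2 f : {malg F[{fmonom nat}]},
    f != 0 & forall a : nat -> A, nc_eval a f = 0.

End PolynomialIdentities.

(* The inclusion of F in K is a parameter iota; the F-algebra structure of
   'M[K]_n is a *: M := iota a *: M. *)
Record representation (F : fieldType) (K : closedFieldType)
    (iota : {rmorphism F -> K}) (A : algType F) (n : nat) := Representation {
  rep_fun :> {rmorphism A -> 'M[K]_n};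
  rep_scale : forall (a : F) (x : A), rep_fun (a *: x) = iota a *: rep_fun x;
  rep_inj : injective rep_fun }.

Definition mx_eval (K : fieldType) (n : nat) (M : 'M[K]_n)
    (f : {mpoly K[n * n]}) : K := f.@[fun i => mxvec M 0 i].

Definition polynomial_relation (K : fieldType) (n : nat) (X : set 'M[K]_n)
    (f : {mpoly K[n * n]}) : Prop := forall M, X M -> mx_eval M f = 0.

Definition zariski_closure (K : fieldType) (n : nat) (X : set 'M[K]_n)
    : set 'M[K]_n :=
  [set M | forall f, polynomial_relation X f -> mx_eval M f = 0].

Lemma zariski_closure_affine_map (K : fieldType) (n : nat) (X : set 'M[K]_n)
    (L : {linear 'M[K]_n -> 'M[K]_n}) (C : 'M[K]_n) :
  (forall M, X M -> zariski_closure X (L M + C)) ->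
  forall M, zariski_closure X M -> zariski_closure X (L M + C).
Proof.
move=> XL M clM f Xf.
pose lq := [tuple \sum_j (lin_mx L j k) *: 'X_j + (mxvec C 0 k)%:MP
             | k < n * n] : (n * n).-tuple {mpoly K[n * n]}.
have lqE N : mx_eval N (comp_mpoly lq f) = mx_eval (L N + C) f.
  rewrite /mx_eval comp_mpoly_meval; apply: meval_eq => k.
  have -> : mxvec (L N + C) = mxvec N *m lin_mx L + mxvec C.
    by rewrite mul_vec_lin linearD.
  rewrite tnth_mktuple !mxE mevalD mevalC raddf_sum /=.
  congr (_ + _); apply: eq_bigr => j _.
  by rewrite mevalZ mevalXU mulrC.
rewrite -lqE; apply: clM => N XN; rewrite lqE.
exact: XL.
Qed.

Section ZariskiClosureAlgebra.
Context (F : fieldType) (K : closedFieldType) (iota : {rmorphism F -> K}).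
Context (A : algType F) (n : nat) (rho : representation iota A n).

Let X : set 'M[K]_n := range rho.

Lemma sub_zariski_closure M : X M -> zariski_closure X M.
Proof. by move=> XM f; apply. Qed.

Lemma zariski_closureD M N :
  zariski_closure X M -> zariski_closure X N -> zariski_closure X (M + N).
Proof.
have step P Q : zariski_closure X P -> X Q -> zariski_closure X (P + Q).
  move=> clP [y _ <-].
  apply: (@zariski_closure_affine_map _ _ _ idfun) clP => _ [x _ <-] /=.
  by apply: sub_zariski_closure; exists (x + y); rewrite ?rmorphD.
move=> clM clN; rewrite addrC.
apply: (@zariski_closure_affine_map _ _ _ idfun) clN => P XP /=.
by rewrite addrC; apply: step.
Qed.

Lemma zariski_closureM M N :
  zariski_closure X M -> zariski_closure X N -> zariski_closure X (M *m N).
Proof.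
have step P Q : zariski_closure X P -> X Q -> zariski_closure X (P *m Q).
  move=> clP [y _ <-]; rewrite -[_ *m _]addr0.
  apply: (@zariski_closure_affine_map _ _ _ (mulmxr (rho y))) clP => _ [x _ <-].
  rewrite addr0 /=.
  by apply: sub_zariski_closure; exists (x * y); rewrite ?rmorphM.
move=> clM clN; rewrite -[_ *m _]addr0.
apply: (@zariski_closure_affine_map _ _ _ (mulmx M)) clN => P XP.
by rewrite addr0; apply: step.
Qed.

Lemma zariski_closureZ (a : F) M :
  zariski_closure X M -> zariski_closure X (iota a *: M).
Proof.
move=> clM; rewrite -[_ *: _]addr0.
apply: (@zariski_closure_affine_map _ _ _ (GRing.scale (iota a))) clM => _ [x _ <-].
rewrite addr0 /=.
by apply: sub_zariski_closure; exists (a *: x); rewrite ?rep_scale.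
Qed.

Lemma zariski_closure1 : zariski_closure X 1.
Proof. by apply: sub_zariski_closure; exists 1; rewrite ?rmorph1. Qed.

Definition in_closure : {pred 'M[K]_n} := fun M => `[< zariski_closure X M >].

Lemma in_closureP M : reflect (zariski_closure X M) (M \in in_closure).
Proof. exact: asboolP. Qed.

Lemma in_closure_subring : subring_closed in_closure.
Proof.
split=> [|M N /in_closureP clM /in_closureP clN
         |M N /in_closureP clM /in_closureP clN]; apply/in_closureP.
- exact: zariski_closure1.
- rewrite -[N]scale1r -scaleNr -(rmorph1 iota) -rmorphN.
  by apply: zariski_closureD => //; apply: zariski_closureZ.
- exact: zariski_closureM.
Qed.

(* The Zariski closure of rho(A) in 'M[K]_n, with the operations of 'M[K]_n and
   the scalar action of F through iota. *)
Record closure_algebra : predArgType :=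
  ClosureAlgebra { closure_val :> 'M[K]_n; _ : closure_val \in in_closure }.

HB.instance Definition _ := [isSub for closure_val].
HB.instance Definition _ := [Choice of closure_algebra by <:].
HB.instance Definition _ := GRing.SubChoice_isSubPzRing.Build _ _
  closure_algebra in_closure_subring.

Lemma closure_algebra_oner_neq0 : (1 : closure_algebra) != 0.
Proof.
apply/negP => /eqP /(congr1 val); rewrite rmorph1 raddf0 => e.
have /eqP := oner_neq0 A; apply; apply: (rep_inj (r := rho)).
by rewrite rmorph1 raddf0.
Qed.

HB.instance Definition _ := GRing.PzSemiRing_isNonZero.Build closure_algebra
  closure_algebra_oner_neq0.

Definition closure_scale (a : F) (M : closure_algebra) : closure_algebra :=
  ClosureAlgebra (introT (in_closureP _)
    (zariski_closureZ a (elimT (in_closureP _) (valP M)))).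

Lemma closure_scaleA a b M :
  closure_scale a (closure_scale b M) = closure_scale (a * b) M.
Proof. by apply: val_inj; rewrite /= scalerA rmorphM. Qed.
Lemma closure_scale1 : left_id 1 closure_scale.
Proof. by move=> M; apply: val_inj; rewrite /= rmorph1 scale1r. Qed.
Lemma closure_scaleDr : right_distributive closure_scale +%R.
Proof. by move=> a M N; apply: val_inj; rewrite /= scalerDr. Qed.
Lemma closure_scaleDl M : {morph closure_scale^~ M : a b / a + b}.
Proof. by move=> a b; apply: val_inj; rewrite /= rmorphD scalerDl. Qed.

HB.instance Definition _ := GRing.Zmodule_isLmodule.Build F closure_algebra
  closure_scaleA closure_scale1 closure_scaleDr closure_scaleDl.

Lemma closure_scaleAl (a : F) (M N : closure_algebra) :
  a *: (M * N) = (a *: M) * N.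
Proof. by apply: val_inj; exact: scalemxAl. Qed.
Lemma closure_scaleAr (a : F) (M N : closure_algebra) :
  a *: (M * N) = M * (a *: N).
Proof. by apply: val_inj; exact: scalemxAr. Qed.

HB.instance Definition _ := GRing.Lmodule_isLalgebra.Build F closure_algebra
  closure_scaleAl.
HB.instance Definition _ := GRing.Lalgebra_isAlgebra.Build F closure_algebra
  closure_scaleAr.

End ZariskiClosureAlgebra.

Definition left_ideal (R : pzRingType) (I : set R) : Prop :=
  [/\ I 0,
      forall x y, I x -> I y -> I (x + y)
    & forall a x, I x -> I (a * x)].

Definition maximal_left_ideal (R : pzRingType) (I : set R) : Prop :=
  [/\ left_ideal I, I <> setT
    & forall I' : set R, left_ideal I' -> I `<=` I' -> I' = I \/ I' = setT].

Definition jacobson_radical (R : pzRingType) : set R :=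
  [set x | forall I : set R, maximal_left_ideal I -> I x].

Definition intermediate_field (F : fieldType) (K : closedFieldType)
    (iota : {rmorphism F -> K}) (E : set K) : Prop :=
  [/\ forall a, E (iota a),
      forall x y, E x -> E y -> E (x - y),
      forall x y, E x -> E y -> E (x * y)
    & forall x, E x -> E x^-1].

Definition mx_over (K : fieldType) (m : nat) (E : set K) : set 'M[K]_m :=
  [set M | forall i j, E (M i j)].

(* A subspace closed under products; its unit, if any, need not be that of B. *)
Definition nonunital_subalgebra (F : fieldType) (B : algType F) (P : set B)
    : Prop :=
  [/\ P 0,
      forall x y, P x -> P y -> P (x + y),
      forall x y, P x -> P y -> P (x * y)
    & forall (a : F) x, P x -> P (a *: x)].

Definition algebra_iso (F : fieldType) (K : closedFieldType)
    (iota : {rmorphism F -> K}) (B : algType F) (m : nat)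
    (P : set B) (Q : set 'M[K]_m) (f : B -> 'M[K]_m) : Prop :=
  [/\ forall x y, P x -> P y -> f (x + y) = f x + f y,
      forall x y, P x -> P y -> f (x * y) = f x *m f y,
      forall (a : F) x, P x -> f (a *: x) = iota a *: f x,
      forall x y, P x -> P y -> f x = f y -> x = y
    & f @` P = Q].

Definition sum_of_components (F : fieldType) (B : algType F) (k : nat)
    (C : 'I_k -> set B) : set B :=
  [set x | exists2 a : 'I_k -> B, forall u, C u (a u) & x = \sum_u a u].

(* B = S (+) J, S = A_1 x ... x A_k, A_u isomorphic to M_{n_u}(F_u). *)
Record wedderburn_decomposition (F : fieldType) (K : closedFieldType)
    (iota : {rmorphism F -> K}) (B : algType F) := WedderburnDecomposition {
  wd_size : nat;
  wd_degree : 'I_wd_size -> nat;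
  wd_field : 'I_wd_size -> set K;
  wd_component : 'I_wd_size -> set B;
  wd_degree_gt0 : forall u, (0 < wd_degree u)%N;
  wd_fieldP : forall u, intermediate_field iota (wd_field u);
  wd_field_finite_or_full :
    forall u, finite_set (wd_field u) \/ wd_field u = setT;
  wd_component_subalgebra : forall u, nonunital_subalgebra (wd_component u);
  wd_component_iso : forall u, exists phi : B -> 'M[K]_(wd_degree u),
    algebra_iso iota (wd_component u) (@mx_over K (wd_degree u) (wd_field u)) phi;
  wd_component_orthogonal : forall u v x y, u != v ->
    wd_component u x -> wd_component v y -> x * y = 0;
  wd_component_direct : forall a : 'I_wd_size -> B,
    (forall u, wd_component u (a u)) -> \sum_u a u = 0 -> forall u, a u = 0;
  wd_semisimple_subalgebra : subalgebra (sum_of_components wd_component);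
  wd_split : forall x : B, exists y z : B,
    [/\ sum_of_components wd_component y, jacobson_radical z & x = y + z];
  wd_split_direct : forall x : B,
    sum_of_components wd_component x -> jacobson_radical x -> x = 0 }.

(* Below, the diagonal blocks are numbered by r : 'I_l in their order along the
   diagonal, block r has size d r, and M_(r,s) is submxblock M r s. *)

(* The two blocks are required to have the same shape; their entries are then
   compared at equal nat positions, 'I_(d r) and 'I_(d r') being only
   propositionally equal. *)
Definition proportional_gluing (K : fieldType) (l : nat) (d : 'I_l -> nat)
    (X : set 'M[K]_(\sum_r d r)) (r s r' s' : 'I_l) (nu : K) : Prop :=
  [/\ d r = d r', d s = d s'
    & forall M, X M -> forall (i : 'I_(d r)) (j : 'I_(d s))
        (i' : 'I_(d r')) (j' : 'I_(d s')), i = i' :> nat -> j = j' :> nat ->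
        submxblock M r' s' i' j' = nu * submxblock M r s i j].

(* Block r belongs to the component u = c r, so that s_u is the number of r
   with c r = u, and two blocks are diagonally glued when c r = c s. *)
Record wedderburn_block_form (F : fieldType) (K : closedFieldType)
    (iota : {rmorphism F -> K}) (B : algType F)
    (W : wedderburn_decomposition iota B) (l : nat) (c : 'I_l -> 'I_(wd_size W))
    (rho : representation iota B (\sum_r wd_degree (c r))) : Prop :=
  WedderburnBlockForm {
  wbf_closed : zariski_closure (range rho) = range rho;
  wbf_multiplicity : forall u, exists r, c r = u;
  wbf_component_blocks : forall u x, wd_component u x ->
    forall r s : 'I_l, r != s \/ c r != u -> submxblock (rho x) r s = 0;
  wbf_component_iso : forall r,
    let block := fun x => submxblock (rho x) r r in
    algebra_iso iota (wd_component (c r)) (block @` wd_component (c r)) block;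
  wbf_radical : forall x, jacobson_radical x ->
    forall r s : 'I_l, (s <= r)%N -> submxblock (rho x) r s = 0;
  wbf_identical_gluing : infinite_set [set: F] -> forall r s, c r = c s ->
    proportional_gluing (d := fun r => wd_degree (c r)) (range rho) r r s s 1 }.

Record full_quiver (K : fieldType) := FullQuiver {
  fq_size : nat;
  fq_degree : 'I_fq_size -> nat;
  fq_field : 'I_fq_size -> set K;
  fq_numeral : 'I_fq_size -> nat;
  fq_arrow : 'I_fq_size -> 'I_fq_size -> Prop;
  fq_gluing : 'I_fq_size -> 'I_fq_size -> 'I_fq_size -> 'I_fq_size -> K -> Prop
}.

Definition block_unit (K : fieldType) (l : nat) (d : 'I_l -> nat) (r : 'I_l)
    : 'M[K]_(\sum_i d i) := \mxdiag_(i < l) ((i == r)%:R%:M : 'M[K]_(d i)).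

Definition full_quiver_of (F : fieldType) (K : closedFieldType)
    (iota : {rmorphism F -> K}) (B : algType F)
    (W : wedderburn_decomposition iota B) (l : nat) (c : 'I_l -> 'I_(wd_size W))
    (rho : representation iota B (\sum_r wd_degree (c r))) : full_quiver K :=
  let d r := wd_degree (c r) in
  {| fq_size := l;
     fq_degree := d;
     fq_field := fun r => wd_field (c r);
     fq_numeral := fun r => c r;
     fq_arrow := fun r s => (r < s)%N /\
       exists x, block_unit K d r *m rho x *m block_unit K d s != 0;
     fq_gluing := proportional_gluing (d := d) (range rho) |}.

Definition mx_var (K : fieldType) (N : nat) (i j : 'I_N) : {mpoly K[N * N]} :=
  'X_(mxvec_index i j).

Inductive gluing_generator (K : fieldType) (Q : full_quiver K)
    (X : set 'M[K]_(\sum_r fq_degree (f := Q) r)) :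
    {mpoly K[(\sum_r fq_degree (f := Q) r) * (\sum_r fq_degree (f := Q) r)]} ->
    Prop :=
| VanishingEntry r s (i : 'I_(fq_degree r)) (j : 'I_(fq_degree s)) of
    (forall M, X M -> submxblock M r s = 0) :
    gluing_generator X (mx_var K (tagnat.Rank r i) (tagnat.Rank s j))
| GluedEntries r s r' s' nu (i : 'I_(fq_degree r)) (j : 'I_(fq_degree s))
    (i' : 'I_(fq_degree r')) (j' : 'I_(fq_degree s')) of
    fq_gluing r s r' s' nu & i = i' :> nat & j = j' :> nat :
    gluing_generator X (mx_var K (tagnat.Rank r' i') (tagnat.Rank s' j')
                        - nu *: mx_var K (tagnat.Rank r i) (tagnat.Rank s j)).

Definition ideal_generated (R : comPzRingType) (G : set R) : set R :=
  [set x | exists2 t : seq (R * R),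
     forall p, p \in t -> G p.2 & x = \sum_(p <- t) p.1 * p.2].

(* Formal consequence is membership in the ideal of K[lambda_ij] generated by
   the given relations. *)
Definition relations_are_consequences_of_gluing (K : fieldType)
    (Q : full_quiver K) (X : set 'M[K]_(\sum_r fq_degree (f := Q) r)) : Prop :=
  forall f, polynomial_relation X f -> ideal_generated (gluing_generator X) f.

(* Main.v *)
Require Import Defs.
From HB Require Import structures.
From mathcomp Require Import all_boot all_order all_algebra all_field.
From mathcomp Require Import boolp classical_sets cardinality.
From mathcomp Require Import finmap mpoly.

Set Implicit Arguments.
Unset Strict Implicit.
Unset Printing Implicit Defensive.

Import GRing.Theory.

Local Open Scope ring_scope.

(** As F is infinite, the closure of rho(A) is the K-span of rho(A), a
    finite-dimensional K-algebra R.  Inequivalent primitive idempotents r_u of R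
    give matrix units and a basic algebra C = (+) K r_u (+) N, and a
    representation of C with vertices of types c(q) inflates to one of R whose
    (q,w) block has size d(c(q)) x d(c(w)).  Choose a basis b_1, ..., b_m of N
    made of homogeneous elements such that b_i b_j lies in the span of the b_l
    with l > i, j.  All relations of the inflated representation come from
    proportional gluing as soon as the matrices of the b_i have disjoint
    supports, and the point is to find a faithful such representation of C.

    Let "label" mean an index i of the basis, and call a C-module with a basis of
    vertices good if each of its matrix entries involves at most one label.  By
    induction on j, a good module on which all labels below j occur exists over
    C / (b_j, ..., b_m): embed the regular module of C / (b_(j+1), ..., b_m) in a
    good module by adding its vertices one at a time.  The column of a new vertex
    v over a good module V may have a bad entry in row a, but the labels i < j of
    that entry can be removed: take a fresh copy of the good module G obtained
    for j, in which i occurs at a position (p, q), and in V (+) G + v replace v by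
    v + g q and p by p + a for a suitable scalar g.  The new columns and rows are
    copies of good ones. *)

(** * Idempotents and radical of a finite-dimensional algebra *)

(** With disjoint supports, faithfulness only asks that every label occurs somewhere and that every
    type has a vertex; so the induction carries occurrence along rather than injectivity. The
    regular module is faithful but need not be good, since [b i * b c] and [b i' * b c] may share a
    term, and a change of basis inside it may just move the surplus labels elsewhere. Hence the
    copies of G enter as direct summands before the conjugation: the old module stays embedded, so
    no label is lost. What can be removed is what occurs in G, the labels below j; the labels above
    j act by zero at that stage, so at most the label j survives in an entry of the new column, and
    a single label is harmless. Since products of basis elements lie in later ones, b_j, ..., b_m
    span an ideal for each j, and the quotients used by the induction exist. *)

Section Nilpotent.
Variable R : nzRingType.

Definition nilpotent_elt (x : R) : Prop := exists N, x ^+ N = 0.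

Lemma nilpotent_mulC x y : nilpotent_elt (x * y) -> nilpotent_elt (y * x).
Proof.
case=> N xyN; exists N.+1.
have E n : (y * x) ^+ n.+1 = y * (x * y) ^+ n * x.
  elim: n => [|n IH]; first by rewrite !expr0 mulr1.
  by rewrite exprS IH [in RHS]exprS !mulrA.
by rewrite E xyN mulr0 mul0r.
Qed.

Lemma nilpotent_inv1B x : nilpotent_elt x ->
  exists y, (1 - x) * y = 1 /\ y * (1 - x) = 1.
Proof.
case=> N xN; exists (\sum_(i < N) x ^+ i).
have e : (1 - x) * (\sum_(i < N) x ^+ i) = 1.
  by apply: oppr_inj; rewrite -mulNr opprB -subrX1 xN sub0r.
split=> //; rewrite -[RHS]e; apply/commr_sym/commr_sum => i _.
apply: commrX; apply/commr_sym; apply: commrB; first exact: commr1.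
exact: commr_refl.
Qed.

End Nilpotent.

Section Subspaces.
Variable K : fieldType.

(** [P] is an arbitrary predicate, so the subspace is found by maximality: it grows by a vector of
    [P] outside it until there is none, and [n] bounds the number of enlargements. *)
Lemma subspace_vspace (V : vectType K) (P : V -> Prop) : P 0 ->
  (forall x y, P x -> P y -> P (x + y)) -> (forall a x, P x -> P (a *: x)) ->
  exists U : {vspace V}, forall x, x \in U <-> P x.
Proof.
move=> P0 PD PZ.
suff main n (U : {vspace V}) : (\dim {:V} < \dim U + n)%N ->
    (forall x, x \in U -> P x) -> exists U : {vspace V}, forall x, x \in U <-> P x.
  apply: (main (\dim {:V}).+1 0%VS); first by rewrite dimv0 add0n.
  by move=> x; rewrite memv0 => /eqP ->.
elim: n U => [U|n IH U lt UP].
  by rewrite addn0 ltnNge (dimvS (subvf U)).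
have [[x [Px xU]]|nx] := pselect (exists x, P x /\ x \notin U); last first.
  exists U => x; split; first exact: UP.
  by move=> Px; apply: contraT => xU; case: nx; exists x.
apply: (IH (U + <[x]>)%VS); last first.
  move=> _ /memv_addP[y yU [_ /vlineP[a ->] ->]].
  by apply: PD; [exact: UP|exact: PZ].
apply: leq_trans lt _; rewrite addnS -addSn leq_add2r ltn_neqAle.
rewrite dimvS ?addvSl // andbT; apply: contra xU => dd.
have /eqP -> : U == (U + <[x]>)%VS by rewrite eqEdim addvSl (eqP dd) /=.
by apply: (subvP (addvSr _ _)); rewrite memv_line.
Qed.

End Subspaces.

(** * Local corners of primitive idempotents and the Peirce decomposition *)

Section LocalAlgebras.
Variables (K : closedFieldType) (R : falgType K).
Implicit Types x y e f : R.

Lemma annihilating_poly x : exists2 p : {poly K}, p != 0 & horner_alg x p = 0.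
Proof.
pose n := (\dim {:R}).+1.
pose X := [tuple x ^+ i | i < n].
have /vector.freeP nf : ~~ free X.
  apply/negP => /eqP fX; have := dimvS (subvf <<X>>%VS).
  by rewrite fX size_tuple /n ltnn.
have [c [c0 [i ci]]] : exists c : 'I_n -> K,
    \sum_(i < n) c i *: X`_i = 0 /\ exists i, c i != 0.
  apply: contrapT => nex; apply: nf => c c0 i; apply: contrapT => /eqP ci.
  by apply: nex; exists c; split=> //; exists i.
exists (\poly_(i < n) c (inord i)).
  apply: contraNneq ci => /polyP /(_ i); rewrite coef_poly ltn_ord coef0.
  by rewrite inord_val => ->.
rewrite poly_def rmorph_sum -[RHS]c0; apply: eq_bigr => j _.
rewrite -mul_polyC rmorphM /= horner_algC mulr_algl inord_val rmorphXn /=.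
by rewrite horner_algX (nth_mktuple _ _ j).
Qed.

Definition primitive_idempotent e : Prop :=
  [/\ e * e = e, e != 0 & forall f, f * f = f -> e * f = f -> f * e = f ->
    f = 0 \/ f = e].

Definition in_corner e f x : Prop := e * x = x /\ x * f = x.

(** The corner of [e] is local with residue field [K]. Write an annihilating polynomial as [q] times
    a power of ['X - a] prime to [q]. Bezout splits [e] into two orthogonal idempotents and
    primitivity kills one: either [x - a e] is nilpotent, or [q] already annihilates [x] in the
    corner and the degree drops. *)
Lemma primitive_eigenvalue e x : primitive_idempotent e -> in_corner e e x ->
  exists a : K, nilpotent_elt (x - a *: e).
Proof.
move=> [ee e0 prim] [ex xe]; pose A := horner_alg x.
have AM p1 p2 : A (p1 * p2) = A p1 * A p2 by exact: rmorphM.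
have AD p1 p2 : A (p1 + p2) = A p1 + A p2 by exact: rmorphD.
have AX p1 n : A p1 ^+ n = A (p1 ^+ n) by rewrite /A rmorphXn.
have A1 : A 1 = 1 by exact: rmorph1.
have cA p : A p * e = e * A p.
  elim/poly_ind: p => [|p c IH]; first by rewrite /A raddf0 mul0r mulr0.
  rewrite /A rmorphD rmorphM /= horner_algX horner_algC mulrDl mulrDr.
  rewrite -/(A p) -mulrA xe mulrA -IH -[RHS]/(_ + _) -mulrA ex.
  by rewrite -scalerAl -scalerAr mul1r mulr1.
have [p p0 Ap] := annihilating_poly x.
have {Ap} : A p * e = 0 by rewrite /A Ap mul0r.
have [n] := ubnP (size p); elim: n p p0 => // n IH p p0 pn Ape.
have [/eqP sp|sp] := boolP (size p == 1%N).
  move/eqP/size_poly1P: sp => [c c0 pc]; move: Ape.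
  rewrite pc /A horner_algC -scalerAl mul1r => /eqP.
  by rewrite scaler_eq0 (negPf c0) (negPf e0).
have [a ra] := closed_rootP _ sp.
have [m [q]] := multiplicity_XsubC p a; rewrite p0 /= => qa pE.
have m0 : (0 < m)%N by case: m pE => // pE; rewrite pE mulr1 (negPf qa) in ra.
have q0 : q != 0 by apply: contraNneq p0 => q0; rewrite pE q0 mul0r.
have sq : (size q < n)%N.
  rewrite -ltnS; apply: leq_trans pn; rewrite ltnS pE.
  rewrite size_Mmonic ?monic_exp ?monicXsubC // size_exp_XsubC addnS /=.
  by rewrite -[X in (X < _)%N]addn0 ltn_add2l.
have /Bezout_eq1_coprimepP[[u1 u2] /= bez] : coprimep q (('X - a%:P) ^+ m).
  by rewrite coprimep_expr // coprimep_XsubC.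
set d := ('X - a%:P) ^+ m in pE bez.
pose f := A (u2 * d) * e; pose g := A (u1 * q) * e.
have fg : f + g = e by rewrite -mulrDl -AD addrC bez A1 mul1r.
have Ae p1 p2 : A p1 * e * (A p2 * e) = A (p1 * p2) * e.
  by rewrite -mulrA (mulrA e) -cA -(mulrA _ e e) ee mulrA AM.
have fg0 : f * g = 0.
  rewrite Ae (_ : u2 * d * (u1 * q) = u2 * u1 * p); last by rewrite pE (mulrC q) (mulrACA u2).
  by rewrite AM -mulrA Ape mulr0.
have ff : f * f = f.
  by rewrite -[X in _ * X](addrK g) fg mulrBr fg0 subr0 -mulrA ee.
have ef : e * f = f by rewrite /f mulrA -cA -mulrA ee.
have fe' : f * e = f by rewrite /f -mulrA ee.
have [f0|fe] := prim f ff ef fe'.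
- exists a, m.
  have -> : x - a *: e = A ('X - a%:P) * e.
    by rewrite /A rmorphB /= horner_algX horner_algC mulrBl xe -scalerAl mul1r.
  rewrite exprMn_comm; last exact: cA.
  have -> : e ^+ m = e.
    case: m m0 {pE d bez f g fg fg0 ff f0 ef fe'} => // m _.
    by elim: m => // m IHm; rewrite exprS IHm.
   rewrite AX -/d -[d]mulr1 -bez mulrDr.
  rewrite mulrCA [d * q]mulrC -pE.
  rewrite AD !AM mulrDl -!mulrA Ape mulr0 add0r.
  by rewrite (mulrA (A u2)) -AM -/f f0 mulr0.
- have g0 : g = 0 by apply: (addrI f); rewrite fg addr0 fe.
  apply: (IH q) => //.
  have qE : q * (u1 * q) + u2 * p = q.
    by rewrite pE (mulrCA u2) -mulrDr bez mulr1.
  by rewrite -/(A q) -qE AD !AM mulrDl -!mulrA Ape mulr0 addr0 (mulrA (A u1)) -AM -/g g0 mulr0.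
Qed.

(** In the corner, [x] is [a] times [e - t] with [t] nilpotent, and the inverse of [1 - t] computed
    in [R] commutes with [e]. *)
Lemma corner_inverse e x (a : K) : e * e = e -> in_corner e e x -> a != 0 ->
  nilpotent_elt (x - a *: e) ->
  exists z, [/\ in_corner e e z, x * z = e & z * x = e].
Proof.
move=> ee [ex xe] a0 [N nN]; pose t := - a^-1 *: (x - a *: e).
have et : e * t = t by rewrite /t -scalerAr mulrBr ex -scalerAr ee.
have te : t * e = t by rewrite /t -scalerAl mulrBl xe -scalerAl ee.
have [|S [tS St]] := @nilpotent_inv1B R t.
  by exists N; rewrite /t exprZn nN scaler0.
have ce : e * (1 - t) = (1 - t) * e by rewrite mulrBr mulrBl mulr1 mul1r et te.
have cS : e * S = S * e.
  by rewrite -[RHS]mulr1 -tS mulrA -(mulrA S e) ce !mulrA St mul1r.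
have xE : x = a *: (e * (1 - t)).
  rewrite mulrBr mulr1 et /t scaleNr opprK scalerDr scalerA mulfV // scale1r.
  by rewrite addrC subrK.
exists (a^-1 *: (e * S)); split; first split.
- by rewrite -scalerAr mulrA ee.
- by rewrite -scalerAl -mulrA -cS mulrA ee.
- rewrite {1}xE -scalerAl -scalerAr scalerA mulfV // scale1r ce -mulrA.
  by rewrite (mulrA e e) ee cS mulrA tS mul1r.
- rewrite {1}xE -scalerAl -scalerAr scalerA mulVf // scale1r cS -mulrA.
  by rewrite (mulrA e e) ee ce mulrA St mul1r.
Qed.

Lemma nilpotent_not_right_unit e x z : e != 0 -> x * e = x -> x * z = e ->
  ~ nilpotent_elt x.
Proof.
move=> e0 xe xz [N xN]; case/negP: e0; apply/eqP; rewrite -xz.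
suff -> : x = 0 by rewrite mul0r.
case: N xN => [|N]; first by rewrite expr0 => /eqP; rewrite oner_eq0.
elim: N => [|N IH] // xN; apply: IH.
(* The right inverse [z] lowers the vanishing power by one, down to [x = 0]. *)
have -> : x ^+ N.+1 = x ^+ N.+2 * z.
  by rewrite (exprSr x N.+1) -mulrA xz exprSr -mulrA xe.
by rewrite xN mul0r.
Qed.

Lemma primitive_nilpotentP e x : primitive_idempotent e -> in_corner e e x ->
  nilpotent_elt x \/ exists z, [/\ in_corner e e z, x * z = e & z * x = e].
Proof.
move=> pe cx; have [a na] := primitive_eigenvalue pe cx.
have [a0|a0] := eqVneq a 0; first by left; move: na; rewrite a0 scale0r subr0.
by right; have [ee _ _] := pe; apply: corner_inverse na.
Qed.

Lemma primitive_nilpotentM e x y : primitive_idempotent e ->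
  in_corner e e x -> in_corner e e y -> nilpotent_elt x -> nilpotent_elt (x * y).
Proof.
move=> pe [ex xe] [ey ye] nx.
have cxy : in_corner e e (x * y) by split; rewrite ?mulrA ?ex // -mulrA ye.
have [//|[z [_ xyz _]]] := primitive_nilpotentP pe cxy.
have [_ e0 _] := pe; rewrite -mulrA in xyz.
by case: (nilpotent_not_right_unit e0 xe xyz nx).
Qed.

(** If [x + y] had an inverse [z], then [x z = e - y z] with [y z] nilpotent would be invertible,
    against the nilpotency of [x z]. *)
Lemma primitive_nilpotentD e x y : primitive_idempotent e ->
  in_corner e e x -> in_corner e e y ->
  nilpotent_elt x -> nilpotent_elt y -> nilpotent_elt (x + y).
Proof.
move=> pe cx cy nx ny; have [[ex xe] [ey ye]] := (cx, cy).
have [ee e0 _] := pe.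
have cxy : in_corner e e (x + y) by split; rewrite ?mulrDr ?mulrDl ?ex ?xe ?ey ?ye.
have [//|[z [cz xyz _]]] := primitive_nilpotentP pe cxy.
have cxz : in_corner e e (x * z) by case: cz => _ ze; split; rewrite ?mulrA ?ex // -mulrA ze.
have nxz := primitive_nilpotentM pe cx cz nx.
have [N yzN] := primitive_nilpotentM pe cy cz ny.
have [|w [_ w1 _]] := @corner_inverse e (x * z) 1 ee cxz (oner_neq0 _).
  exists N; rewrite scale1r -xyz mulrDl opprD addrA subrr add0r exprNn yzN.
  by rewrite mulr0.
by case: (nilpotent_not_right_unit e0 cxz.2 w1 nxz).
Qed.

(** Equivalently, the right ideals [e R] and [f R] are isomorphic modules. *)
Definition idempotent_equiv e f : Prop := exists u v,
  [/\ in_corner e f u, in_corner f e v, u * v = e & v * u = f].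

Lemma idempotent_equiv_sym e f : idempotent_equiv e f -> idempotent_equiv f e.
Proof. by case=> u [v [? ? ? ?]]; exists v, u. Qed.

Lemma idempotent_equiv_trans e f g :
  idempotent_equiv e f -> idempotent_equiv f g -> idempotent_equiv e g.
Proof.
case=> u [v [[eu uf] [fv ve] uv vu]] [u' [v' [[fu' u'g] [gv' v'f] uv' vu']]].
exists (u * u'), (v' * v); split; [split|split| |].
- by rewrite mulrA eu.
- by rewrite -mulrA u'g.
- by rewrite mulrA gv'.
- by rewrite -mulrA ve.
- by rewrite mulrA -(mulrA u) uv' uf.
- by rewrite mulrA -(mulrA v') vu v'f.
Qed.

(** Were [x * y] invertible in the corner of [e], a right multiple [y'] of [y] would satisfy
    [x * y' = e], and [y' * x] would be a nonzero idempotent under [f], hence [f] itself: an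
    equivalence. *)
Lemma nonequiv_nilpotent e f x y : primitive_idempotent e ->
  primitive_idempotent f -> ~ idempotent_equiv e f ->
  in_corner e f x -> in_corner f e y -> nilpotent_elt (x * y).
Proof.
move=> pe [ff f0 primf] nef [ex xf] [fy ye]; have [ee e0 _] := pe.
have cxy : in_corner e e (x * y) by split; rewrite ?mulrA ?ex // -mulrA ye.
have [//|[z [[ez ze] xyz _]]] := primitive_nilpotentP pe cxy.
pose y' := y * z; have xy' : x * y' = e by rewrite mulrA.
have fy' : f * y' = y' by rewrite /y' mulrA fy.
have y'e : y' * e = y' by rewrite /y' -mulrA ze.
have [|||h|h] := primf (y' * x).
- by rewrite mulrA -(mulrA y') xy' y'e.
- by rewrite mulrA fy'.
- by rewrite -mulrA xf.
- case/negP: e0; apply/eqP.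
  by rewrite -ee -{2}xy' -xy' mulrA -(mulrA x) h mulr0 mul0r.
- by case: nef; exists x, y'.
Qed.

(** An idempotent [e] that is not primitive splits as [f + (e - f)], and both right ideals are
    proper in [e R]: from [f R = e R] would follow [f e = e], whereas [f e = f]. *)
Lemma primitive_decomposition : exists s : seq R,
  [/\ uniq s, forall e, e \in s -> primitive_idempotent e,
      forall e f, e \in s -> f \in s -> e != f -> e * f = 0
    & \sum_(e <- s) e = 1].
Proof.
suff main n e : (\dim (limg (amull e)) < n)%N -> e * e = e -> exists s : seq R,
    [/\ uniq s, forall f, f \in s -> primitive_idempotent f /\ in_corner e e f,
        forall f g, f \in s -> g \in s -> f != g -> f * g = 0
      & \sum_(f <- s) f = e].
  have [|s [us ps os s1]] := main _ 1 (leqnn _); first by rewrite mulr1.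
  by exists s; split=> // e /ps[].
elim: n e => // n IH e dn ee.
have [->|e0] := eqVneq e 0.
  by exists [::]; split=> //; rewrite big_nil.
have [pe|npe] := pselect (primitive_idempotent e).
  exists [:: e]; split=> // [f|f g|]; last by rewrite big_seq1.
    by rewrite inE => /eqP->; split.
  by rewrite !inE => /eqP-> /eqP->; rewrite eqxx.
have [f [ff ef fe f0 fne]] : exists f, [/\ f * f = f, e * f = f, f * e = f,
    f != 0 & f != e].
  apply: contrapT => nex; apply: npe; split=> // f ff ef fe.
  have [->|f0] := eqVneq f 0; first by left.
  by have [->|fne] := eqVneq f e; [right|case: nex; exists f].
have smaller f' : e * f' = f' -> f' * f' = f' -> f' * e = f' -> f' != e ->
    (\dim (limg (amull f')) < n)%N.
  move=> ef' f'f' f'e ne; rewrite -ltnS; apply: leq_trans dn; rewrite ltnS.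
  rewrite ltn_neqAle dimvS ?andbT; last first.
    apply/subvP => _ /memv_imgP[y _ ->]; apply/memv_imgP.
    by exists (f' * y); rewrite ?memvf // !lfunE /= mulrA ef'.
  apply: contraNneq ne => dd; apply/eqP.
  have sub : (limg (amull f') <= limg (amull e))%VS.
    apply/subvP => _ /memv_imgP[y _ ->]; apply/memv_imgP.
    by exists (f' * y); rewrite ?memvf // !lfunE /= mulrA ef'.
  have /eqP eqv : limg (amull f') == limg (amull e) by rewrite eqEdim sub dd /=.
  have : e \in limg (amull f').
    by rewrite eqv; apply/memv_imgP; exists e; rewrite ?memvf // lfunE /= ee.
  by case/memv_imgP => y _; rewrite lfunE /= => eE; rewrite -f'e {1}eE mulrA f'f' -eE.
pose g := e - f.
have gg : g * g = g by rewrite /g mulrBr !mulrBl ee fe ef ff subrr subr0.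
have eg : e * g = g by rewrite /g mulrBr ee ef.
have ge : g * e = g by rewrite /g mulrBl ee fe.
have fg : f * g = 0 by rewrite /g mulrBr fe ff subrr.
have gf : g * f = 0 by rewrite /g mulrBl ef ff subrr.
have gne : g != e.
  by rewrite /g -subr_eq0 addrAC subrr sub0r oppr_eq0.
have [s [us ps os sf]] := IH f (smaller f ef ff fe fne) ff.
have [t [ut pt ot tg]] := IH g (smaller g eg gg ge gne) gg.
have st x y : x \in s -> y \in t -> x * y = 0 /\ y * x = 0.
  move=> /ps[_ [fx xf]] /pt[_ [gy yg]]; split.
    by rewrite -xf -gy mulrA -(mulrA x) fg mulr0 mul0r.
  by rewrite -yg -fx mulrA -(mulrA y) gf mulr0 mul0r.
exists (s ++ t); split.
- rewrite cat_uniq us ut andbT; apply/hasPn => x xt; apply/negP => xs.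
  have [[xx x0 _] _] := ps x xs.
  by case/negP: x0; rewrite -xx (st x x xs xt).1.
- move=> x; rewrite mem_cat => /orP[/ps|/pt] [px [ex xe]]; split=> //; split.
  + by rewrite -ex mulrA ef.
  + by rewrite -xe -mulrA fe.
  + by rewrite -ex mulrA eg.
  + by rewrite -xe -mulrA ge.
- move=> x y; rewrite !mem_cat => /orP[xs|xt] /orP[ys|yt] ne.
  + exact: os.
  + by case: (st x y xs yt).
  + by case: (st y x ys xt).
  + exact: ot.
- by rewrite big_cat /= sf tg /g addrC subrK.
Qed.

(** Primitive idempotents are grouped by equivalence: [r u] represents a class, [d u] is its size,
    and [P u i], [Q u i] are mutually inverse isomorphisms between its i-th member and [r u]. *)
Lemma peirce_decomposition :
  exists (k : nat) (d : 'I_k -> nat) (r : 'I_k -> R) (P Q : 'I_k -> nat -> R),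
  [/\ forall u, (0 < d u)%N, forall u, primitive_idempotent (r u)
    & forall u v, u != v -> r u * r v = 0 /\ ~ idempotent_equiv (r u) (r v)] /\
  [/\ forall u i, P u i * r u = P u i, forall u i, r u * Q u i = Q u i,
      forall u v i j, (i < d u)%N -> (j < d v)%N ->
        Q u i * P v j = if (u == v) && (i == j) then r u else 0
    & \sum_u \sum_(i < d u) P u i * Q u i = 1].
Proof.
have [s [us ps os s1]] := primitive_decomposition.
pose T := 'I_(size s); pose a (t : T) := s`_t.
have pa t : primitive_idempotent (a t) by apply: ps; rewrite mem_nth.
have oa t t' : t != t' -> a t * a t' = 0.
  by move=> ne; apply: os; rewrite ?mem_nth // nth_uniq.
have sa : \sum_t a t = 1 by rewrite -s1 (big_nth 0) big_mkord.
pose eqv t t' := `[< idempotent_equiv (a t) (a t') >].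
have eqv_refl t : eqv t t.
  apply/asboolP; exists (a t), (a t); have [aa _ _] := pa t.
  by split=> //; split.
have eqv_sym t t' : eqv t t' -> eqv t' t.
  by move=> /asboolP h; apply/asboolP; exact: idempotent_equiv_sym.
have eqv_trans t1 t2 t3 : eqv t1 t2 -> eqv t2 t3 -> eqv t1 t3.
  by move=> /asboolP h /asboolP h'; apply/asboolP; exact: idempotent_equiv_trans h h'.
(* The representative depends on the class alone: equivalent [t] and [t'] give extensionally equal
   predicates to [pick]. *)
pose rep t := odflt t [pick t' | eqv t t'].
have rep_eqv t : eqv t (rep t).
  by rewrite /rep; case: pickP => //= /(_ t); rewrite eqv_refl.
have rep_const t t' : eqv t t' -> rep t = rep t'.
  move=> e; have E : eqv t =1 eqv t'.
    by move=> x; apply/idP/idP; apply: eqv_trans => //; exact: eqv_sym.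
  rewrite /rep (eq_pick E).
  by case: pickP => //= /(_ t'); rewrite eqv_refl.
have rep_rep t : rep (rep t) = rep t by rewrite -(rep_const _ _ (rep_eqv t)).
have [w wP] : {w : T -> R * R & forall t,
    [/\ in_corner (a t) (a (rep t)) (w t).1, in_corner (a (rep t)) (a t) (w t).2,
        (w t).1 * (w t).2 = a t & (w t).2 * (w t).1 = a (rep t)]}.
  apply: (@choice _ _ (fun t (x : R * R) =>
    [/\ in_corner (a t) (a (rep t)) x.1, in_corner (a (rep t)) (a t) x.2,
        x.1 * x.2 = a t & x.2 * x.1 = a (rep t)])) => t.
  by have /asboolP[x [y h]] := rep_eqv t; exists (x, y).
pose A := [set t | rep t == t].
pose cl (u : 'I_#|A|) := enum [set t | rep t == enum_val u].
pose el u i := nth (enum_val u) (cl u) i.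
have repA (u : 'I_#|A|) : rep (enum_val u) = enum_val u.
  by have := enum_valP u; rewrite inE => /eqP.
have rep_el u i : rep (el u i) = enum_val u.
  have [lt|ge] := ltnP i (size (cl u)); last by rewrite /el nth_default.
  by have := mem_nth (enum_val u) lt; rewrite mem_enum inE => /eqP.
exists #|A|, (fun u => size (cl u)), (fun u => a (enum_val u)),
  (fun u i => (w (el u i)).1), (fun u i => (w (el u i)).2); split; split.
- move=> u; rewrite -has_predT; apply/hasP; exists (enum_val u) => //.
  by rewrite mem_enum inE repA.
- by move=> u; exact: pa.
- move=> u v ne; split.
    by apply: oa; apply: contraNneq ne => /enum_val_inj ->.
  move=> h; case/negP: ne; apply/eqP/enum_val_inj.
  by rewrite -(repA u) -(repA v); apply: rep_const; apply/asboolP.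
- by move=> u i; have [[_ h] _ _ _] := wP (el u i); rewrite rep_el in h.
- by move=> u i; have [_ [h _] _ _] := wP (el u i); rewrite rep_el in h.
- move=> u v i j lu lv; have [_ [_ h2] _ q2] := wP (el u i).
  have [[h1 _] _ _ _] := wP (el v j).
  have [e|ne] := eqVneq (el u i) (el v j).
    have uv : u = v by apply: enum_val_inj; rewrite -(rep_el u i) -(rep_el v j) e.
    subst v; have ij : i = j.
      by apply/eqP; rewrite -(nth_uniq (enum_val u) lu lv) ?enum_uniq // -/(el u i) e.
    by rewrite -ij !eqxx /= q2 rep_el.
  have -> : (u == v) && (i == j) = false.
    by apply: contraNF ne => /andP[/eqP-> /eqP->].
  by rewrite -h2 -h1 -mulrA (mulrA (a _)) oa // mul0r mulr0.
- transitivity (\sum_(x in A) \sum_(t | rep t == x) a t); last first.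
    rewrite -sa [RHS](partition_big rep (mem A)) => [//|t _].
    by rewrite -[mem A _]/(rep t \in A) inE rep_rep.
  rewrite [RHS]big_enum_val; apply: eq_bigr => u _.
  rewrite -(big_mkord xpredT (fun i => (w (el u i)).1 * (w (el u i)).2)).
  rewrite -(big_nth (enum_val u) xpredT (fun t => (w t).1 * (w t).2)) big_enum /=.
  by apply: eq_big => t; rewrite ?inE // => _; case: (wP t).
Qed.

(** * The radical of the basic algebra and an adapted basis *)

Section RadicalBasis.
Variables (k : nat) (r : 'I_k -> R).
Hypothesis r_prim : forall u, primitive_idempotent (r u).
Hypothesis r_orth : forall u v, u != v ->
  r u * r v = 0 /\ ~ idempotent_equiv (r u) (r v).

Let rr u : r u * r u = r u. Proof. by case: (r_prim u). Qed.

Let rM u v : r u * r v = if u == v then r u else 0.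
Proof. by have [->|/r_orth[]] := eqVneq u v. Qed.

Let eps := \sum_u r u.

Let r_eps u : r u * eps = r u.
Proof.
rewrite mulr_sumr (bigD1 u) //= rr big1 ?addr0 // => v.
by rewrite eq_sym => /r_orth[].
Qed.

Let eps_r u : eps * r u = r u.
Proof. by rewrite mulr_suml (bigD1 u) //= rr big1 ?addr0 // => v /r_orth[]. Qed.

(** The Jacobson radical of [eps R eps]. Only the diagonal corners carry a condition: the [r u]
    being pairwise inequivalent, the off-diagonal corners lie in the radical automatically. *)
Definition basic_radical (x : R) : Prop :=
  [/\ eps * x = x, x * eps = x & forall u, nilpotent_elt (r u * x * r u)].

Let corner_rr u v x : in_corner (r u) (r v) (r u * x * r v).
Proof. by split; rewrite ?mulrA ?rr // -mulrA rr. Qed.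

Let diag_mul u x y : x * eps = x ->
  r u * (x * y) * r u = \sum_v (r u * x * r v) * (r v * y * r u).
Proof.
move=> xe; rewrite -{1}xe -!mulrA /eps mulr_suml !mulr_sumr.
by apply: eq_bigr => v _; rewrite !mulrA -(mulrA _ (r v) (r v)) rr.
Qed.

Let nilpotent_sum u (I : finType) (F : I -> R) :
  (forall i, in_corner (r u) (r u) (F i) /\ nilpotent_elt (F i)) ->
  nilpotent_elt (\sum_i F i).
Proof.
move=> h; suff [] : in_corner (r u) (r u) (\sum_i F i) /\
  nilpotent_elt (\sum_i F i) by [].
apply: (big_ind (fun x => in_corner (r u) (r u) x /\ nilpotent_elt x)) => //.
  by split; [split; rewrite ?mulr0 ?mul0r|exists 1%N; rewrite expr1].
move=> x y [[ex xe] nx] [[ey ye] ny]; split; last exact: (primitive_nilpotentD (r_prim u)).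
by split; rewrite ?mulrDr ?mulrDl ?ex ?xe ?ey ?ye.
Qed.

Let nilpotent_part u v x y :
  nilpotent_elt (r u * x * r u) \/ nilpotent_elt (r u * y * r u) ->
  nilpotent_elt ((r u * x * r v) * (r v * y * r u)).
Proof.
move=> h; have [<-|/r_orth[_ ne]] := eqVneq u v; last first.
  exact: (nonequiv_nilpotent (r_prim u) (r_prim v) ne).
case: h => h; first exact: (primitive_nilpotentM (r_prim u)).
by apply: nilpotent_mulC; exact: (primitive_nilpotentM (r_prim u)).
Qed.

Let corner_part u v x y : in_corner (r u) (r u) ((r u * x * r v) * (r v * y * r u)).
Proof. by split; rewrite ?mulrA ?rr // -mulrA rr. Qed.

Lemma basic_radicalMr x y : basic_radical x -> y * eps = y -> basic_radical (x * y).
Proof.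
case=> ex xe nx ye; split; rewrite ?mulrA ?ex // -?mulrA ?ye // => u.
rewrite diag_mul //; apply: (@nilpotent_sum u) => v; split; first exact: corner_part.
by apply: nilpotent_part; left.
Qed.

Lemma basic_radicalMl x y : basic_radical x -> eps * y = y -> y * eps = y ->
  basic_radical (y * x).
Proof.
case=> ex xe nx ey ye; split; rewrite ?mulrA ?ey // -?mulrA ?xe // => u.
rewrite diag_mul //; apply: (@nilpotent_sum u) => v; split; first exact: corner_part.
by apply: nilpotent_part; right.
Qed.

Lemma basic_radicalD x y : basic_radical x -> basic_radical y -> basic_radical (x + y).
Proof.
case=> ex xe nx [ey ye ny]; split; rewrite ?mulrDr ?mulrDl ?ex ?xe ?ey ?ye // => u.
rewrite mulrDr mulrDl; exact: (primitive_nilpotentD (r_prim u)).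
Qed.

Lemma basic_radicalZ (a : K) x : basic_radical x -> basic_radical (a *: x).
Proof.
case=> ex xe nx; split; rewrite -?scalerAr -?scalerAl ?ex ?xe // => u.
have [n h] := nx u; exists n.
by rewrite -scalerAr -scalerAl exprZn h scaler0.
Qed.

Lemma basic_radical0 : basic_radical 0.
Proof.
split; rewrite ?mulr0 ?mul0r // => u; exists 1%N.
by rewrite mulr0 mul0r expr1.
Qed.

Variable N : {vspace R}.
Hypothesis NP : forall x, x \in N <-> basic_radical x.

Let N_eps x : x \in N -> eps * x = x /\ x * eps = x.
Proof. by move=> /NP[]. Qed.

Let N_mul x y : x \in N -> y \in N -> x * y \in N.
Proof. by move=> /NP h /N_eps[_ ye]; apply/NP; exact: basic_radicalMr. Qed.

Let N_rl u x : x \in N -> r u * x \in N.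
Proof. by move=> /NP h; apply/NP; apply: basic_radicalMl; rewrite ?eps_r ?r_eps. Qed.

Let N_rr u x : x \in N -> x * r u \in N.
Proof. by move=> /NP h; apply/NP; apply: basic_radicalMr; rewrite ?r_eps. Qed.

Let N_peirce x : x \in N -> x = \sum_u \sum_v r u * x * r v.
Proof.
move=> /N_eps[ex xe]; rewrite -{1}ex -{1}xe mulr_suml; apply: eq_bigr => u _.
by rewrite /eps !mulr_sumr; apply: eq_bigr => v _; rewrite mulrA.
Qed.

(** The list grows at its head, and [N] multiplies each new head from both sides into the span of
    the tail. Hence a product of two members lies in the span of the members after both. *)
Fixpoint radical_chain (bs : seq R) : Prop :=
  if bs is b :: bs' then
    [/\ radical_chain bs', b \in N, b \notin <<bs'>>%VS,
        exists u v, in_corner (r u) (r v) b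
      & forall x, x \in N -> x * b \in <<bs'>>%VS /\ b * x \in <<bs'>>%VS]
  else True.

Lemma radical_chain_sub bs : radical_chain bs -> (<<bs>> <= N)%VS.
Proof.
elim: bs => [|b bs IH] /=; first by rewrite span_nil sub0v.
by case=> /IH sN bN _ _ _; rewrite span_cons subv_add sN andbT -memvE.
Qed.

Lemma radical_chain_free bs : radical_chain bs -> free bs.
Proof.
elim: bs => [|b bs IH] /=; first by rewrite nil_free.
by case=> /IH fb _ nb _ _; rewrite free_cons nb.
Qed.

(** So the span of a chain is an ideal of the basic algebra: stability under [N] is the chain
    condition, stability under the [r u] comes from homogeneity. *)
Lemma radical_chain_stable bs : radical_chain bs -> forall y, y \in <<bs>>%VS ->
  (forall x, x \in N -> x * y \in <<bs>>%VS /\ y * x \in <<bs>>%VS) /\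
  (forall u, r u * y \in <<bs>>%VS /\ y * r u \in <<bs>>%VS).
Proof.
elim: bs => [_ y|b bs IH]; first by rewrite span_nil memv0 => /eqP->;
  split=> *; rewrite mulr0 mul0r mem0v.
case=> /IH{}IH bN _ [s [t [sb bt]]] bx y.
have sub z : z \in <<bs>>%VS -> z \in <<b :: bs>>%VS.
  by rewrite span_cons; apply: (subvP (addvSr _ _)).
have bb (a : K) : a *: b \in <<b :: bs>>%VS by rewrite memvZ // memv_span ?mem_head.
rewrite {1}span_cons => /memv_addP[_ /vlineP[a ->] [z zs ->]].
have [zN zr] := IH z zs; split=> [x xN|u].
  have [xb bx'] := bx x xN; have [xz zx] := zN x xN.
  by split; rewrite ?mulrDr ?mulrDl -?scalerAr -?scalerAl; apply: rpredD;
    try apply: rpredZ; exact: sub.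
have [rz zr'] := zr u; split; rewrite ?mulrDr ?mulrDl -?scalerAr -?scalerAl.
  apply: rpredD; last exact: sub.
  have -> : r u * b = if u == s then b else 0.
    by rewrite -{1}sb mulrA rM; case: eqP => [->|_]; rewrite ?sb ?mul0r.
  by case: eqP; rewrite ?bb // scaler0 mem0v.
apply: rpredD; last exact: sub.
have -> : b * r u = if t == u then b else 0.
  by rewrite -{1}bt -mulrA rM; case: eqP => [_|_]; rewrite ?bt ?mulr0.
by case: eqP; rewrite ?bb // scaler0 mem0v.
Qed.

Let not_mem_sum (I : {vspace R}) (T : finType) (F : T -> R) :
  \sum_i F i \notin I -> exists i, F i \notin I.
Proof.
move=> h; apply: contrapT => nex; case/negP: h; apply: rpred_sum => i _.
by apply: contraT => ?; case: nex; exists i.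
Qed.

(** Descent on [v N + I], with [I] the span of the chain. If [v x] leaves [I], so does some
    [v' = v x r_s], and [v' N + I] is strictly smaller: otherwise [v'] would be congruent to [v' y']
    modulo [I] with [y'] nilpotent, and would lie in [I]. *)
Lemma radical_chain_right bs u v w : radical_chain bs ->
  v \in N -> v \notin <<bs>>%VS -> in_corner (r u) (r w) v ->
  exists v' w', [/\ v' \in N, v' \notin <<bs>>%VS, in_corner (r u) (r w') v'
    & forall x, x \in N -> v' * x \in <<bs>>%VS].
Proof.
move=> cb; set I := <<bs>>%VS.
have st := radical_chain_stable cb.
pose D v := (amull v @: N + I)%VS.
have [n] := ubnP (\dim (D v)); elim: n v w => // n IH v w dn vN vI [uv vw].
have [h|] := pselect (forall x, x \in N -> v * x \in I).
  by exists v, w; split=> //; split.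
move=> /existsNP[x /not_implyP[xN /negP vxI]].
have vxE : v * x = \sum_s v * x * r s.
  by rewrite -mulr_sumr -/eps -mulrA (N_eps xN).2.
have [s v'I] : exists s, v * x * r s \notin I by apply: not_mem_sum; rewrite -vxE.
set v' := v * x * r s in v'I.
have v'N : v' \in N by rewrite N_rr ?N_mul.
have xsN : x * r s \in N by rewrite N_rr.
have v's : v' * r s = v' by rewrite /v' -mulrA rr.
apply: (IH v' s) => //; last by split=> //; rewrite /v' !mulrA uv.
rewrite -ltnS; apply: leq_trans dn; rewrite ltnS.
have sub : (D v' <= D v)%VS.
  rewrite subv_add addvSr andbT; apply/subvP => _ /memv_imgP[y yN ->].
  apply: (subvP (addvSl _ _)); apply/memv_imgP; exists (x * r s * y).
    exact: N_mul.
  by rewrite !lfunE /= !mulrA.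
rewrite ltn_neqAle dimvS // andbT; apply: contra v'I => /eqP dd.
have /eqP eD : D v' == D v by rewrite eqEdim sub dd /=.
have : v' \in D v.
  apply: (subvP (addvSl _ _)); apply/memv_imgP; exists (x * r s) => //.
  by rewrite lfunE /= /v' mulrA.
rewrite -eD => /memv_addP[_ /memv_imgP[y yN ->] [i iI]].
(* Cut to the corner of [r s], [y] becomes nilpotent by the definition of [basic_radical]; nothing
   is lost, because [v' * r s = v']. *)
rewrite lfunE /= => v'E; pose y' := r s * y * r s.
have y'N : y' \in N by rewrite N_rr ?N_rl.
have d1 : v' - v' * y' \in I.
  have -> : v' - v' * y' = i * r s; last by have [_ /(_ s)[]] := st _ iI.
  by rewrite /y' !mulrA v's -{1}v's {1}v'E mulrDl addrC addrA addNr add0r.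
have [_ _ /(_ s)[m]] : basic_radical y by apply/NP.
rewrite -/y' => y'm.
suff : v' - v' * y' ^+ m \in I by rewrite y'm mulr0 subr0.
elim: m {y'm} => [|m IHm]; first by rewrite expr0 mulr1 subrr mem0v.
have -> : v' - v' * y' ^+ m.+1 = (v' - v' * y') + (v' - v' * y' ^+ m) * y'.
  by rewrite exprSr mulrBl mulrA addrA subrK.
by rewrite rpredD //; have [/(_ _ y'N)[]] := st _ IHm.
Qed.

(** The mirror descent on [N v + I]. Passing to a left multiple of [v] keeps [v N] inside [I], as
    [I] is stable under [N]. *)
Lemma radical_chain_left bs u v w : radical_chain bs ->
  v \in N -> v \notin <<bs>>%VS -> in_corner (r u) (r w) v ->
  (forall x, x \in N -> v * x \in <<bs>>%VS) ->
  exists v' u', [/\ v' \in N, v' \notin <<bs>>%VS, in_corner (r u') (r w) v'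
    & forall x, x \in N -> x * v' \in <<bs>>%VS /\ v' * x \in <<bs>>%VS].
Proof.
move=> cb; set I := <<bs>>%VS.
have st := radical_chain_stable cb.
pose D v := (amulr v @: N + I)%VS.
have [n] := ubnP (\dim (D v)); elim: n v u => // n IH v u dn vN vI [uv vw] vNI.
have [h|] := pselect (forall x, x \in N -> x * v \in I).
  by exists v, u; split=> // x xN; split; auto.
move=> /existsNP[x /not_implyP[xN /negP vxI]].
have vxE : x * v = \sum_s r s * (x * v).
  by rewrite -mulr_suml -/eps mulrA (N_eps xN).1.
have [s v'I] : exists s, r s * (x * v) \notin I by apply: not_mem_sum; rewrite -vxE.
set v' := r s * (x * v) in v'I.
have v'N : v' \in N by rewrite N_rl ?N_mul.
have xsN : r s * x \in N by rewrite N_rl.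
have v's : r s * v' = v' by rewrite /v' mulrA rr.
apply: (IH v' s) => //; last first.
- by move=> y yN; rewrite /v' mulrA -mulrA; have [/(_ _ xsN)[]] := st _ (vNI y yN).
- by split=> //; rewrite /v' -!mulrA vw.
rewrite -ltnS; apply: leq_trans dn; rewrite ltnS.
have sub : (D v' <= D v)%VS.
  rewrite subv_add addvSr andbT; apply/subvP => _ /memv_imgP[y yN ->].
  apply: (subvP (addvSl _ _)); apply/memv_imgP; exists (y * (r s * x)).
    exact: N_mul.
  by rewrite !lfunE /= !mulrA.
rewrite ltn_neqAle dimvS // andbT; apply: contra v'I => /eqP dd.
have /eqP eD : D v' == D v by rewrite eqEdim sub dd /=.
have : v' \in D v.
  apply: (subvP (addvSl _ _)); apply/memv_imgP; exists (r s * x) => //.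
  by rewrite lfunE /= /v' mulrA.
rewrite -eD => /memv_addP[_ /memv_imgP[y yN ->] [i iI]].
rewrite lfunE /= => v'E; pose y' := r s * y * r s.
have y'N : y' \in N by rewrite N_rr ?N_rl.
have d1 : v' - y' * v' \in I.
  have -> : v' - y' * v' = r s * i; last by have [_ /(_ s)[]] := st _ iI.
  by rewrite /y' -!mulrA v's -{1}v's {1}v'E mulrDr addrC addrA addNr add0r.
have [_ _ /(_ s)[m]] : basic_radical y by apply/NP.
rewrite -/y' => y'm.
suff : v' - y' ^+ m * v' \in I by rewrite y'm mul0r subr0.
elim: m {y'm} => [|m IHm]; first by rewrite expr0 mul1r subrr mem0v.
have -> : v' - y' ^+ m.+1 * v' = (v' - y' * v') + y' * (v' - y' ^+ m * v').
  by rewrite exprS mulrBr (mulrA y' (_ ^+ m)) addrA subrK.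
by rewrite rpredD //; have [/(_ _ y'N)[]] := st _ IHm.
Qed.

Lemma radical_chain_full : exists bs, radical_chain bs /\ (<<bs>> = N)%VS.
Proof.
suff main n bs : (\dim N - size bs < n)%N -> radical_chain bs ->
    exists bs', radical_chain bs' /\ (<<bs'>> = N)%VS.
  by apply: (main _ [::] (leqnn _)).
elim: n bs => // n IH bs lt cb.
have sN := radical_chain_sub cb.
have [NI|/subvPn[v vN vI]] := boolP (N <= <<bs>>)%VS.
  by exists bs; split=> //; apply/eqP; rewrite eqEsubv sN.
have [u h] : exists u, \sum_w r u * v * r w \notin <<bs>>%VS.
  by apply: not_mem_sum; rewrite -N_peirce.
have [w {}vI] := not_mem_sum h.
have v1N : r u * v * r w \in N by rewrite N_rr ?N_rl.
have [v2 [w2 [v2N v2I c2 v2x]]] := radical_chain_right cb v1N vI (corner_rr u w v).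
have [v3 [u3 [v3N v3I c3 v3x]]] := radical_chain_left cb v2N v2I c2 v2x.
have cb' : radical_chain (v3 :: bs) by split=> //; exists u3, w2.
apply: (IH (v3 :: bs)) => //.
rewrite -ltnS; apply: leq_trans lt; rewrite ltnS /=.
have := dimvS (radical_chain_sub cb'); have /eqP -> := radical_chain_free cb'.
by move=> /= le; rewrite subnS prednK // subn_gt0.
Qed.

End RadicalBasis.

(* The r u are pairwise inequivalent primitive idempotents; P u i and Q u i
   are a column and a row of matrix units, so that y |-> Q u i * y * P v j are
   the Peirce coordinates of y.  The b i form a homogeneous basis of the
   radical of the basic algebra, and lam, cf are the coordinates in the basis
   (r u), (b i). *)
Record peirce_basis := PeirceBasis {
  pb_k : nat; pb_d : 'I_pb_k -> nat; pb_r : 'I_pb_k -> R;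
  pb_P : 'I_pb_k -> nat -> R; pb_Q : 'I_pb_k -> nat -> R;
  pb_m : nat; pb_b : 'I_pb_m -> R;
  pb_s : 'I_pb_m -> 'I_pb_k; pb_t : 'I_pb_m -> 'I_pb_k;
  pb_lam : 'I_pb_k -> {scalar R}; pb_cf : 'I_pb_m -> {scalar R};
  pb_d_gt0 : forall u, (0 < pb_d u)%N;
  pb_rM : forall u v, pb_r u * pb_r v = if u == v then pb_r u else 0;
  pb_Pr : forall u i, pb_P u i * pb_r u = pb_P u i;
  pb_rQ : forall u i, pb_r u * pb_Q u i = pb_Q u i;
  pb_QP : forall u v i j, (i < pb_d u)%N -> (j < pb_d v)%N ->
    pb_Q u i * pb_P v j = if (u == v) && (i == j) then pb_r u else 0;
  pb_PQ : \sum_u \sum_(i < pb_d u) pb_P u i * pb_Q u i = 1;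
  pb_rb : forall i, pb_r (pb_s i) * pb_b i = pb_b i;
  pb_br : forall i, pb_b i * pb_r (pb_t i) = pb_b i;
  pb_lam_r : forall u v, pb_lam u (pb_r v) = (u == v)%:R;
  pb_lam_b : forall u i, pb_lam u (pb_b i) = 0;
  pb_cf_r : forall i u, pb_cf i (pb_r u) = 0;
  pb_cf_b : forall i j, pb_cf i (pb_b j) = (i == j)%:R;
  pb_expand : forall u v x, let y := pb_r u * x * pb_r v in
    y = \sum_w pb_lam w y *: pb_r w + \sum_i pb_cf i y *: pb_b i;
  pb_lam_bb : forall u i j, pb_lam u (pb_b i * pb_b j) = 0;
  pb_cf_bb : forall l i j, pb_cf l (pb_b i * pb_b j) != 0 ->
    (i < l)%N /\ (j < l)%N }.

Lemma exists_peirce_basis : inhabited peirce_basis.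
Proof.
have [k [d [r [P [Q [[d0 pr or] [Pr rQ QP PQ]]]]]]] := peirce_decomposition.
have rr u : r u * r u = r u by case: (pr u).
have rM u v : r u * r v = if u == v then r u else 0.
  by have [->|/or[]] := eqVneq u v.
have [N NP] : exists N : {vspace R}, forall x, x \in N <-> basic_radical r x.
  apply: subspace_vspace; first exact: basic_radical0.
    exact: basic_radicalD.
  exact: basic_radicalZ.
have [bs [cb bsN]] := radical_chain_full pr or NP.
have fbs := radical_chain_free cb.
have bN (j : 'I_(size bs)) : bs`_j \in N by rewrite -bsN memv_span ?mem_nth.
have chain n : (n < size bs)%N -> (exists s t, in_corner (r s) (r t) bs`_n) /\
    forall x, x \in N -> x * bs`_n \in <<drop n.+1 bs>>%VS /\
      bs`_n * x \in <<drop n.+1 bs>>%VS.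
  move=> ln; have : radical_chain r N (drop n bs).
    elim: n {ln} => [|n IH]; first by rewrite drop0.
    by rewrite -add1n -drop_drop; case: (drop n bs) IH => //= b s; rewrite drop0 => -[].
  by rewrite (drop_nth 0 ln) => -[].
have [st stP] : {f : 'I_(size bs) -> 'I_k * 'I_k &
    forall i, in_corner (r (f i).1) (r (f i).2) bs`_i}.
  apply: (@choice _ _ (fun (i : 'I_(size bs)) (st : 'I_k * 'I_k) =>
    in_corner (r st.1) (r st.2) bs`_i)) => i.
  by have [[s [t h]] _] := chain i (ltn_ord i); exists (s, t).
pose m := size bs; pose el (i : 'I_(k + m)) : R :=
  match split i with inl u => r u | inr j => bs`_j end.
have ell u : el (lshift m u) = r u.
  by rewrite /el -[lshift m u]/(unsplit (inl u)) unsplitK.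
have elr j : el (rshift k j) = bs`_j.
  by rewrite /el -[rshift k j]/(unsplit (inr j)) unsplitK.
pose X := [tuple el i | i < k + m].
have XE (i : 'I_(k + m)) : X`_i = el i by rewrite -tnth_nth tnth_mktuple.
have fX : free X.
  apply/vector.freeP => c; under eq_bigr do rewrite XE.
  rewrite big_split_ord /=; under eq_bigr do rewrite ell.
  under [X in _ + X]eq_bigr do rewrite elr.
  set nu := (X in _ + X) => c0.
  have nuN : nu \in N by apply: rpred_sum => j _; rewrite rpredZ.
  (* In the corner of [r u] the relation says that a multiple of [r u] is nilpotent, so its
     coefficient is zero. *)
  have cl u : c (lshift m u) = 0.
    apply/eqP; apply: contraT => cu; have [_ r0 _] := pr u.
    have [_ _ /(_ u)[n hn]] : basic_radical r nu by apply/NP.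
    have E : c (lshift m u) *: r u = - (r u * nu * r u).
      apply/eqP; rewrite -subr_eq0 opprK; apply/eqP.
      have := congr1 (fun z => r u * z * r u) c0.
      rewrite mulr0 mul0r mulrDr mulrDl => <-; congr (_ + _).
      rewrite mulr_sumr mulr_suml (bigD1 u) //= -scalerAr -scalerAl !rr.
      rewrite big1 ?addr0 // => v ne; rewrite -scalerAr rM eq_sym (negPf ne).
      by rewrite scaler0 mul0r.
    case: (@nilpotent_not_right_unit (r u) (c (lshift m u) *: r u)
      ((c (lshift m u))^-1 *: r u) r0).
    - by rewrite -scalerAl rr.
    - by rewrite -scalerAl -scalerAr scalerA mulfV // scale1r rr.
    - by exists n; rewrite E exprNn hn mulr0.
  move=> i; rewrite -(splitK i); case: (split i) => [u|j] /=; first exact: cl.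
  move: c0; rewrite big1 ?add0r => [c0|u _]; last by rewrite cl scale0r.
  exact: (vector.freeP (X := in_tuple bs) fbs (fun j => c (rshift k j)) c0).
have rX u : r u \in <<X>>%VS.
  by rewrite -ell -XE memv_span // mem_nth // size_tuple.
have NX x : x \in N -> x \in <<X>>%VS.
  rewrite -bsN => /(subvP _ x); apply; apply/span_subvP => b.
  move=> /(nthP 0)[j lj <-].
  by rewrite -[j]/(nat_of_ord (Ordinal lj)) -elr -XE memv_span // mem_nth ?size_tuple.
(* [coord X] is linear on all of [R] but reads coefficients only on the span of [X]; its values
   matter on the basic algebra alone. *)
pose lam u : {scalar R} := coord X (lshift m u).
pose cf j : {scalar R} := coord X (rshift k j).
have lam_r u v : lam u (r v) = (u == v)%:R.
  by have := coord_free (lshift m v) (lshift m u) fX; rewrite XE ell eq_lshift eq_sym.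
have lam_b u (i : 'I_m) : lam u bs`_i = 0.
  by have := coord_free (rshift k i) (lshift m u) fX; rewrite XE elr eq_rlshift.
have cf_r i u : cf i (r u) = 0.
  by have := coord_free (lshift m u) (rshift k i) fX; rewrite XE ell eq_lrshift.
have cf_b i (j : 'I_m) : cf i bs`_j = (i == j)%:R.
  by have := coord_free (rshift k j) (rshift k i) fX; rewrite XE elr eq_rshift eq_sym.
have drop_cf n y : y \in <<drop n bs>>%VS ->
    (forall u, lam u y = 0) /\ forall l : 'I_m, cf l y != 0 -> (n <= l)%N.
  move=> /(coord_span (X := in_tuple (drop n bs)))->.
  have nd (j : 'I_(size (drop n bs))) : (n + j < m)%N.
    by have := ltn_ord j; rewrite [X in (_ < X)%N]size_drop ltn_subRL.
  split=> [u|l].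
    rewrite linear_sum big1 // => j _; rewrite linearZ /= nth_drop.
    by rewrite -[(n + j)%N]/(nat_of_ord (Ordinal (nd j))) lam_b mulr0.
  apply: contraR; rewrite -ltnNge => ln.
  rewrite linear_sum big1 // => j _; rewrite linearZ /= nth_drop.
  rewrite -[(n + j)%N]/(nat_of_ord (Ordinal (nd j))) cf_b.
  case: eqP => [e|_]; last by rewrite mulr0.
  by move: ln; rewrite e /= ltnNge leq_addr.
have expand u v x : let y := r u * x * r v in
    y = \sum_w lam w y *: r w + \sum_i cf i y *: bs`_i.
  move=> y; have yX : y \in <<X>>%VS.
    have sumr w : (\sum_u r u) * r w = r w /\ r w * (\sum_u r u) = r w.
      rewrite mulr_suml mulr_sumr; split; rewrite (bigD1 w) //= rr big1 ?addr0 // => w' ne.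
        by rewrite rM (negPf ne).
      by rewrite rM eq_sym (negPf ne).
    have uy : r u * y = y by rewrite /y !mulrA rr.
    have yv : y * r v = y by rewrite /y -mulrA rr.
    (* Off the diagonal a corner element lies in [N]; on the diagonal it does after subtracting its
       eigenvalue times [r u]. *)
    have [uv|ne] := eqVneq u v; last first.
      apply/NX/NP; split; first by rewrite -{1}uy mulrA (sumr u).1.
        by rewrite -{1}yv -mulrA (sumr v).2.
      move=> w; exists 1%N; rewrite expr1 -uy -{1}yv !mulrA rM.
      have [->|] := eqVneq w u; last by rewrite !mul0r.
      by rewrite -!mulrA rM eq_sym (negPf ne) !mulr0.
    have [a [n hn]] : exists a : K, nilpotent_elt (y - a *: r u).
      by apply: primitive_eigenvalue => //; split=> //; rewrite uv.
    rewrite -(subrK (a *: r u) y) rpredD ?rpredZ //; apply/NX/NP.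
    have cz : in_corner (r u) (r u) (y - a *: r u).
      by split; rewrite ?mulrBr ?mulrBl -?scalerAr -?scalerAl rr ?uy // {1}uv yv.
    move: (y - a *: r u) hn cz => z hn [uz zu].
    split; first by rewrite -uz mulrA (sumr u).1.
      by rewrite -zu -mulrA (sumr u).2.
    move=> w; rewrite -uz -zu !mulrA rM; have [->|] := eqVneq w u.
      by rewrite -mulrA rr uz zu; exists n.
    by rewrite !mul0r; exists 1%N; rewrite expr1.
  rewrite {1}(coord_span yX); under eq_bigr do rewrite XE.
  by rewrite big_split_ord; congr (_ + _); apply: eq_bigr => j _; rewrite ?ell ?elr.
apply: inhabits; apply: (@PeirceBasis k d r P Q m (fun i => bs`_i) (fun i => (st i).1)
  (fun i => (st i).2) lam cf d0 rM Pr rQ QP PQ _ _ lam_r lam_b cf_r cf_b expand).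
- by move=> i; case: (stP i).
- by move=> i; case: (stP i).
- by move=> u i j; have [_ /(_ _ (bN j))[_ /drop_cf[]]] := chain i (ltn_ord i).
- move=> l i j nz; have [_ /(_ _ (bN j))[_ /drop_cf[_ h1]]] := chain i (ltn_ord i).
  have [_ /(_ _ (bN i))[/drop_cf[_ h2] _]] := chain j (ltn_ord j).
  by split; [exact: h1|exact: h2].
Qed.

End LocalAlgebras.

(** * Modules with disjoint supports *)

Section FunctionMatrices.
Variable K : fieldType.

(** Matrices are functions on finite types, because vertex sets are built as sums and products; they
    are numbered only at the very end. *)
Definition fmul (I J L : finType) (f : I -> J -> K) (g : J -> L -> K)
  (a : I) (c : L) : K := \sum_b f a b * g b c.

Lemma fmulA (I J L M : finType) (f : I -> J -> K) (g : J -> L -> K)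
    (h : L -> M -> K) a d :
  fmul f (fmul g h) a d = fmul (fmul f g) h a d.
Proof.
rewrite /fmul; under eq_bigr do rewrite mulr_sumr.
under [RHS]eq_bigr do rewrite mulr_suml.
rewrite exchange_big; apply: eq_bigr => c _; apply: eq_bigr => b _.
by rewrite mulrA.
Qed.

Lemma fmulBl (I J L : finType) (f g : I -> J -> K) (h : J -> L -> K) a c :
  fmul (fun a b => f a b - g a b) h a c = fmul f h a c - fmul g h a c.
Proof. by rewrite /fmul -sumrB; apply: eq_bigr => b _; rewrite mulrBl. Qed.

Lemma fmulBr (I J L : finType) (f : I -> J -> K) (g h : J -> L -> K) a c :
  fmul f (fun a b => g a b - h a b) a c = fmul f g a c - fmul f h a c.
Proof. by rewrite /fmul -sumrB; apply: eq_bigr => b _; rewrite mulrBr. Qed.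

Lemma fmul_suml (I J L T : finType) (w : T -> K) (f : T -> I -> J -> K)
    (h : J -> L -> K) a c :
  fmul (fun a b => \sum_t w t * f t a b) h a c = \sum_t w t * fmul (f t) h a c.
Proof.
rewrite /fmul; under eq_bigr do rewrite mulr_suml.
rewrite exchange_big; apply: eq_bigr => t _; rewrite mulr_sumr.
by apply: eq_bigr => b _; rewrite mulrA.
Qed.

Lemma fmul_sumr (I J L T : finType) (w : T -> K) (f : T -> J -> L -> K)
    (h : I -> J -> K) a c :
  fmul h (fun a b => \sum_t w t * f t a b) a c = \sum_t w t * fmul h (f t) a c.
Proof.
rewrite /fmul; under eq_bigr do rewrite mulr_sumr.
rewrite exchange_big; apply: eq_bigr => t _; rewrite mulr_sumr.
by apply: eq_bigr => b _; rewrite mulrCA.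
Qed.

Lemma eq_fmul (I J L : finType) (f f' : I -> J -> K) (g g' : J -> L -> K) a c :
  (forall b, f a b = f' a b) -> (forall b, g b c = g' b c) ->
  fmul f g a c = fmul f' g' a c.
Proof. by move=> ef eg; apply: eq_bigr => b _; rewrite ef eg. Qed.

Lemma fmul_neq0 (I J L : finType) (f : I -> J -> K) (g : J -> L -> K) a c :
  fmul f g a c != 0 -> exists b, f a b != 0 /\ g b c != 0.
Proof.
move=> nz; apply: contrapT => nex; case/negP: nz; apply/eqP.
apply: big1 => b _; apply/eqP; rewrite mulf_eq0; apply: contrapT => /negP.
by rewrite negb_or => /andP[fb gb]; apply: nex; exists b.
Qed.

End FunctionMatrices.

(** * Modules with typed vertices over an algebra given by structure constants *)

Section TypedModules.
Variables (K : fieldType) (k m : nat) (sg ta : 'I_m -> 'I_k).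
Variable gam : 'I_m -> 'I_m -> 'I_m -> K.

(** A module over the algebra with structure constants [gam]. The idempotents act through the types
    of the vertices, and the rank makes every label strictly triangular. *)
Record typed_module (I : finType) (ty : I -> 'I_k) (h : I -> nat)
    (X : 'I_m -> I -> I -> K) : Prop := TypedModule {
  tm_type : forall i a b, X i a b != 0 -> ty a = sg i /\ ty b = ta i;
  tm_rank : forall i a b, X i a b != 0 -> (h a < h b)%N;
  tm_mul : forall i j a b, fmul (X i) (X j) a b = \sum_t gam i j t * X t a b }.

Definition disjoint_supports (I : finType) (X : 'I_m -> I -> I -> K) : Prop :=
  forall i j a b, X i a b != 0 -> X j a b != 0 -> i = j.

Section Extension.
Variables (V H : finType) (tV : V -> 'I_k) (hV : V -> nat).
Variables (X : 'I_m -> V -> V -> K) (tH : H -> 'I_k) (hH : H -> nat).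
Variables (Z : 'I_m -> H -> H -> K) (v : 'I_k) (x : 'I_m -> V -> unit -> K).
Variables (T : V -> H -> K) (Y : H -> unit -> K).
Hypothesis modX : typed_module tV hV X.
Hypothesis modZ : typed_module tH hH Z.
Hypothesis x_type : forall i a b, x i a b != 0 -> tV a = sg i /\ v = ta i.
Hypothesis x_mul : forall i j a b,
  fmul (X i) (x j) a b = \sum_t gam i j t * x t a b.
Hypothesis T_type : forall a b, T a b != 0 -> tV a = tH b.
Hypothesis Y_type : forall a b, Y a b != 0 -> tH a = v.

Definition ext_type (a : V + H + unit) : 'I_k :=
  match a with inl (inl a) => tV a | inl (inr a) => tH a | inr _ => v end.

Definition ext_rank (a : V + H + unit) : nat :=
  let M := (\max_b hV b).+1 in
  match a with
  | inl (inl a) => hV a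
  | inl (inr a) => M + hH a
  | inr _ => M + (\max_b hH b).+1
  end.

(** The direct sum of [H] and the extension of [V] by the column [x], conjugated by
    [(1 - T) (1 - Y)], where [T] and [Y] are extended by zero. *)
Definition ext_op (i : 'I_m) (a b : V + H + unit) : K :=
  match a, b with
  | inl (inl a), inl (inl b) => X i a b
  | inl (inl a), inl (inr b) => fmul (X i) T a b - fmul T (Z i) a b
  | inl (inl a), inr b => x i a b - fmul T (fmul (Z i) Y) a b
  | inl (inr a), inl (inr b) => Z i a b
  | inl (inr a), inr b => fmul (Z i) Y a b
  | _, _ => 0
  end.

Lemma ext_module : typed_module ext_type ext_rank ext_op.
Proof.
have subr_neq0 (y z : K) : y - z != 0 -> y != 0 \/ z != 0.
  case: (eqVneq z 0) => [->|]; last by right.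
  by rewrite subr0; left.
have hVM a : (hV a < (\max_b hV b).+1)%N by rewrite ltnS leq_bigmax.
have hHM a : (hH a < (\max_b hH b).+1)%N by rewrite ltnS leq_bigmax.
split.
- move=> i [[a|a]|a] [[b|b]|b] /=; rewrite ?eqxx //.
  + exact: (tm_type modX).
  + case/subr_neq0 => /fmul_neq0[c []].
      by move=> /(tm_type modX)[-> <-] /T_type ->.
    by move=> /T_type -> /(tm_type modZ).
  + case/subr_neq0 => [/x_type //|/fmul_neq0[c [/T_type->]]].
    by move=> /fmul_neq0[d [/(tm_type modZ)[-> <-] /Y_type->]].
  + exact: (tm_type modZ).
  + by move=> /fmul_neq0[d [/(tm_type modZ)[-> <-] /Y_type->]].
- move=> i [[a|a]|a] [[b|b]|b] /=; rewrite ?eqxx // => nz.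
  + exact: (tm_rank modX nz).
  + by apply: leq_trans (hVM a) _; rewrite leq_addr.
  + by apply: leq_trans (hVM a) _; rewrite leq_addr.
  + by rewrite ltn_add2l (tm_rank modZ nz).
  + by rewrite ltn_add2l hHM.
- have red i j a b : fmul (ext_op i) (ext_op j) a b =
    \sum_c ext_op i a (inl (inl c)) * ext_op j (inl (inl c)) b +
    \sum_c ext_op i a (inl (inr c)) * ext_op j (inl (inr c)) b +
    \sum_c ext_op i a (inr c) * ext_op j (inr c) b.
    by rewrite /fmul big_sumType /= big_sumType.
  have red3 i j a b : \sum_(c : unit) ext_op i a (inr c) * ext_op j (inr c) b = 0.
    by apply: big1 => c _; rewrite mulr0.
  have sum0 (w : 'I_m -> K) : \sum_t w t * 0 = 0 by apply: big1 => *; rewrite mulr0.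
  have bl0 (J : finType) (f : J -> K) : \sum_c 0 * f c = 0.
    by apply: big1 => *; rewrite mul0r.
  have br0 (J : finType) (f : J -> K) : \sum_c f c * 0 = 0.
    by apply: big1 => *; rewrite mulr0.
  move=> i j [[a|a]|a] [[b|b]|b]; rewrite red red3 addr0 /= ?bl0 ?br0 ?addr0 ?add0r //.
  + exact: (tm_mul modX).
  + rewrite -!/(fmul _ _ _ _).
    rewrite -[X in X + _]/(fmul (X i) (fun c d => fmul (X j) T c d - fmul T (Z j) c d) a b).
    rewrite -[X in _ + X]/(fmul (fun c d => fmul (X i) T c d - fmul T (Z i) c d) (Z j) a b).
    (* The two terms [X i T Z j] cancel, leaving [X i X j T - T Z i Z j]. *)
    rewrite fmulBr fmulBl addrA fmulA [fmul _ (fmul T _) _ _]fmulA subrK.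
    rewrite -[fmul (fmul T _) _ _ _]fmulA.
    under eq_bigr do rewrite mulrBr.
    rewrite sumrB -fmul_suml -fmul_sumr.
    congr (_ - _); apply: eq_fmul => // c; [exact: (tm_mul modX)|exact: (tm_mul modZ)].
  + rewrite -[X in X + _]/(fmul (X i) (fun c d => x j c d - fmul T (fmul (Z j) Y) c d) a b).
    rewrite -[X in _ + X]/(fmul (fun c d => fmul (X i) T c d - fmul T (Z i) c d)
      (fmul (Z j) Y) a b).
    rewrite fmulBr fmulBl addrA [fmul _ (fmul T _) _ _]fmulA subrK x_mul.
    under [RHS]eq_bigr do rewrite mulrBr.
    rewrite sumrB; congr (_ - _); rewrite -fmulA -fmul_sumr; apply: eq_fmul => // c.
    rewrite fmulA -fmul_suml; apply: eq_fmul => // d; exact: (tm_mul modZ).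
  + exact: (tm_mul modZ).
  + rewrite -[LHS]/(fmul (Z i) (fmul (Z j) Y) a b) fmulA -fmul_suml.
    by apply: eq_fmul => // c; exact: (tm_mul modZ).
Qed.

Definition col_type (a : V + unit) : 'I_k := if a is inl a then tV a else v.

Definition col_op (i : 'I_m) (a b : V + unit) : K :=
  match a, b with
  | inl a, inl b => X i a b
  | inl a, inr b => x i a b
  | inr _, _ => 0
  end.

(** The columns of [(1 - T) (1 - Y)] over [V] and the new vertex, which span a submodule before the
    conjugation. *)
Definition col_embed (w : V + H + unit) (b : V + unit) : K :=
  match w, b with
  | inl (inl a), inl b => (a == b)%:R
  | inl (inl a), inr b => fmul T Y a b
  | inl (inr a), inl b => 0
  | inl (inr a), inr b => - Y a b
  | inr _, inl _ => 0
  | inr _, inr _ => 1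
  end.

Lemma col_embed_type w b : col_embed w b != 0 -> ext_type w = col_type b.
Proof.
case: w b => [[a|a]|a] [b|b] /=; rewrite ?eqxx //.
- by case: (eqVneq a b) => [->|]; rewrite ?eqxx.
- by move=> /fmul_neq0[c [/T_type-> /Y_type->]].
- by rewrite oppr_eq0 => /Y_type.
Qed.

Lemma col_embedP i w b :
  fmul (ext_op i) col_embed w b = fmul col_embed (col_op i) w b.
Proof.
rewrite /fmul big_sumType /= big_sumType /= [RHS]big_sumType /=.
have tt0 (J : finType) (f : J -> K) : \sum_c f c * 0 = 0.
  by apply: big1 => *; rewrite mulr0.
have bl0 (J : finType) (f : J -> K) : \sum_c 0 * f c = 0.
  by apply: big1 => *; rewrite mul0r.
have delta (J : finType) (a : J) (f : J -> K) : \sum_c (a == c)%:R * f c = f a.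
  rewrite (bigD1 a) //= eqxx mul1r big1 ?addr0 // => c /negPf.
  by rewrite eq_sym => ->; rewrite mul0r.
have deltar (J : finType) (a : J) (f : J -> K) : \sum_c f c * (c == a)%:R = f a.
  rewrite (bigD1 a) //= eqxx mulr1 big1 ?addr0 // => c /negPf ->.
  by rewrite mulr0.
have sumN (J : finType) (f g : J -> K) : \sum_c f c * - g c = - \sum_c f c * g c.
  by rewrite -sumrN; apply: eq_bigr => c _; rewrite mulrN.
have sumu (f : unit -> K) : \sum_c f c = f tt.
  by rewrite (bigD1 tt) //= big1 ?addr0 // => -[].
case: w b => [[a|a]|a] [b|[]]; rewrite /= ?sumu ?tt0 ?bl0 ?mulr0 ?mulr1 ?addr0 ?add0r ?sumN //.
- by rewrite delta deltar.
- rewrite delta.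
  rewrite -[X in X - _]/(fmul (X i) (fmul T Y) a tt).
  rewrite -[X in _ - X + _]/(fmul (fun c d => fmul (X i) T c d - fmul T (Z i) c d) Y a tt).
  rewrite fmulBl fmulA -[fmul (fmul T _) _ _ _]fmulA opprB [X in X + _]addrC.
  by rewrite subrK addrC subrK.
- by rewrite -/(fmul (Z i) Y a tt) addNr.
Qed.

Lemma col_embed_inj (z : V + unit -> K) :
  (forall w, \sum_b col_embed w b * z b = 0) -> forall b, z b = 0.
Proof.
move=> z0; have zt u : z (inr u) = 0.
  have := z0 (inr u); rewrite big_sumType /= big1 ?add0r => [|c _]; last exact: mul0r.
  by rewrite (bigD1 u) //= big1 => [|[]]; case: u => //; rewrite mul1r addr0.
case=> [a|//]; have := z0 (inl (inl a)); rewrite big_sumType /=.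
rewrite [X in _ + X]big1 ?addr0 => [|c _]; last by rewrite zt mulr0.
rewrite (bigD1 a) //= eqxx mul1r big1 ?addr0 // => c /negPf.
by rewrite eq_sym => ->; rewrite mul0r.
Qed.

End Extension.

Section Copies.
Variables (S G : finType) (tG : G -> 'I_k) (hG : G -> nat).
Variables (Z : 'I_m -> G -> G -> K).

Definition copies_op (i : 'I_m) (a b : S * G) : K :=
  (a.1 == b.1)%:R * Z i a.2 b.2.

Lemma copies_neq0 i a b : copies_op i a b != 0 -> a.1 = b.1 /\ Z i a.2 b.2 != 0.
Proof.
rewrite /copies_op; case: (eqVneq a.1 b.1) => [->|_] /=; first by rewrite mul1r.
by rewrite mul0r eqxx.
Qed.

Lemma copies_module : typed_module tG hG Z ->
  typed_module (fun a : S * G => tG a.2) (fun a => hG a.2) copies_op.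
Proof.
move=> modZ; split=> [i a b /copies_neq0[_]|i a b /copies_neq0[_]|i j [s a] [s' b]].
- exact: (tm_type modZ).
- exact: (tm_rank modZ).
rewrite /fmul (eq_bigr (fun c : S * G =>
  (c.1 == s)%:R * ((s == s')%:R * (Z i a c.2 * Z j c.2 b)))); last first.
  case=> s1 c _; rewrite /copies_op /= eq_sym -!mulrA; case: (eqVneq s1 s) => [->|_].
    by rewrite !mul1r mulrCA.
  by rewrite !mul0r.
rewrite -(pair_bigA _ (fun s1 c => (s1 == s)%:R * ((s == s')%:R * (Z i a c * Z j c b)))).
rewrite /= (bigD1 s) //= [X in _ + X]big1 ?addr0; last first.
  by move=> s1 /negPf ->; apply: big1 => c _; rewrite mul0r.
under eq_bigr do rewrite eqxx mul1r.
rewrite -mulr_sumr -[X in _ * X]/(fmul (Z i) (Z j) a b) (tm_mul modZ) mulr_sumr.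
by apply: eq_bigr => t _; rewrite /copies_op /= mulrCA.
Qed.

Lemma copies_disjoint : disjoint_supports Z -> disjoint_supports copies_op.
Proof. by move=> dZ i j a b /copies_neq0[_ Zi] /copies_neq0[_]; apply: dZ Zi. Qed.

End Copies.

Definition killed (I : finType) (X : 'I_m -> I -> I -> K) (j : nat) : Prop :=
  forall (i : 'I_m) a b, (j <= i)%N -> X i a b = 0.

(* Every label i < j occurs in G, at (p i, q i).  In the column x, all labels
   below j are removed from row a by adding to the new vertex the multiple
   x i a / G i (p i) (q i) of q i in a fresh copy of G, and a to p i in that
   copy; the only label that survives in row a is j. *)
Lemma column_step (j : nat) (G V : finType) (tG : G -> 'I_k) (hG : G -> nat)
    (Z : 'I_m -> G -> G -> K) (tV : V -> 'I_k) (hV : V -> nat)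
    (X : 'I_m -> V -> V -> K) (v : 'I_k) (x : 'I_m -> V -> unit -> K) :
  typed_module tG hG Z -> disjoint_supports Z -> killed Z j ->
  (forall i : 'I_m, (i < j)%N -> exists a b, Z i a b != 0) -> G ->
  typed_module tV hV X -> disjoint_supports X -> killed X j.+1 ->
  (forall i a b, x i a b != 0 -> tV a = sg i /\ v = ta i) ->
  (forall i i' a b, fmul (X i) (x i') a b = \sum_t gam i i' t * x t a b) ->
  (forall (i : 'I_m) a b, (j < i)%N -> x i a b = 0) ->
  exists (W : finType) (tW : W -> 'I_k) (hW : W -> nat)
    (X' : 'I_m -> W -> W -> K) (Q : W -> V + unit -> K),
  [/\ typed_module tW hW X', disjoint_supports X' & killed X' j.+1] /\
  [/\ forall a, exists b, tW b = tV a,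
      forall w b, Q w b != 0 -> tW w = col_type tV v b,
      forall i w b, fmul (X' i) Q w b = fmul Q (col_op X x i) w b
    & forall z, (forall w, \sum_b Q w b * z b = 0) -> forall b, z b = 0].
Proof.
move=> modZ dZ kZ occ g0 modX dX kX xty xmul kx.
have [pq pqP] : {f : 'I_m -> G * G & forall i : 'I_m, (i < j)%N -> Z i (f i).1 (f i).2 != 0}.
  apply: (@choice _ _ (fun (i : 'I_m) (pq : G * G) => (i < j)%N -> Z i pq.1 pq.2 != 0)) => i.
  case: (ltnP i j) => [/occ[a [b nz]]|_]; first by exists (a, b).
  by exists (g0, g0).
pose p i := (pq i).1; pose q i := (pq i).2.
pose act (s : V * 'I_m) := (s.2 < j)%N && (x s.2 s.1 tt != 0).
(* One copy of [G] per pair of a row and a label. Where the pair is not [act], [T] and [Y] vanish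
   and the copy stays a direct summand. *)
pose S : finType := (V * 'I_m)%type.
pose T (a : V) (b : S * G) : K := [&& act b.1, b.1.1 == a & b.2 == p b.1.2]%:R.
pose cf (s : S) := x s.2 s.1 tt / Z s.2 (p s.2) (q s.2).
pose Y (b : S * G) (_ : unit) : K := (act b.1 && (b.2 == q b.1.2))%:R * cf b.1.
pose Zc := copies_op (S := S) Z.
have modZc := @copies_module S _ _ _ _ modZ.
have dZc := @copies_disjoint S _ _ dZ.
have actZ s : act s -> Z s.2 (p s.2) (q s.2) != 0 by case/andP => /pqP.
have nzb (b : bool) : b%:R != 0 :> K -> b by case: b; rewrite // eqxx.
have T_type a b : T a b != 0 -> tV a = tG b.2.
  move=> /nzb/and3P[ac /eqP <- /eqP->].
  have [-> _] := tm_type modZ (actZ _ ac).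
  by case/andP: ac => _ /xty[].
have Y_type b u : Y b u != 0 -> tG b.2 = v.
  rewrite mulf_eq0 negb_or => /andP[/nzb/andP[ac /eqP->] _].
  have [_ ->] := tm_type modZ (actZ _ ac).
  by case/andP: ac => _ /xty[].
have boolM (b1 : bool) (y : K) : b1%:R * y = if b1 then y else 0.
  by case: b1; rewrite ?mul1r ?mul0r.
have TZ i a b : fmul T (Zc i) a b = if act b.1 && (b.1.1 == a) then Z i (p b.1.2) b.2 else 0.
  rewrite /fmul (bigD1 (b.1, p b.1.2)) //= big1 ?addr0.
    by rewrite /T /Zc /copies_op /= !eqxx andbT mul1r boolM.
  case=> s c; rewrite /T /Zc /copies_op /= => ne.
  case: (eqVneq s b.1) ne => [->|_ _]; last by rewrite mul0r mulr0.
  rewrite xpair_eqE eqxx /= => /negPf ->.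
  by rewrite !andbF mul0r.
have XT i a b : fmul (X i) T a b = if act b.1 && (b.2 == p b.1.2) then X i a b.1.1 else 0.
  rewrite /fmul (bigD1 b.1.1) //= big1 ?addr0.
    by rewrite /T eqxx /= mulrC boolM.
  by move=> c /negPf ne; rewrite /T eq_sym ne andbF mulr0.
have ZY i a u : fmul (Zc i) Y a u = if act a.1 then Z i a.2 (q a.1.2) * cf a.1 else 0.
  rewrite /fmul (bigD1 (a.1, q a.1.2)) //= big1 ?addr0.
    rewrite /Y /Zc /copies_op /= !eqxx andbT mul1r boolM.
    by case: (act _); rewrite ?mulr0.
  case=> s c; rewrite /Y /Zc /copies_op /= => ne.
  case: (eqVneq s a.1) ne => [->|ne _]; last by rewrite !mul0r.
  rewrite xpair_eqE eqxx /= => /negPf ->.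
  by rewrite andbF mul0r mulr0.
(* By disjointness of [Z], the copy for [(a, i')] contributes to label [i] only if [i' = i]; there
   the divisor in [cf] restores exactly [x i a]. *)
have TZY i a : fmul T (fmul (Zc i) Y) a tt = if (i < j)%N then x i a tt else 0.
  rewrite /fmul.
  under eq_bigr => b _ do rewrite -/(fmul (Zc i) Y b tt) ZY /T boolM.
  have E (s : S) c : (if [&& act s, s.1 == a & c == p s.2] then
      if act s then Z i c (q s.2) * cf s else 0 else 0) =
      (c == p s.2)%:R * if act s && (s == (a, i)) then x i a tt else 0.
    rewrite boolM; case: (eqVneq c (p s.2)) => [->|]; last by rewrite !andbF.
    rewrite andbT; case ac: (act s) => //=; case: s ac => a' i' /= ac.
    rewrite xpair_eqE; case: (eqVneq a' a) => //= eqa; subst a'.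
    case: (eqVneq i' i) ac => [->|ne] ac.
      by rewrite /cf /= mulrC divfK //; exact: (actZ (a, i)).
    have [->|nz] := eqVneq (Z i (p i') (q i')) 0; first by rewrite mul0r.
    by case/negP: ne; apply/eqP; exact: (dZ _ _ _ _ (actZ _ ac) nz).
  rewrite -(pair_bigA _ (fun (s : S) c => if [&& act s, s.1 == a & c == p s.2] then
      if act s then Z i c (q s.2) * cf s else 0 else 0)) /=.
  under eq_bigr => s _ do under eq_bigr => c _ do rewrite E.
  rewrite (bigD1 (a, i)) //= [X in _ + X]big1 ?addr0; last first.
    by move=> s /negPf ->; rewrite andbF; apply: big1 => c _; rewrite mulr0.
  rewrite (bigD1 (p i)) //= big1 ?addr0 => [|c /negPf->]; last by rewrite mul0r.
  rewrite !eqxx mul1r andbT /act /=.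
  by case: (ltnP i j) => //= _; case: eqP.
exists (V + S * G + unit)%type, (ext_type tV (fun a => tG a.2) v),
  (ext_rank hV (fun a => hG a.2)), (ext_op X Zc x T Y), (col_embed T Y).
split; split.
- exact: ext_module.
- move=> i i' [[a|a]|a] [[b|b]|b] /=; rewrite ?eqxx //.
  + exact: dX.
  + rewrite !XT !TZ; case: (act b.1) => /=; last by rewrite subrr eqxx.
    case: (eqVneq b.2 (p b.1.2)) => [->|ne]; last first.
      by rewrite !sub0r !oppr_eq0; case: ifP => _; [apply: dZ|rewrite eqxx].
    (* The entries of [X] sit at the vertex [p] of the copy, where the row of [Z] has its diagonal
       entry, zero by the rank. So a row of [X] and a row of [Z] never overlap. *)
    have diag (l : 'I_m) c : Z l c c = 0.
      by apply/eqP; apply: contraT => /(tm_rank modZ); rewrite ltnn.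
    by rewrite !diag !if_same !subr0; apply: dX.
  + case: b; rewrite !TZY.
    (* Labels below [j] have been cancelled and labels above [j] vanish in [x]: only [j] is left. *)
    have H (l : 'I_m) : x l a tt - (if (l < j)%N then x l a tt else 0) != 0 -> l = j :> nat.
      case: ltnP; rewrite ?subrr ?eqxx ?subr0 // => le nz.
      apply/eqP; rewrite eqn_leq le andbT leqNgt; apply/negP => lt.
      by rewrite kx ?eqxx in nz.
    by move=> /H e1 /H e2; apply: val_inj; rewrite /= e1 e2.
  + exact: dZc.
  + rewrite !ZY; case: (act _); rewrite ?eqxx // !mulf_eq0 !negb_or => /andP[z1 _] /andP[z2 _].
    exact: dZ z1 z2.
- have kZ' (l : 'I_m) a b : (j.+1 <= l)%N -> Z l a b = 0 by move=> le; apply: kZ; apply: ltnW.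
  move=> i [[a|a]|a] [[b|b]|b] //= le.
  + exact: kX.
  + by rewrite XT TZ kX // kZ' // !if_same subr0.
  + by case: b; rewrite TZY ltnNge (ltnW le) subr0 kx.
  + by rewrite /Zc /copies_op kZ' // mulr0.
  + by rewrite ZY kZ' // mul0r if_same.
- by move=> a; exists (inl (inl a)).
- exact: col_embed_type.
- by move=> i w b; exact: col_embedP.
- exact: col_embed_inj.
Qed.

Definition good_module (j : nat) (I : finType) (ty : I -> 'I_k) (h : I -> nat)
    (X : 'I_m -> I -> I -> K) : Prop :=
  [/\ typed_module ty h X, disjoint_supports X, killed X j
    & forall u, exists a, ty a = u].

Lemma zero_good_module j :
  good_module j id (fun _ => 0%N) (fun _ _ _ => 0 : K).
Proof.
split=> [|i i' a b|//|u]; rewrite ?eqxx //; last by exists u.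
split=> [i a b|i a b|i i' a b]; rewrite ?eqxx //.
by rewrite /fmul !big1 // => *; rewrite mulr0.
Qed.

(** The vertices of [M] of rank below [t] span a submodule, which [T] embeds in a good module. As
    [hI] is injective, raising [t] adds at most one vertex; its column is transported by [T] and
    cleaned by [column_step]. *)
Lemma embed_good_module (j : nat) (G : finType) (tG : G -> 'I_k)
    (hG : G -> nat) (Z : 'I_m -> G -> G -> K) (I : finType) (tI : I -> 'I_k)
    (hI : I -> nat) (M : 'I_m -> I -> I -> K) :
  good_module j tG hG Z ->
  (forall i : 'I_m, (i < j)%N -> exists a b, Z i a b != 0) ->
  typed_module tI hI M -> injective hI -> killed M j.+1 ->
  exists (V : finType) (tV : V -> 'I_k) (hV : V -> nat)
    (X : 'I_m -> V -> V -> K),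
  good_module j.+1 tV hV X /\
  forall i a b, M i a b != 0 -> exists c d, X i c d != 0.
Proof.
move=> [modZ dZ kZ sZ] occ modM injh kM.
suff main t : exists (V : finType) (tV : V -> 'I_k) (hV : V -> nat)
    (X : 'I_m -> V -> V -> K) (T : V -> I -> K),
  [/\ good_module j.+1 tV hV X, forall a b, T a b != 0 -> tV a = tI b,
    forall i a b, (hI b < t)%N -> fmul (X i) T a b = fmul T (M i) a b
  & forall z, (forall b, z b != 0 -> (hI b < t)%N) ->
    (forall a, \sum_b T a b * z b = 0) -> forall b, z b = 0].
  have [V [tV [hV [X [T [gX _ XT Tinj]]]]]] := main (\max_b hI b).+1.
  have hIM b : (hI b < (\max_b hI b).+1)%N by rewrite ltnS leq_bigmax.
  exists V, tV, hV, X; split=> // i a b nz; apply: contrapT => nex.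
  (* If the label [i] acted by zero on [V], the injective [T] would force the column [M i _ b] to
     vanish. *)
  case/negP: nz; apply/eqP; apply: (Tinj (fun c => M i c b)) => // c.
  rewrite -[LHS]/(fmul T (M i) c b) -XT //; apply: big1 => d _.
  have [-> |nz] := eqVneq (X i c d) 0; first by rewrite mul0r.
  by case: nex; exists c, d.
elim: t => [|t [V [tV [hV [X [T [[modX dX kX sX] T_type XT Tinj]]]]]]].
  exists 'I_k, id, (fun _ => 0%N), (fun _ _ _ => 0), (fun _ _ => 0); split.
  - exact: zero_good_module.
  - by move=> a b; rewrite eqxx.
  - by [].
  - move=> z zs _ b; apply/eqP; apply: contraT => /zs; by rewrite ltn0.
have [/existsP[b0 /eqP hb0]|] := boolP [exists b, hI b == t]; last first.
  rewrite negb_exists => /forallP nt; exists V, tV, hV, X, T.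
  have lt b : (hI b < t.+1)%N -> (hI b < t)%N.
    by rewrite ltnS leq_eqVlt (negPf (nt b)).
  split=> // [i a b /lt|z zs]; first exact: XT.
  by apply: Tinj => b /zs/lt.
pose x i a (_ : unit) := fmul T (M i) a b0.
have Mlt i a b : M i a b != 0 -> (hI a < hI b)%N by exact: (tm_rank modM).
have x_type i a u : x i a u != 0 -> tV a = sg i /\ tI b0 = ta i.
  by move=> /fmul_neq0[c [/T_type -> /(tm_type modM)]].
have x_mul i i' a b : fmul (X i) (x i') a b = \sum_t gam i i' t * x t a b.
  rewrite -[LHS]/(fmul (X i) (fmul T (M i')) a b0) fmulA.
  transitivity (fmul (fmul T (M i)) (M i') a b0).
    apply: eq_bigr => c _; have [->|nz] := eqVneq (M i' c b0) 0.
      by rewrite !mulr0.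
    by rewrite XT // -hb0; exact: Mlt nz.
  by rewrite -fmulA -fmul_sumr; apply: eq_fmul => // c; exact: (tm_mul modM).
have kx (i : 'I_m) a b : (j < i)%N -> x i a b = 0.
  by move=> lt; apply: big1 => c _; rewrite kM // mulr0.
have [g0 _] := sZ (tI b0).
have [W [tW [hW [X' [Q [[modX' dX' kX'] [sW Qt XQ Qinj]]]]]]] :=
  column_step modZ dZ kZ occ g0 modX dX kX x_type x_mul kx.
(* [b0] goes to the new vertex; the other columns of rank at least [t] are cut off, since [T] is
   known to intertwine only below [t]. *)
pose Tc (a : V + unit) b : K :=
  match a with inl a => if (hI b < t)%N then T a b else 0 | inr _ => (b == b0)%:R end.
have ltS b : (hI b < t.+1)%N -> b = b0 \/ (hI b < t)%N.
  by rewrite ltnS leq_eqVlt -hb0 => /orP[/eqP/injh|]; [left|right].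
exists W, tW, hW, X', (fmul Q Tc); split.
- split=> // u; have [a <-] := sX u; have [b <-] := sW a; by exists b.
- move=> w b /fmul_neq0[c [/Qt->]]; case: c => [a|u] /=.
    by case: ifP => [_ /T_type|]; rewrite ?eqxx.
  by case: (eqVneq b b0) => [->|]; rewrite ?eqxx.
- move=> i w b lt; rewrite fmulA.
  rewrite (eq_fmul (f' := fmul Q (col_op X x i)) (g' := Tc)) //.
  rewrite -!fmulA; apply: eq_fmul => // c.
  have TcM a : fmul Tc (M i) (inl a) b = fmul T (M i) a b.
    apply: eq_bigr => d _ /=; have [->|/Mlt lt'] := eqVneq (M i d b) 0.
      by rewrite !mulr0.
    by rewrite (leq_trans lt').
  have colE a : fmul (col_op X x i) Tc (inl a) b =
      (if (hI b < t)%N then fmul (X i) T a b else 0) + x i a tt * (b == b0)%:R.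
    rewrite /fmul big_sumType /=; congr (_ + _).
      by case: ifP => // _; apply: big1 => *; rewrite mulr0.
    by rewrite (bigD1 tt) //= big1 ?addr0 // => -[].
  case: c => [a|u]; last first.
    transitivity (0 : K); [|symmetry]; apply: big1 => c _; first by rewrite mul0r.
    rewrite /=; have [->|] := eqVneq c b0; last by rewrite mul0r.
    have [->|/Mlt] := eqVneq (M i b0 b) 0; first by rewrite mulr0.
    by rewrite hb0 ltnNge -ltnS lt.
  rewrite colE TcM; case: (ltS _ lt) => [->|lt'].
    by rewrite hb0 ltnn eqxx mulr1 add0r.
  rewrite lt' XT //; have [e|] := eqVneq b b0; last by rewrite mulr0 addr0.
  by rewrite e hb0 ltnn in lt'.
- move=> z zs QTz.
  have Tz c : \sum_b Tc c b * z b = 0.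
    apply: (Qinj (fun c => \sum_b Tc c b * z b)) => w.
    have := QTz w; rewrite /fmul; under eq_bigr do rewrite mulr_suml.
    rewrite exchange_big => e; apply: etrans e; apply: eq_bigr => d _.
    by rewrite mulr_sumr; apply: eq_bigr => b _; rewrite mulrA.
  have zb0 : z b0 = 0.
    have := Tz (inr tt); rewrite (bigD1 b0) //= eqxx mul1r big1 ?addr0 // => b.
    by move=> /negPf->; rewrite mul0r.
  have zs' b : z b != 0 -> (hI b < t)%N.
    by move=> nz; case: (ltS _ (zs _ nz)) => // e; rewrite e zb0 eqxx in nz.
  refine (Tinj z zs' _) => a; apply: etrans (Tz (inl a)); apply: eq_bigr => b _ /=.
  by have [->|/zs'->] := eqVneq (z b) 0; rewrite ?mulr0.
Qed.

Lemma exists_good_module (J : nat) :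
  (forall j, (j <= J)%N -> exists (I : finType) (tI : I -> 'I_k) (hI : I -> nat)
     (M : 'I_m -> I -> I -> K), [/\ typed_module tI hI M, injective hI,
     killed M j & forall i : 'I_m, (i < j)%N -> exists a b, M i a b != 0]) ->
  exists (V : finType) (tV : V -> 'I_k) (hV : V -> nat)
    (X : 'I_m -> V -> V -> K), good_module J tV hV X /\
  forall i : 'I_m, (i < J)%N -> exists a b, X i a b != 0.
Proof.
elim: J => [_|J IH reg].
  exists 'I_k, id, (fun _ => 0%N), (fun _ _ _ => 0).
  by split=> //; exact: zero_good_module.
have [|G [tG [hG [Z [gZ occ]]]]] := IH; first by move=> j /leqW; exact: reg.
have [I [tI [hI [M [modM injh kM occM]]]]] := reg _ (leqnn J.+1).
have [V [tV [hV [X [gX occX]]]]] := embed_good_module gZ occ modM injh kM.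
exists V, tV, hV, X; split=> // i /occM[a [b]]; exact: occX.
Qed.

End TypedModules.

(** Numbering the vertices by rank turns the rank condition into strict upper triangularity. *)
Lemma sorting_enumeration (V : finType) (h : V -> nat) :
  exists f : 'I_#|V| -> V, bijective f /\
    forall i j : 'I_#|V|, (i <= j)%N -> (h (f i) <= h (f j))%N.
Proof.
have [v|V0] := pickP (mem V); last first.
  have n0 : #|V| = 0%N by apply: eq_card0 => a; have := V0 a; rewrite !inE.
  have F (T : Type) (i : 'I_#|V|) : T by case: i => i; rewrite n0.
  exists (F V); split=> [|i]; last exact: (F _ i).
  by exists (fun a => F _ (enum_rank a)) => x; [exact: (F _ x)|have := V0 x].
move=> _; pose e := sort (relpre h leq) (enum V).
have pe : perm_eq e (enum V) by rewrite perm_sort.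
have se : size e = #|V| by rewrite (perm_size pe) cardE.
pose f (i : 'I_#|V|) := nth v e i.
exists f; split.
  apply: inj_card_bij; last by rewrite card_ord.
  move=> i j /eqP; rewrite nth_uniq ?se ?ltn_ord //; first by move/eqP/val_inj.
  by rewrite (perm_uniq pe) enum_uniq.
move=> i j ij; have tr : transitive (relpre h leq) by move=> x y z; exact: leq_trans.
have so : sorted (relpre h leq) e by apply: sort_sorted => x y; exact: leq_total.
by apply: (sorted_leq_nth tr _ v so); rewrite ?inE ?se // => x; exact: leqnn.
Qed.

(** * The labelled quiver of the basic algebra *)

Section LabelledQuiver.
Variables (K : closedFieldType) (R : falgType K) (B : peirce_basis R).

Local Notation k := (pb_k B).
Local Notation m := (pb_m B).
Local Notation r := (pb_r (p := B)).
Local Notation b := (pb_b (p := B)).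
Local Notation s := (pb_s (p := B)).
Local Notation t := (pb_t (p := B)).
Local Notation lam := (pb_lam (p := B)).
Local Notation cf := (pb_cf (p := B)).

Lemma pb_rbr u v i :
  r u * b i * r v = if (s i == u) && (t i == v) then b i else 0.
Proof.
rewrite -(pb_rb i) -(pb_br i) !mulrA pb_rM -!mulrA pb_rM [u == _]eq_sym.
case: (eqVneq (s i) u) => [->|_] /=; last by rewrite mul0r.
by case: ifP => _; rewrite ?mulr0.
Qed.

Lemma pb_cf_type u v x l : cf l (r u * x * r v) != 0 -> s l = u /\ t l = v.
Proof.
have E : r u * x * r v = r u * (r u * x * r v) * r v.
  by rewrite !mulrA pb_rM eqxx -!mulrA pb_rM eqxx.
have F : cf l (r u * x * r v) =
    cf l (r u * x * r v) * ((s l == u) && (t l == v))%:R.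
  rewrite {1}E {1}(pb_expand u v x) mulrDr mulrDl linearD /=.
  rewrite mulr_sumr mulr_suml linear_sum big1 ?add0r => [|w _]; last first.
    rewrite -scalerAr -scalerAl linearZ /= pb_rM.
    case: eqP => _; last by rewrite mul0r linear0 mulr0.
    by rewrite pb_rM; case: eqP => _; rewrite ?pb_cf_r ?linear0 mulr0.
  rewrite mulr_sumr mulr_suml linear_sum (bigD1 l) //= big1 ?addr0 => [|i ne].
    rewrite -scalerAr -scalerAl linearZ /= pb_rbr; case: andP => _.
      by rewrite pb_cf_b eqxx.
    by rewrite linear0.
  rewrite -scalerAr -scalerAl linearZ /= pb_rbr; case: andP => _.
    by rewrite pb_cf_b eq_sym (negPf ne) mulr0.
  by rewrite linear0 mulr0.
rewrite F; case: andP => [[/eqP-> /eqP->] //|_]; by rewrite mulr0 eqxx.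
Qed.

Lemma pb_lam_type u v x w : lam w (r u * x * r v) != 0 -> w = u /\ w = v.
Proof.
have E : r u * x * r v = r u * (r u * x * r v) * r v.
  by rewrite !mulrA pb_rM eqxx -!mulrA pb_rM eqxx.
have F : lam w (r u * x * r v) =
    lam w (r u * x * r v) * ((w == u) && (w == v))%:R.
  rewrite {1}E {1}(pb_expand u v x) mulrDr mulrDl linearD /=.
  rewrite [X in _ + X](_ : _ = 0) ?addr0; last first.
    rewrite mulr_sumr mulr_suml linear_sum big1 // => i _.
    rewrite -scalerAr -scalerAl linearZ /= pb_rbr; case: andP => _.
      by rewrite pb_lam_b mulr0.
    by rewrite linear0 mulr0.
  rewrite mulr_sumr mulr_suml linear_sum (bigD1 w) //= big1 ?addr0 => [|i ne].
    rewrite -scalerAr -scalerAl linearZ /= pb_rM eq_sym.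
    case: eqP => [<-|_] /=; last by rewrite mul0r linear0.
    by rewrite pb_rM; case: eqP => _ /=; rewrite ?linear0 // pb_lam_r eqxx.
  rewrite -scalerAr -scalerAl linearZ /= pb_rM.
  case: eqP => [->|_]; last by rewrite mul0r linear0 mulr0.
  rewrite pb_rM; case: eqP => _; last by rewrite linear0 mulr0.
  by rewrite pb_lam_r eq_sym (negPf ne) mulr0.
rewrite F; case: andP => [[/eqP-> /eqP->] //|_]; by rewrite mulr0 eqxx.
Qed.

Definition pb_gam i j l : K := cf l (b i * b j).

Local Notation basis_index := ('I_k + 'I_m)%type.

Definition basis_elt (a : basis_index) : R :=
  match a with inl u => r u | inr i => b i end.
Definition basis_type (a : basis_index) : 'I_k :=
  match a with inl u => u | inr i => s i end.
Definition basis_right (a : basis_index) : 'I_k :=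
  match a with inl u => u | inr i => t i end.
Definition basis_coord (a : basis_index) : {scalar R} :=
  match a with inl u => lam u | inr i => cf i end.
(** Products move towards larger indices, so later labels get smaller ranks, and the idempotents lie
    above all labels. *)
Definition basis_rank (a : basis_index) : nat :=
  match a with inl u => m + u | inr i => m - i.+1 end.

(* The left regular representation of the basic algebra modulo the ideal
   spanned by the b i with j <= i. *)
Definition regular_op (j : nat) (i : 'I_m) (a c : basis_index) : K :=
  let alive (d : basis_index) := if d is inr l then (l < j)%N else true in
  if alive a && alive c then basis_coord a (b i * basis_elt c) else 0.

Lemma basis_elt_left a : r (basis_type a) * basis_elt a = basis_elt a.
Proof. by case: a => [u|i] /=; rewrite ?pb_rM ?eqxx ?pb_rb. Qed.

Lemma basis_elt_right a : basis_elt a * r (basis_right a) = basis_elt a.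
Proof. by case: a => [u|i] /=; rewrite ?pb_rM ?eqxx ?pb_br. Qed.

Lemma pb_mul_basis i a : b i * basis_elt a =
  r (s i) * (b i * basis_elt a) * r (basis_right a).
Proof. by rewrite -[in RHS]mulrA -[b i * _ * _]mulrA basis_elt_right mulrA pb_rb. Qed.

Lemma basis_coordE i a : b i * basis_elt a =
  \sum_c basis_coord c (b i * basis_elt a) *: basis_elt c.
Proof. by rewrite {1}pb_mul_basis {1}pb_expand -pb_mul_basis big_sumType. Qed.

Lemma pb_bbE i j : b i * b j = \sum_l pb_gam i j l *: b l.
Proof.
rewrite {1}(basis_coordE i (inr j)) big_sumType /= big1 ?add0r // => u _.
by rewrite pb_lam_bb scale0r.
Qed.

Lemma basis_coord_neq0 i a c : basis_coord a (b i * basis_elt c) != 0 ->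
  [/\ basis_type a = s i, basis_type c = t i
    & exists2 l, a = inr l & (i <= l)%N /\ (if c is inr j then (j < l)%N else true)].
Proof.
move=> nz; have ct : basis_type c = t i.
  apply/eqP; apply: contraNT nz => ne.
  by rewrite -(pb_br i) -(basis_elt_left c) -mulrA (mulrA (r (t i))) pb_rM [t i == _]eq_sym
    (negPf ne) mul0r mulr0 linear0.
have [l al] : exists l, a = inr l.
  case: a nz => [u|l] /=; last by exists l.
  case: c {ct} => [v|j] /=; last by rewrite pb_lam_bb eqxx.
  rewrite -(pb_br i) -mulrA pb_rM; have [_|_] := eqVneq (t i) v.
    by rewrite pb_br pb_lam_b eqxx.
  by rewrite mulr0 linear0 eqxx.
subst a; split=> //.
  by move: nz; rewrite /= pb_mul_basis => /pb_cf_type[].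
exists l => //; case: c nz {ct} => [v|j] /=; last first.
  by move=> /pb_cf_bb[lt1 lt2]; split=> //; exact: ltnW.
rewrite -(pb_br i) -mulrA pb_rM; have [_|_] := eqVneq (t i) v; last by rewrite mulr0 linear0 eqxx.
by rewrite pb_br pb_cf_b; case: (eqVneq l i) => [->|]; rewrite ?eqxx.
Qed.

Lemma basis_rank_inj : injective basis_rank.
Proof.
move=> [u|i] [v|j] /=.
- by move/addnI/val_inj->.
- move=> e; have := ltn_ord j; have := leq_subr j.+1 m; rewrite -e => le.
  move=> lt; move: e; have -> : (u : nat) = 0%N.
    by apply/eqP; rewrite -leqn0 -(leq_add2l m) addn0.
  rewrite addn0 => e; have : (m - j.+1 < m)%N by rewrite ltn_subrL (leq_trans _ lt).
  by rewrite -e ltnn.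
- move=> e; have := ltn_ord i; have := leq_subr i.+1 m; rewrite e => le.
  move=> lt; move: e; have -> : (v : nat) = 0%N.
    by apply/eqP; rewrite -leqn0 -(leq_add2l m) addn0.
  rewrite addn0 => e; have : (m - i.+1 < m)%N by rewrite ltn_subrL (leq_trans _ lt).
  by rewrite e ltnn.
- move=> e; congr inr; apply: val_inj => /=; apply: succn_inj.
  by rewrite -(subKn (ltn_ord i)) e subKn.
Qed.

Lemma regular_module j : typed_module s t pb_gam basis_type basis_rank (regular_op j).
Proof.
split.
- move=> i a c; rewrite /regular_op; case: ifP => _; last by rewrite eqxx.
  by move=> /basis_coord_neq0[-> ->].
- move=> i a c; rewrite /regular_op; case: ifP => _; last by rewrite eqxx.
  move=> /basis_coord_neq0[_ _ [l -> [il jl]]] /=.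
  case: c jl => [u _|j' jl] /=; last by apply: ltn_sub2l => //; exact: leq_ltn_trans jl (ltn_ord l).
  by rewrite (leq_trans _ (leq_addr _ _)) // ltn_subrL (leq_ltn_trans _ (ltn_ord l)).
- move=> i i' a c.
  (* A product with a discarded basis element has only discarded coordinates, so truncating both
     indices is compatible with composition. *)
  have dead (d : basis_index) (l : 'I_m) : (j <= l)%N -> d = inr l ->
      basis_coord a (b i * basis_elt d) = 0 \/
      ~~ (if a is inr l0 then (l0 < j)%N else true).
    move=> jl ->; have [->|] := eqVneq (basis_coord a (b i * basis_elt (inr l))) 0.
      by left.
    move=> /basis_coord_neq0[_ _ [l0 -> [_ ll]]]; right.
    by rewrite -leqNgt (leq_trans jl) // ltnW.
  rewrite /regular_op /fmul.
  case al: (if a is inr l then (l < j)%N else true); last first.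
    by rewrite !big1 // => *; rewrite ?mul0r ?mulr0.
  case cl: (if c is inr l then (l < j)%N else true); last first.
    by rewrite !big1 // => *; rewrite ?andbF ?mulr0.
  transitivity (basis_coord a (b i * (b i' * basis_elt c))).
    rewrite [in RHS](basis_coordE i' c) mulr_sumr linear_sum.
    apply: eq_bigr => d _; rewrite -scalerAr linearZ /= andbT.
    case: ifP => [_|dl]; first by rewrite mulrC.
    case: d dl => // l /negbT; rewrite -leqNgt => jl.
    case: (dead (inr l) l jl erefl) => [->|]; first by rewrite !mulr0 ?mul0r.
    by rewrite al.
  rewrite mulrA pb_bbE mulr_suml linear_sum; apply: eq_bigr => l _.
  by rewrite -scalerAl linearZ.
Qed.

Lemma regular_killed j : killed (regular_op j) j.
Proof.
move=> i a c ji; apply/eqP; rewrite /regular_op; case: ifP => // /andP[al _].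
apply: contraT => /basis_coord_neq0[_ _ [l ae [il _]]].
by move: al; rewrite ae ltnNge (leq_trans ji il).
Qed.

Lemma regular_neq0 j (i : 'I_m) : (i < j)%N -> exists a c, regular_op j i a c != 0.
Proof.
move=> ij; exists (inr i), (inl (t i)).
by rewrite /regular_op /= ij /= pb_br pb_cf_b eqxx oner_eq0.
Qed.

Theorem exists_labelled_quiver :
  exists (l : nat) (c : 'I_l -> 'I_k) (X : 'I_m -> 'I_l -> 'I_l -> K),
  [/\ forall i x y, X i x y != 0 -> [/\ c x = s i, c y = t i & (x < y)%N],
      forall i j x y, fmul (X i) (X j) x y = \sum_l pb_gam i j l * X l x y
    & forall i j x y, X i x y != 0 -> X j x y != 0 -> i = j] /\
  (forall i, exists x y, X i x y != 0) /\ (forall u, exists x, c x = u).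
Proof.
have [|V [tV [hV [X [[modX dX _ sX] occ]]]]] :=
    @exists_good_module K k m s t pb_gam m.
  move=> j _; exists basis_index, basis_type, basis_rank, (regular_op j).
  split; [exact: regular_module|exact: basis_rank_inj|exact: regular_killed|].
  exact: regular_neq0.
have [f [[g fg gf] mono]] := sorting_enumeration hV.
exists #|V|, (tV \o f), (fun i x y => X i (f x) (f y)); split; [split|split].
- move=> i x y nz; have [tx ty] := tm_type modX nz; split=> //.
  by rewrite ltnNge; apply/negP => /mono; rewrite leqNgt (tm_rank modX nz).
- move=> i j x y; rewrite -(tm_mul modX) /fmul [RHS](reindex f) //.
  by exists g => z _.
- by move=> i j x y; exact: dX.
- move=> i; have [a [c nz]] := occ i (ltn_ord i).
  by exists (g a), (g c); rewrite !gf.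
- by move=> u; have [a <-] := sX u; exists (g a); rewrite /= gf.
Qed.

End LabelledQuiver.

(** * Block coordinates *)

Section BlockCoordinates.
Variables (K : closedFieldType) (R : falgType K) (B : peirce_basis R).

Local Notation k := (pb_k B).
Local Notation m := (pb_m B).
Local Notation d := (pb_d (p := B)).
Local Notation r := (pb_r (p := B)).
Local Notation P := (pb_P (p := B)).
Local Notation Q := (pb_Q (p := B)).
Local Notation b := (pb_b (p := B)).
Local Notation s := (pb_s (p := B)).
Local Notation t := (pb_t (p := B)).
Local Notation lam := (pb_lam (p := B)).
Local Notation cf := (pb_cf (p := B)).

Variables (l : nat) (c : 'I_l -> 'I_k) (X : 'I_m -> 'I_l -> 'I_l -> K).
Hypothesis X_type : forall i x y, X i x y != 0 -> [/\ c x = s i, c y = t i & (x < y)%N].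
Hypothesis X_mul : forall i j x y,
  fmul (X i) (X j) x y = \sum_l pb_gam i j l * X l x y.
Hypothesis X_disj : forall i j x y, X i x y != 0 -> X j x y != 0 -> i = j.
Hypothesis X_occ : forall i, exists x y, X i x y != 0.
Hypothesis c_surj : forall u, exists x, c x = u.

Definition quiver_op (y : R) (q w : 'I_l) : K :=
  (q == w)%:R * lam (c q) y + \sum_i X i q w * cf i y.

Lemma quiver_op_sum (I : finType) (a : I -> K) (y : I -> R) q w :
  quiver_op (\sum_i a i *: y i) q w = \sum_i a i * quiver_op (y i) q w.
Proof.
rewrite /quiver_op linear_sum mulr_sumr.
under [X in _ + X]eq_bigr do rewrite linear_sum mulr_sumr.
rewrite exchange_big -big_split; apply: eq_bigr => i _ /=.
rewrite linearZ mulrDr mulrCA; congr (_ + _); rewrite mulr_sumr.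
by apply: eq_bigr => j _; rewrite linearZ mulrCA.
Qed.

Lemma quiver_opD y z q w : quiver_op (y + z) q w = quiver_op y q w + quiver_op z q w.
Proof.
rewrite /quiver_op linearD mulrDr addrACA -big_split; congr (_ + _).
by apply: eq_bigr => i _; rewrite linearD mulrDr.
Qed.

Lemma quiver_opZ a y q w : quiver_op (a *: y) q w = a * quiver_op y q w.
Proof.
rewrite /quiver_op linearZ mulrDr mulrCA; congr (_ + _); rewrite mulr_sumr.
by apply: eq_bigr => j _; rewrite linearZ mulrCA.
Qed.

Lemma quiver_op_r u q w : quiver_op (r u) q w = ((q == w) && (c q == u))%:R.
Proof.
rewrite /quiver_op pb_lam_r big1 ?addr0; first by case: (q == w); rewrite ?mul1r ?mul0r.
by move=> i _; rewrite pb_cf_r mulr0.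
Qed.

Lemma quiver_op_b i q w : quiver_op (b i) q w = X i q w.
Proof.
rewrite /quiver_op pb_lam_b mulr0 add0r (bigD1 i) //= pb_cf_b eqxx mulr1.
by rewrite big1 ?addr0 // => j ne; rewrite pb_cf_b (negPf ne) mulr0.
Qed.

Lemma quiver_op_basisM (a1 a2 : 'I_k + 'I_m) q w :
  quiver_op (basis_elt a1 * basis_elt a2) q w =
  fmul (quiver_op (basis_elt a1)) (quiver_op (basis_elt a2)) q w.
Proof.
have q0 q' w' : quiver_op 0 q' w' = 0.
  by rewrite -(scale0r (0 : R)) quiver_opZ mul0r.
have rl u y q' : fmul (quiver_op (r u)) y q' w = (c q' == u)%:R * y q' w.
  rewrite /fmul (bigD1 q') //= quiver_op_r eqxx /= big1 ?addr0 // => p ne.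
  by rewrite quiver_op_r eq_sym (negPf ne) mul0r.
have X0 i q' w' : (c q' != s i) || (c w' != t i) -> X i q' w' = 0.
  by move=> h; apply/eqP; apply: contraT => /X_type[e1 e2 _]; rewrite e1 e2 !eqxx in h.
case: a1 a2 => [u|i] [v|j] /=.
- rewrite rl pb_rM quiver_op_r; have [<-|ne] := eqVneq u v.
    by rewrite quiver_op_r; case: (c q == u); rewrite ?andbF ?mul0r ?mul1r ?andbT.
  rewrite q0; have [->|_] := eqVneq (c q) u; last by rewrite mul0r.
  by rewrite (negPf ne) andbF mulr0.
- rewrite rl quiver_op_b -(pb_rb j) mulrA pb_rM.
  have [->|ne] := eqVneq u (s j).
    rewrite pb_rb quiver_op_b; have [e|ne'] := eqVneq (c q) (s j); first by rewrite mul1r.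
    by rewrite mul0r X0 ?ne'.
  rewrite mul0r q0; have [e|_] := eqVneq (c q) u; last by rewrite mul0r.
  by rewrite X0 ?mulr0 // e ne.
- transitivity (X i q w * (c w == v)%:R); last first.
    rewrite /fmul (bigD1 w) //= quiver_op_b quiver_op_r eqxx /= big1 ?addr0 // => p ne.
    by rewrite quiver_op_r (negPf ne) mulr0.
  rewrite -(pb_br i) -mulrA pb_rM; have [<-|ne] := eqVneq (t i) v.
    rewrite pb_br quiver_op_b; have [e|ne'] := eqVneq (c w) (t i); first by rewrite mulr1.
    by rewrite mulr0 X0 ?ne' ?orbT.
  rewrite mulr0 q0; have [e|_] := eqVneq (c w) v; last by rewrite mulr0.
  by rewrite X0 ?mul0r // e [v == _]eq_sym ne orbT.
- rewrite (eq_fmul (f' := X i) (g' := X j)) => [|p|p]; rewrite ?quiver_op_b //.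
  rewrite X_mul pb_bbE quiver_op_sum; apply: eq_bigr => z _.
  by rewrite quiver_op_b.
Qed.

Lemma pb_expandE u v x : let y := r u * x * r v in
  y = \sum_a basis_coord (B := B) a y *: basis_elt a.
Proof. by move=> y; rewrite {1}/y {1}pb_expand big_sumType. Qed.

Lemma quiver_opM u v v' u' x y q w :
  let x' := r u * x * r v in let y' := r v' * y * r u' in
  quiver_op (x' * y') q w = fmul (quiver_op x') (quiver_op y') q w.
Proof.
move=> x' y'; rewrite {1}[x']pb_expandE {1}[y']pb_expandE mulr_suml.
under eq_bigr do rewrite -scalerAl.
rewrite quiver_op_sum.
transitivity (\sum_a \sum_a' basis_coord (B := B) a x' * (basis_coord (B := B) a' y' *
   fmul (quiver_op (basis_elt (B := B) a)) (quiver_op (basis_elt (B := B) a')) q w)).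
  apply: eq_bigr => a _; rewrite mulr_sumr; under eq_bigr do rewrite -scalerAr.
  rewrite quiver_op_sum mulr_sumr; apply: eq_bigr => a' _.
  by rewrite quiver_op_basisM.
rewrite [RHS](eq_fmul
  (f' := fun q p =>
     \sum_a basis_coord (B := B) a x' * quiver_op (basis_elt (B := B) a) q p)
  (g' := fun p w =>
     \sum_a basis_coord (B := B) a y' * quiver_op (basis_elt (B := B) a) p w)).
- by rewrite fmul_suml; apply: eq_bigr => a _; rewrite fmul_sumr mulr_sumr.
- by move=> p; rewrite {1}[x']pb_expandE quiver_op_sum.
- by move=> p; rewrite {1}[y']pb_expandE quiver_op_sum.
Qed.

(** Inflation from the basic algebra to [R] by the matrix units. Positions are natural numbers
    because block sizes at vertices of equal type agree only propositionally. *)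
Definition block_entry (x : R) (q : 'I_l) (i : nat) (w : 'I_l) (j : nat) : K :=
  quiver_op (Q (c q) i * x * P (c w) j) q w.

Lemma QxP u i x v j : Q u i * x * P v j = r u * (Q u i * x * P v j) * r v.
Proof. by rewrite !mulrA pb_rQ -!mulrA pb_Pr. Qed.

Lemma block_entryD x y q i w j :
  block_entry (x + y) q i w j = block_entry x q i w j + block_entry y q i w j.
Proof. by rewrite /block_entry mulrDr mulrDl quiver_opD. Qed.

Lemma block_entryZ a x q i w j :
  block_entry (a *: x) q i w j = a * block_entry x q i w j.
Proof. by rewrite /block_entry -scalerAr -scalerAl quiver_opZ. Qed.

Lemma block_entry1 q i w j : (i < d (c q))%N -> (j < d (c w))%N ->
  block_entry 1 q i w j = ((q == w) && (i == j))%:R.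
Proof.
move=> iq jw; rewrite /block_entry mulr1 pb_QP //.
have [e|ne] := eqVneq (c q) (c w).
  case: (eqVneq i j) => _ /=; first by rewrite quiver_op_r eqxx !andbT.
  by rewrite andbF -(scale0r (0 : R)) quiver_opZ mul0r.
rewrite /= -(scale0r (0 : R)) quiver_opZ mul0r.
by have [e|//] := eqVneq q w; rewrite e eqxx in ne.
Qed.

Lemma block_entryM x y q i w j : block_entry (x * y) q i w j =
  \sum_p \sum_(e < d (c p)) block_entry x q i p e * block_entry y p e w j.
Proof.
have E : Q (c q) i * (x * y) * P (c w) j =
    \sum_v \sum_(e < d v) (Q (c q) i * x * P v e) * (Q v e * y * P (c w) j).
  rewrite -{1}(mulr1 x) -(pb_PQ B) mulr_sumr mulr_suml mulr_sumr mulr_suml.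
  apply: eq_bigr => v _; rewrite mulr_sumr mulr_suml mulr_sumr mulr_suml.
  by apply: eq_bigr => e _; rewrite !mulrA.
rewrite /block_entry E.
have opS (I : finType) (f : I -> R) :
    quiver_op (\sum_i0 f i0) q w = \sum_i0 quiver_op (f i0) q w.
  rewrite (eq_bigr (fun i0 => 1 *: f i0)) => [|i0 _]; last by rewrite scale1r.
  by rewrite quiver_op_sum; apply: eq_bigr => i0 _; rewrite mul1r.
have ct u v' z p p' : quiver_op (r u * z * r v') p p' != 0 -> c p' = v'.
  apply: contraNeq => ne; rewrite /quiver_op; apply/eqP.
  rewrite big1 ?addr0 => [|i0 _].
    have [e|_] := eqVneq p p'; last by rewrite mul0r.
    apply/eqP; apply: contraT; rewrite mulf_eq0 negb_or => /andP[_ /pb_lam_type[_ h]].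
    by rewrite -h e eqxx in ne.
  apply/eqP; apply: contraT; rewrite mulf_eq0 negb_or.
  by move=> /andP[/X_type[_ h _] /pb_cf_type[_ h']]; rewrite h h' eqxx in ne.
transitivity (\sum_v \sum_p if c p == v then \sum_(e < d v)
    quiver_op (Q (c q) i * x * P v e) q p * quiver_op (Q v e * y * P (c w) j) p w else 0).
  rewrite opS; apply: eq_bigr => v _; rewrite opS.
  under eq_bigr => e _ do rewrite QxP [Q v e * y * _]QxP quiver_opM -!QxP.
  rewrite /fmul exchange_big; apply: eq_bigr => p _; case: eqVneq => // ne.
  rewrite big1 // => e _; have [->|] := eqVneq (quiver_op (Q (c q) i * x * P v e) q p) 0.
    by rewrite mul0r.
  by rewrite QxP => /ct h; rewrite h eqxx in ne.
rewrite exchange_big; apply: eq_bigr => p _ /=.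
by rewrite (bigD1 (c p)) //= eqxx [X in _ + X]big1 ?addr0 // => v; rewrite eq_sym => /negPf->.
Qed.

(** This and [arrow_coord] depend on a component or a label, not on vertices: they are the free
    parameters that the blocks repeat up to scalars. *)
Definition diag_coord (x : R) u i j : K := lam u (Q u i * x * P u j).
Definition arrow_coord (x : R) e i j : K := cf e (Q (s e) i * x * P (t e) j).

Lemma block_entryE x q i w j : block_entry x q i w j =
  (q == w)%:R * diag_coord x (c q) i j + \sum_e X e q w * arrow_coord x e i j.
Proof.
rewrite /block_entry /quiver_op; congr (_ + _).
  by case: eqVneq => [->|_]; rewrite ?mul0r.
apply: eq_bigr => e _; have [->|/X_type[-> -> _]//] := eqVneq (X e q w) 0.
by rewrite !mul0r.
Qed.

Lemma block_entry_diag x q i j : block_entry x q i q j = diag_coord x (c q) i j.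
Proof.
rewrite block_entryE eqxx mul1r big1 ?addr0 // => e _.
by have [->|/X_type[_ _]] := eqVneq (X e q q) 0; rewrite ?mul0r ?ltnn.
Qed.

Lemma block_entry_arrow x e q i w j : X e q w != 0 ->
  block_entry x q i w j = X e q w * arrow_coord x e i j.
Proof.
move=> nz; have [_ _ lt] := X_type nz.
rewrite block_entryE (_ : (q == w) = false) ?mul0r ?add0r; last first.
  by apply/eqP => qw; rewrite qw ltnn in lt.
rewrite (bigD1 e) //= big1 ?addr0 // => e' ne.
have [->|nz'] := eqVneq (X e' q w) 0; first by rewrite mul0r.
by rewrite (X_disj nz' nz) eqxx in ne.
Qed.

Lemma block_entry_none x q i w j : q != w -> (forall e, X e q w = 0) ->
  block_entry x q i w j = 0.
Proof.
move=> /negPf ne h; rewrite block_entryE ne mul0r add0r big1 // => e _.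
by rewrite h mul0r.
Qed.

Lemma block_entry_neq0 x q i w j : block_entry x q i w j != 0 -> (q <= w)%N.
Proof.
have [->//|ne] := eqVneq q w; have [[e nz] _|none] := pselect (exists e, X e q w != 0).
  by have [_ _ /ltnW] := X_type nz.
rewrite block_entry_none ?eqxx // => e; apply/eqP; apply: contraT => nz.
by case: none; exists e.
Qed.

Lemma diag_coordM x y u i j : diag_coord (x * y) u i j =
  \sum_(e < d u) diag_coord x u i e * diag_coord y u e j.
Proof.
have [q <-] := c_surj u; rewrite -block_entry_diag block_entryM (bigD1 q) //=.
rewrite [X in _ + X]big1 ?addr0 => [|p ne].
  by apply: eq_bigr => e _; rewrite !block_entry_diag.
rewrite big1 // => e _; have [->|nz] := eqVneq (block_entry x q i p e) 0.
  by rewrite mul0r.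
have [->|nz'] := eqVneq (block_entry y p e q j) 0; first by rewrite mulr0.
case/negP: ne; apply/eqP/val_inj/anti_leq.
by rewrite (block_entry_neq0 nz) (block_entry_neq0 nz').
Qed.

(** Vanishing arrow coordinates mean a block diagonal matrix, a property kept by products; each
    label is tested at a position where it occurs. *)
Lemma arrow_coordM0 x y :
  (forall e i j, (i < d (s e))%N -> (j < d (t e))%N -> arrow_coord x e i j = 0) ->
  (forall e i j, (i < d (s e))%N -> (j < d (t e))%N -> arrow_coord y e i j = 0) ->
  forall e i j, (i < d (s e))%N -> (j < d (t e))%N -> arrow_coord (x * y) e i j = 0.
Proof.
move=> x0 y0 e i j iu jv; have [q [w nz]] := X_occ e.
have off z : (forall e i j, (i < d (s e))%N -> (j < d (t e))%N -> arrow_coord z e i j = 0) ->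
    forall q i w j, (i < d (c q))%N -> (j < d (c w))%N -> q != w -> block_entry z q i w j = 0.
  move=> z0 q' i' w' j' lt1 lt2 /negPf ne; rewrite block_entryE ne mul0r add0r.
  rewrite big1 // => e' _; have [->|/X_type[sq tw _]] := eqVneq (X e' q' w') 0.
    by rewrite mul0r.
  by rewrite z0 ?mulr0 // -?sq -?tw.
have [sq tw lt] := X_type nz; apply: (mulfI nz).
rewrite mulr0 -block_entry_arrow // block_entryM big1 // => p _; rewrite big1 // => e' _.
have [qp|ne] := eqVneq q p; last by rewrite (off x x0) ?mul0r // sq.
rewrite (off y y0) ?mulr0 ?tw //.
by apply: contraTneq lt => pw; rewrite qp pw ltnn.
Qed.

Lemma coords_inj x : (forall u i j, (i < d u)%N -> (j < d u)%N -> diag_coord x u i j = 0) ->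
  (forall e i j, (i < d (s e))%N -> (j < d (t e))%N -> arrow_coord x e i j = 0) -> x = 0.
Proof.
move=> dx ax.
have QxP0 u i v j : (i < d u)%N -> (j < d v)%N -> Q u i * x * P v j = 0.
  move=> iu jv; rewrite QxP pb_expand -QxP !big1 ?addr0 // => e _.
    have [->|] := eqVneq (cf e (Q u i * x * P v j)) 0; first by rewrite scale0r.
    rewrite {1}QxP => /pb_cf_type[su tv]; subst u v.
    by rewrite -[cf e _]/(arrow_coord x e i j) ax // scale0r.
  have [->|] := eqVneq (lam e (Q u i * x * P v j)) 0; first by rewrite scale0r.
  rewrite {1}QxP => /pb_lam_type[su tv]; subst u v.
  by rewrite -[lam e _]/(diag_coord x e i j) dx // scale0r.
transitivity (1 * x * 1); first by rewrite mul1r mulr1.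
rewrite -{1}(pb_PQ B) !mulr_suml big1 // => u _; rewrite !mulr_suml big1 // => i _.
rewrite -(pb_PQ B) mulr_sumr big1 // => v _; rewrite mulr_sumr big1 // => j _.
by rewrite -!mulrA (mulrA x) (mulrA (Q u i)) (mulrA (Q u i)) QxP0 // mul0r mulr0.
Qed.

Lemma block_entry_inj x : (forall q i w j, (i < d (c q))%N -> (j < d (c w))%N ->
  block_entry x q i w j = 0) -> x = 0.
Proof.
move=> h; apply: coords_inj => [u|e] i j iu jv.
  by have [q qu] := c_surj u; subst u; rewrite -block_entry_diag h.
have [q [w nz]] := X_occ e; have [sq tw _] := X_type nz.
by apply: (mulfI nz); rewrite mulr0 -block_entry_arrow // h ?sq ?tw.
Qed.

Lemma diag_coord1 u i j : (i < d u)%N -> (j < d u)%N ->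
  diag_coord 1 u i j = (i == j)%:R.
Proof.
by have [q <-] := c_surj u => iu ju; rewrite -block_entry_diag block_entry1 // eqxx.
Qed.

Lemma arrow_coord1 e i j : (i < d (s e))%N -> (j < d (t e))%N ->
  arrow_coord 1 e i j = 0.
Proof.
move=> iu jv; have [q [w nz]] := X_occ e; have [sq tw lt] := X_type nz.
apply: (mulfI nz); rewrite mulr0 -block_entry_arrow // block_entry1 ?sq ?tw //.
by rewrite (_ : (q == w) = false) //; apply/eqP => qw; rewrite qw ltnn in lt.
Qed.

(** The matrix is strictly block upper triangular with [l] diagonal blocks. *)
Lemma diag_nilpotent x :
  (forall u i j, (i < d u)%N -> (j < d u)%N -> diag_coord x u i j = 0) ->
  x ^+ l = 0.
Proof.
move=> x0; have main n q i w j : (i < d (c q))%N -> (j < d (c w))%N ->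
    block_entry (x ^+ n) q i w j != 0 -> (q + n <= w)%N.
  elim: n q i w j => [|n IH] q i w j iu jv; first by rewrite addn0 => /block_entry_neq0.
  rewrite exprS block_entryM => nz; apply: contraT; rewrite -ltnNge => lt.
  case/negP: nz; apply/eqP; rewrite big1 // => p _; rewrite big1 // => e _.
  have [->|nz] := eqVneq (block_entry x q i p e) 0; first by rewrite mul0r.
  have [->|nz'] := eqVneq (block_entry (x ^+ n) p e w j) 0; first by rewrite mulr0.
  have le1 := IH p e w j (ltn_ord e) jv nz'.
  have qp : (q < p)%N.
    rewrite ltn_neqAle (block_entry_neq0 nz) andbT; apply: contraNneq nz => qp.
    have eqp : q = p by exact: val_inj.
    by subst p; rewrite block_entry_diag x0.
  by move: lt; rewrite ltnNge addnS -addSn (leq_trans _ le1) // leq_add2r.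
apply: block_entry_inj => q i w j iu jv; apply/eqP; apply: contraT.
move=> /(main _ _ _ _ _ iu jv); rewrite leqNgt.
by rewrite (leq_trans (ltn_ord w)) // leq_addl.
Qed.

(** The inverse of the coordinate map. [D] and [E] are arbitrary, so the coordinates are
    independent, and by [coords_inj] they determine the element. *)
Definition reconstruct (D : 'I_k -> nat -> nat -> K) (E : 'I_m -> nat -> nat -> K) : R :=
  \sum_u \sum_(i < d u) \sum_(j < d u) D u i j *: (P u i * Q u j) +
  \sum_e \sum_(i < d (s e)) \sum_(j < d (t e)) E e i j *: (P (s e) i * b e * Q (t e) j).

Lemma Q_reconstruct_P D E u i v j : (i < d u)%N -> (j < d v)%N ->
  Q u i * reconstruct D E * P v j =
  (if u == v then D u i j *: r u else 0) +
  \sum_e (if (s e == u) && (t e == v) then E e i j *: b e else 0).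
Proof.
move=> iu jv; rewrite /reconstruct mulrDr mulrDl; congr (_ + _).
  rewrite mulr_sumr mulr_suml (bigD1 u) //= [X in _ + X]big1 ?addr0 => [|u' ne].
    rewrite mulr_sumr mulr_suml (bigD1 (Ordinal iu)) //= [X in _ + X]big1 ?addr0.
      rewrite mulr_sumr mulr_suml; have [e|ne] := eqVneq u v.
        subst v; rewrite (bigD1 (Ordinal jv)) //= big1 ?addr0 => [|j' ne].
          by rewrite -scalerAr -scalerAl mulrA pb_QP // -mulrA pb_QP // !eqxx /= pb_rM eqxx.
        rewrite -scalerAr -scalerAl -!mulrA pb_QP // eqxx /=.
        by rewrite (_ : (j' == j :> nat) = false) ?mulr0 ?scaler0 //; exact: negbTE ne.
      rewrite big1 // => j' _; rewrite -scalerAr -scalerAl -!mulrA pb_QP //.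
      by rewrite (negPf ne) /= !mulr0 scaler0.
    move=> i' ne; rewrite mulr_sumr mulr_suml big1 // => j' _.
    rewrite -scalerAr -scalerAl mulrA pb_QP // eqxx /= eq_sym.
    by rewrite (_ : (i' == i :> nat) = false) ?mul0r ?scaler0 //; exact: negbTE ne.
  rewrite mulr_sumr mulr_suml big1 // => i' _; rewrite mulr_sumr mulr_suml big1 // => j' _.
  by rewrite -scalerAr -scalerAl mulrA pb_QP // eq_sym (negPf ne) /= !mul0r scaler0.
rewrite mulr_sumr mulr_suml; apply: eq_bigr => e _.
have [su|ne] := eqVneq (s e) u; last first.
  rewrite mulr_sumr mulr_suml big1 // => i' _; rewrite mulr_sumr mulr_suml big1 // => j' _.
  by rewrite -scalerAr -scalerAl !mulrA pb_QP // eq_sym (negPf ne) /= !mul0r scaler0.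
have [tv|ne] := eqVneq (t e) v; last first.
  rewrite mulr_sumr mulr_suml big1 // => i' _; rewrite mulr_sumr mulr_suml big1 // => j' _.
  by rewrite -scalerAr -scalerAl -!mulrA pb_QP // (negPf ne) /= !mulr0 scaler0.
subst u v; rewrite mulr_sumr mulr_suml (bigD1 (Ordinal iu)) //= [X in _ + X]big1 ?addr0.
  rewrite mulr_sumr mulr_suml (bigD1 (Ordinal jv)) //= big1 ?addr0 => [|j' ne].
    rewrite -scalerAr -scalerAl !mulrA pb_QP // -!mulrA pb_QP // !eqxx /=.
    by rewrite pb_br pb_rb.
  rewrite -scalerAr -scalerAl -!mulrA pb_QP // eqxx /=.
  by rewrite (_ : (j' == j :> nat) = false) ?mulr0 ?scaler0 //; exact: negbTE ne.
move=> i' ne; rewrite mulr_sumr mulr_suml big1 // => j' _.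
rewrite -scalerAr -scalerAl !mulrA pb_QP // eqxx /= eq_sym.
by rewrite (_ : (i' == i :> nat) = false) ?mul0r ?scaler0 //; exact: negbTE ne.
Qed.

Lemma diag_reconstruct D E u i j : (i < d u)%N -> (j < d u)%N ->
  diag_coord (reconstruct D E) u i j = D u i j.
Proof.
move=> iu ju; rewrite /diag_coord Q_reconstruct_P // eqxx linearD linearZ /=.
rewrite pb_lam_r eqxx mulr1 linear_sum big1 ?addr0 // => e _.
by case: ifP => _; rewrite ?linear0 // linearZ /= pb_lam_b mulr0.
Qed.

Lemma arrow_reconstruct D E e i j : (i < d (s e))%N -> (j < d (t e))%N ->
  arrow_coord (reconstruct D E) e i j = E e i j.
Proof.
move=> iu ju; rewrite /arrow_coord Q_reconstruct_P // linearD linear_sum (bigD1 e) //=.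
rewrite !eqxx /= linearZ /= pb_cf_b eqxx mulr1 big1 ?addr0 => [|e' ne]; last first.
  by case: ifP => _; rewrite ?linear0 // linearZ /= pb_cf_b eq_sym (negPf ne) mulr0.
by case: ifP => _; rewrite ?linear0 ?add0r // linearZ /= pb_cf_r mulr0 add0r.
Qed.

Lemma diag_coord_linear u i j a x y :
  diag_coord (a *: x + y) u i j = a * diag_coord x u i j + diag_coord y u i j.
Proof. by rewrite /diag_coord mulrDr mulrDl -scalerAr -scalerAl linearP. Qed.

Lemma arrow_coord_linear e i j a x y :
  arrow_coord (a *: x + y) e i j = a * arrow_coord x e i j + arrow_coord y e i j.
Proof. by rewrite /arrow_coord mulrDr mulrDl -scalerAr -scalerAl linearP. Qed.

Lemma block_reconstruct D E q i w j : (i < d (c q))%N -> (j < d (c w))%N ->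
  block_entry (reconstruct D E) q i w j =
  (q == w)%:R * D (c q) i j + \sum_e X e q w * E e i j.
Proof.
move=> iq jw; rewrite block_entryE; congr (_ + _).
  by case: eqVneq jw => [<-|] jw; rewrite ?mul0r // diag_reconstruct.
apply: eq_bigr => e _; have [->|/X_type[sq tw _]] := eqVneq (X e q w) 0.
  by rewrite !mul0r.
by rewrite arrow_reconstruct -?sq -?tw.
Qed.

End BlockCoordinates.

Local Open Scope classical_set_scope.

(** * Polynomial relations *)

Section InfiniteFields.

Lemma infinite_roots_eq0 (F K : fieldType) (iota : {rmorphism F -> K})
    (p : {poly K}) :
  infinite_set [set: F] -> (forall a, p.[iota a] = 0) -> p = 0.
Proof.
move=> infF p0; apply: contraTeq isT => nz.
have [S _ sS] := infinite_set_fset (size p) infF.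
pose rs := [seq iota a | a <- enum_fset S].
have : (size rs < size p)%N.
  apply: max_poly_roots nz _ _; first by apply/allP => _ /mapP[a _ ->]; rewrite /root p0.
  by rewrite map_inj_uniq ?fset_uniq //; exact: fmorph_inj.
by rewrite size_map ltnNge sS.
Qed.

Lemma infinite_set_image (F K : fieldType) (iota : {rmorphism F -> K}) :
  infinite_set [set: F] -> infinite_set [set: K].
Proof.
move=> infF finK; apply: infF; apply: (sub_finite_set (B := iota @^-1` [set: K])) => //.
by apply: finite_preimage => // x y _ _; exact: fmorph_inj.
Qed.

(** Induction on the number of variables: [muni] makes [p] univariate in the last variable, and at
    each point the evaluated coefficients vanish by counting roots. *)
Lemma mpoly_eval_eq0 (K : fieldType) (n : nat) (p : {mpoly K[n]}) :
  infinite_set [set: K] -> (forall v, p.@[v] = 0) -> p = 0.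
Proof.
move=> infK; elim: n p => [|n IH] p p0.
  apply/mpolyP => mm; rewrite mcoeff0.
  have := p0 (fun=> 0); rewrite mevalE.
  have E m1 : m1 = mm :> 'X_{1.. 0} by apply/mnmP => -[].
  have [ms|] := boolP (mm \in msupp p); last by move/memN_msupp_eq0.
  rewrite (big_rem mm ms) /= big_ord0 mulr1 big_seq big1 ?addr0 // => m1.
  by rewrite (E m1) mem_rem_uniq ?msupp_uniq // inE eqxx.
pose low (mm : 'X_{1.. n.+1}) : 'X_{1.. n} := [multinom mm (widen_ord (leqnSn n) i) | i < n].
have muE : muni p = \sum_(mm <- msupp p) (p@_mm *: 'X_[low mm]) *: 'X^(mm ord_max).
  exact: muniE.
have mu0 : muni p = 0.
  apply/polyP => j; rewrite coef0; apply: IH => v.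
  suff /polyP/(_ j) : map_poly (meval v) (muni p) = 0 by rewrite coef_map coef0.
  apply: (@infinite_roots_eq0 K K idfun) => // a.
  pose w (i : 'I_n.+1) := if insub (val i) is Some i' then v i' else a.
  rewrite -[RHS](p0 w) mevalE muE rmorph_sum horner_sum /=.
  apply: eq_bigr => mm _; rewrite map_polyZ /= map_polyXn hornerZ hornerXn mevalZ.
  rewrite big_ord_recr /= mulrA; congr (_ * _ * _).
    rewrite mevalX; apply: eq_bigr => i _; rewrite mnmE; congr (_ ^+ _).
    by rewrite /w /= insubT //= => lt; congr v; apply: val_inj.
  by congr (_ ^+ _); rewrite /w insubF //= ltnn.
apply/mpolyP => mm; rewrite mcoeff0.
(* A monomial is determined by its last exponent and its remaining part [low], so the coefficients
   of [p] can be read off from [muni p]. *)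
have := congr1 (fun q : {poly {mpoly K[n]}} => (q`_(mm ord_max))@_(low mm)) mu0.
rewrite muE coef0 mcoeff0 coef_sum raddf_sum /=.
under eq_bigr => m1 _ do rewrite coefZ coefXn.
have F m1 : (p@_m1 *: 'X_[low m1] * (mm ord_max == m1 ord_max)%:R)@_(low mm) =
    if m1 == mm then p@_m1 else 0.
  have [->|ne] := eqVneq m1 mm.
    by rewrite eqxx mulr1 mcoeffZ mcoeffX eqxx mulr1.
  have [e|] := eqVneq (mm ord_max) (m1 ord_max); last by rewrite mulr0 mcoeff0.
  rewrite mulr1 mcoeffZ mcoeffX; case: eqP => [e'|_]; last by rewrite mulr0.
  case/negP: ne; apply/eqP/mnmP => i.
  have [lt|ge] := ltnP i n.
    have := congr1 (fun x : 'X_{1.. n} => x (Ordinal lt)) e'; rewrite !mnmE.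
    by rewrite (_ : widen_ord _ _ = i) //; apply: val_inj.
  rewrite (_ : i = ord_max) ?e //; apply: val_inj; apply/eqP.
  by rewrite eqn_leq ge -ltnS ltn_ord.
under eq_bigr => m1 _ do rewrite F.
have [ms|] := boolP (mm \in msupp p); last by move/memN_msupp_eq0.
rewrite (big_rem mm ms) /= eqxx big_seq big1 ?addr0 // => m1.
by rewrite mem_rem_uniq ?msupp_uniq // inE => /andP[/negPf->].
Qed.

End InfiniteFields.

Section ClosureScaling.
Variables (F : fieldType) (K : closedFieldType) (iota : {rmorphism F -> K}).
Variables (A : algType F) (n : nat) (rho : representation iota A n).

(** Along the line [t M] a relation is a polynomial in [t] vanishing on the infinite image of [F],
    hence everywhere. This makes the closure a space over [K]. *)
Lemma zariski_closure_scale (a : K) (M : 'M[K]_n) : infinite_set [set: F] ->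
  zariski_closure (range rho) M -> zariski_closure (range rho) (a *: M).
Proof.
move=> infF clM f Xf.
pose q : {poly K} := mmap polyC (fun i => (mxvec M 0 i) *: 'X) f.
have qE t : q.[t] = mx_eval (t *: M) f.
  rewrite /q /mmap horner_sum /mx_eval mevalE; apply: eq_bigr => mm _.
  rewrite hornerM hornerC /mmap1 horner_prod; congr (_ * _); apply: eq_bigr => i _.
  by rewrite horner_exp hornerZ hornerX linearZ mxE mulrC.
rewrite -qE (@infinite_roots_eq0 _ _ iota q) ?horner0 // => b.
by rewrite qE; apply: (zariski_closureZ b clM).
Qed.

End ClosureScaling.

Section Ideals.
Variables (K : fieldType) (n : nat) (G : {mpoly K[n]} -> Prop).

Let I := ideal_generated G.

Lemma ideal_generatedD f g : I f -> I g -> I (f + g).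
Proof.
move=> [s sG ->] [t tG ->]; exists (s ++ t); last by rewrite big_cat.
by move=> p; rewrite mem_cat => /orP[/sG|/tG].
Qed.

Lemma ideal_generated_mul f g : I g -> I (f * g).
Proof.
move=> [s sG ->]; exists [seq (f * p.1, p.2) | p <- s].
  by move=> _ /mapP[p /sG h ->].
by rewrite big_map mulr_sumr; apply: eq_bigr => p _; rewrite mulrA.
Qed.

Lemma ideal_generated0 : I 0.
Proof. by exists [::] => //; rewrite big_nil. Qed.

Lemma ideal_generated_gen g : G g -> I g.
Proof.
move=> Gg; exists [:: (1, g)]; last by rewrite big_seq1 mul1r.
by move=> p; rewrite inE => /eqP->.
Qed.

(** Modulo the ideal each variable equals its substitute, and sums and products respect
    congruences. *)
Lemma ideal_generated_comp (lq : n.-tuple {mpoly K[n]}) f :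
  (forall i, I ('X_i - tnth lq i)) -> I (f - comp_mpoly lq f).
Proof.
move=> h.
have mulB g1 g2 h1 h2 : I (g1 - g2) -> I (h1 - h2) -> I (g1 * h1 - g2 * h2).
  move=> i1 i2; have -> : g1 * h1 - g2 * h2 = h1 * (g1 - g2) + g2 * (h1 - h2).
    by rewrite !mulrBr [h1 * g1]mulrC [h1 * g2]mulrC addrA subrK.
  by apply: ideal_generatedD; exact: ideal_generated_mul.
elim/mpolyind: f => [|a mm p _ _ IH].
  by rewrite comp_mpoly0 subrr; exact: ideal_generated0.
rewrite comp_mpolyD opprD addrACA; apply: ideal_generatedD => //.
rewrite comp_mpolyZ -scalerBr -mul_mpolyC; apply: ideal_generated_mul.
rewrite comp_mpolyX mpolyXE_id.
apply: (big_ind2 (fun x y => I (x - y))) => [|x1 x2 y1 y2|i _].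
- by rewrite subrr; exact: ideal_generated0.
- exact: mulB.
- elim: (mm i) => [|e IHe]; first by rewrite !expr0 subrr; exact: ideal_generated0.
  by rewrite !exprS; apply: mulB.
Qed.

End Ideals.

Section NatIndexedMatrices.
Variable K : fieldType.

(** The default 0 outside the range lets one formula serve blocks whose sizes are equal only
    propositionally. *)
Definition mx_nat (p q : nat) (M : 'M[K]_(p, q)) (i j : nat) : K :=
  if insub i is Some i' then if insub j is Some j' then M i' j' else 0 else 0.

Lemma mx_natE p q (M : 'M[K]_(p, q)) (i : 'I_p) (j : 'I_q) : mx_nat M i j = M i j.
Proof. by rewrite /mx_nat !valK. Qed.

Lemma mx_nat_eq p q (M : 'M[K]_(p, q)) (i' j' : nat) (i : 'I_p) (j : 'I_q) :
  i' = i -> j' = j -> mx_nat M i' j' = M i j.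
Proof. by move=> -> ->; exact: mx_natE. Qed.

Definition block_mx_nat (l : nat) (d : 'I_l -> nat)
    (f : 'I_l -> nat -> 'I_l -> nat -> K) : 'M[K]_(\sum_r d r) :=
  \matrix_(a, e) f (tagnat.sig1 a) (tagnat.sig2 a) (tagnat.sig1 e) (tagnat.sig2 e).

Lemma block_mx_natE l (d : 'I_l -> nat) f q i w j :
  @block_mx_nat l d f (tagnat.Rank q i) (tagnat.Rank w j) = f q i w j.
Proof. by rewrite mxE !tagnat.Rank2K /= !tagnat.Rank1K. Qed.

Lemma block_mx_natP l (d : 'I_l -> nat) (M N : 'M[K]_(\sum_r d r)) :
  (forall q i w j, M (tagnat.Rank q i) (tagnat.Rank w j) =
                   N (tagnat.Rank q i) (tagnat.Rank w j)) -> M = N.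
Proof.
by move=> h; apply/matrixP => a e; rewrite -(tagnat.sig2K a) -(tagnat.sig2K e).
Qed.

Lemma sum_Rank l (d : 'I_l -> nat) (f : 'I_(\sum_r d r) -> K) :
  \sum_a f a = \sum_q \sum_i f (@tagnat.Rank l d q i).
Proof.
rewrite sig_big_dep /= (reindex _ tagnat.sig_bij_on) /=; apply: eq_bigr => a _.
by rewrite tagnat.sig2K.
Qed.

End NatIndexedMatrices.

Section RelationsOfGluing.
Variables (K : fieldType) (Q : full_quiver K).
Variable X : set 'M[K]_(\sum_r fq_degree (f := Q) r).
Hypothesis gluingP : forall r s r' s' nu, fq_gluing r s r' s' nu ->
  proportional_gluing (d := @fq_degree _ Q) X r s r' s' nu.

Lemma gluing_generator_relation f :
  ideal_generated (gluing_generator X) f -> polynomial_relation X f.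
Proof.
have var M a e : mx_eval M (mx_var K a e) = M a e.
  by rewrite /mx_eval mevalXU mxvecE.
case=> s sG -> M XM; rewrite /mx_eval rmorph_sum big_seq big1 // => p /sG gen.
rewrite rmorphM /=; suff -> : p.2.@[fun i => mxvec M 0 i] = 0 by rewrite mulr0.
case: p.2 / gen => [r s' i j h|r s' r' s'' nu i j i' j' gl ei ej].
  rewrite -[LHS]/(mx_eval M _) var.
  by have /matrixP/(_ i j) := h M XM; rewrite !mxE.
rewrite mevalB mevalZ -!/(mx_eval M _) !var.
by have [_ _ /(_ M XM i j i' j' ei ej)] := gluingP gl; rewrite !mxE => ->; rewrite subrr.
Qed.

End RelationsOfGluing.

(** * Wedderburn decomposition and block representation *)

Section BlockRepresentation.
Variables (F : fieldType) (K : closedFieldType) (iota : {rmorphism F -> K}).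
Variables (A : algType F) (R : falgType K).
Variables (psi : {rmorphism A -> R}) (phi : R -> A).
Hypothesis psiZ : forall a x, psi (a *: x) = iota a *: psi x.
Hypotheses (psiK : cancel psi phi) (phiK : cancel phi psi).
Variable B : peirce_basis R.

Local Notation k := (pb_k B).
Local Notation m := (pb_m B).
Local Notation d := (pb_d (p := B)).
Local Notation s := (pb_s (p := B)).
Local Notation t := (pb_t (p := B)).

Variables (l : nat) (c : 'I_l -> 'I_k) (X : 'I_m -> 'I_l -> 'I_l -> K).
Hypothesis X_type : forall i x y, X i x y != 0 -> [/\ c x = s i, c y = t i & (x < y)%N].
Hypothesis X_mul : forall i j x y,
  fmul (X i) (X j) x y = \sum_l pb_gam i j l * X l x y.
Hypothesis X_disj : forall i j x y, X i x y != 0 -> X j x y != 0 -> i = j.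
Hypothesis X_occ : forall i, exists x y, X i x y != 0.
Hypothesis c_surj : forall u, exists x, c x = u.

Let dg x u i j := diag_coord (B := B) (psi x) u i j.
Let ar x e i j := arrow_coord (B := B) (psi x) e i j.
Let be x q i w j := block_entry c X (psi x) q i w j.
Let rec D E := phi (reconstruct (B := B) D E).

Let dg_linear a x y u i j : dg (a *: x + y) u i j = iota a * dg x u i j + dg y u i j.
Proof. by rewrite /dg rmorphD psiZ diag_coord_linear. Qed.
Let dgD x y u i j : dg (x + y) u i j = dg x u i j + dg y u i j.
Proof. by rewrite -[x]scale1r dg_linear rmorph1 mul1r scale1r. Qed.
Let dg0 u i j : dg 0 u i j = 0.
Proof. by apply: (addrI (dg 0 u i j)); rewrite -dgD !addr0. Qed.
Let dgZ a x u i j : dg (a *: x) u i j = iota a * dg x u i j.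
Proof. by rewrite -[a *: x]addr0 dg_linear dg0 addr0. Qed.
Let ar_linear a x y e i j : ar (a *: x + y) e i j = iota a * ar x e i j + ar y e i j.
Proof. by rewrite /ar rmorphD psiZ arrow_coord_linear. Qed.
Let arD x y e i j : ar (x + y) e i j = ar x e i j + ar y e i j.
Proof. by rewrite -[x]scale1r ar_linear rmorph1 mul1r scale1r. Qed.
Let ar0 e i j : ar 0 e i j = 0.
Proof. by apply: (addrI (ar 0 e i j)); rewrite -arD !addr0. Qed.
Let arZ a x e i j : ar (a *: x) e i j = iota a * ar x e i j.
Proof. by rewrite -[a *: x]addr0 ar_linear ar0 addr0. Qed.
Let dgM x y u i j : dg (x * y) u i j = \sum_(e < d u) dg x u i e * dg y u e j.
Proof. by rewrite /dg rmorphM (diag_coordM X_type X_mul c_surj). Qed.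
Let dg1 u i j : (i < d u)%N -> (j < d u)%N -> dg 1 u i j = (i == j)%:R.
Proof. by move=> iu ju; rewrite /dg rmorph1 (diag_coord1 X_type c_surj). Qed.
Let ar1 e i j : (i < d (s e))%N -> (j < d (t e))%N -> ar 1 e i j = 0.
Proof. by move=> iu ju; rewrite /ar rmorph1 (arrow_coord1 X_type X_disj X_occ). Qed.
Let dg_rec D E u i j : (i < d u)%N -> (j < d u)%N -> dg (rec D E) u i j = D u i j.
Proof. by move=> iu ju; rewrite /dg phiK diag_reconstruct. Qed.
Let ar_rec D E e i j : (i < d (s e))%N -> (j < d (t e))%N -> ar (rec D E) e i j = E e i j.
Proof. by move=> iu ju; rewrite /ar phiK arrow_reconstruct. Qed.

Let A_eq x y :
  (forall u i j, (i < d u)%N -> (j < d u)%N -> dg x u i j = dg y u i j) ->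
  (forall e i j, (i < d (s e))%N -> (j < d (t e))%N -> ar x e i j = ar y e i j) -> x = y.
Proof.
move=> hd ha; apply: (can_inj psiK); apply/eqP; rewrite -subr_eq0; apply/eqP.
apply: coords_inj => [u|e] i j iu jv.
  rewrite -rmorphB -/(dg (x - y) u i j); apply: (addIr (dg y u i j)).
  by rewrite -dgD subrK add0r hd.
rewrite -rmorphB -/(ar (x - y) e i j); apply: (addIr (ar y e i j)).
by rewrite -arD subrK add0r ha.
Qed.

Definition diag_vanish x : Prop :=
  forall u i j, (i < d u)%N -> (j < d u)%N -> dg x u i j = 0.
Definition arrow_vanish x : Prop :=
  forall e i j, (i < d (s e))%N -> (j < d (t e))%N -> ar x e i j = 0.

(** The elements whose column [j] in the component [u] vanishes form a maximal left ideal, which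
    gives one inclusion. Conversely, vanishing diagonal coordinates make every [a * x] nilpotent and
    [1 - a * x] invertible, so no maximal left ideal can miss [x]. *)
Lemma jacobson_radicalP x : jacobson_radical x <-> diag_vanish x.
Proof.
split=> [Jx u i j iu ju|x0 I [[I0 ID IM] IT Imax]].
  pose I : set A := [set y | forall i', (i' < d u)%N -> dg y u i' j = 0].
  suff : maximal_left_ideal I by move=> /Jx; apply.
  split.
  - split=> [i' iu'|y z Iy Iz i' iu'|a y Iy i' iu']; first exact: dg0.
      by rewrite dgD Iy ?Iz ?addr0.
    by rewrite dgM big1 // => e _; rewrite Iy ?mulr0.
  - move=> IT; have : I 1 by rewrite IT.
    by move=> /(_ j ju) /eqP; rewrite dg1 // eqxx oner_eq0.
  - move=> I' [I'0 I'D I'M] sub; have [sub'|] := pselect (I' `<=` I).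
      by left; rewrite eqEsubset.
    move=> /existsNP[y /not_implyP[I'y /existsNP[i0 /not_implyP[i0u /eqP y0]]]].
    right; rewrite eqEsubset; split=> // z _.
    (* Only column [i0] of [g] is nonzero, scaled so that [g * y] and [z] have the same column [j]
       in the component [u]. *)
    pose D (v : 'I_k) a e := if (v == u) && (e == i0) then dg z u a j / dg y u i0 j else 0.
    pose g := rec D (fun _ _ _ => 0).
    rewrite -(subrK (g * y) z); apply: I'D; last exact: I'M.
    apply: sub => i' iu'; rewrite -[z]/(id z).
    have -> : z - g * y = (-1) *: (g * y) + z by rewrite scaleN1r addrC.
    rewrite dg_linear rmorphN1 mulN1r dgM (bigD1 (Ordinal i0u)) //= big1 ?addr0.
      by rewrite dg_rec // /D !eqxx /= divfK // addNr.
    move=> e ne; rewrite dg_rec // /D eqxx (_ : (_ == _) = false) ?mul0r //.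
    exact: negbTE ne.
apply: contrapT => nIx.
pose I' : set A := [set z | exists2 y, I y & exists a, z = y + a * x].
have [||I'I|I'T] := Imax I'.
- split; first by exists 0 => //; exists 0; rewrite mul0r addr0.
    move=> _ _ [y Iy [a ->]] [y' Iy' [a' ->]].
    by exists (y + y'); [exact: ID|exists (a + a'); rewrite mulrDl addrACA].
  move=> e _ [y Iy [a ->]]; exists (e * y); first exact: IM.
  by exists (e * a); rewrite mulrDr mulrA.
- by move=> y Iy; exists y => //; exists 0; rewrite mul0r addr0.
- by apply: nIx; rewrite -I'I; exists 0 => //; exists 1; rewrite mul1r add0r.
have : I' 1 by rewrite I'T.
case=> y Iy [a e1].
have nil : nilpotent_elt (a * x).
  exists l; apply: (can_inj psiK); rewrite rmorph0 rmorphXn.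
  apply: (diag_nilpotent X_type X_mul X_disj X_occ c_surj) => u i j iu ju.
  by rewrite -/(dg (a * x) u i j) dgM big1 // => e _; rewrite x0 ?mulr0.
have [z [_ z1]] := nilpotent_inv1B nil.
apply: IT; rewrite eqEsubset; split=> // w _.
rewrite -[w]mulr1 -z1 mulrA; apply: (IM); rewrite {1}e1 addrK.
exact: Iy.
Qed.

(** Under [psi], the [K]-span of the [P u i * Q u j], a full matrix algebra. *)
Definition diag_component (u : 'I_k) : set A :=
  [set x | (forall v i j, (i < d v)%N -> (j < d v)%N -> v != u -> dg x v i j = 0) /\
           arrow_vanish x].

Let component_subalgebra u : nonunital_subalgebra (diag_component u).
Proof.
split.
- by split=> [v i j *|e i j *]; rewrite ?dg0 ?ar0.
- move=> x y [dx ax] [dy ay]; split=> [v i j *|e i j *];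
    by rewrite ?dgD ?arD ?dx ?dy ?ax ?ay ?addr0.
- move=> x y [dx ax] [dy ay]; split=> [v i j iv jv ne|].
    by rewrite dgM big1 // => e _; rewrite dx // mul0r.
  rewrite /arrow_vanish /ar rmorphM.
  exact: (arrow_coordM0 X_type X_mul X_disj X_occ).
- by move=> a x [dx ax]; split=> [v i j *|e i j *]; rewrite ?dgZ ?arZ ?dx ?ax ?mulr0.
Qed.

Definition diag_mx u (x : A) : 'M[K]_(d u) := \matrix_(i, j) dg x u i j.

Let diag_mxD u x y : diag_mx u (x + y) = diag_mx u x + diag_mx u y.
Proof. by apply/matrixP => i j; rewrite !mxE dgD. Qed.
Let diag_mxM u x y : diag_mx u (x * y) = diag_mx u x *m diag_mx u y.
Proof. by apply/matrixP => i j; rewrite !mxE dgM; apply: eq_bigr => e _; rewrite !mxE. Qed.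
Let diag_mxZ u a x : diag_mx u (a *: x) = iota a *: diag_mx u x.
Proof. by apply/matrixP => i j; rewrite !mxE dgZ. Qed.
Let diag_mx_inj u x y : diag_component u x -> diag_component u y ->
  diag_mx u x = diag_mx u y -> x = y.
Proof.
move=> [dx ax] [dy ay] e; apply: A_eq => [v i j iv jv|e' i j iv jv]; last by rewrite ax ?ay.
have [vu|ne] := eqVneq v u; last by rewrite dx ?dy.
subst v; have /matrixP/(_ (Ordinal iv) (Ordinal jv)) := e.
by rewrite !mxE.
Qed.

Let component_iso u : exists f : A -> 'M[K]_(d u),
  algebra_iso iota (diag_component u) (@mx_over K (d u) setT) f.
Proof.
exists (diag_mx u); split.
- by move=> x y _ _; exact: diag_mxD.
- by move=> x y _ _; exact: diag_mxM.
- by move=> a x _; exact: diag_mxZ.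
- exact: diag_mx_inj.
- rewrite eqEsubset; split=> [_ _|M _] //.
  exists (rec (fun v i j => if v == u then mx_nat M i j else 0) (fun _ _ _ => 0)).
    split=> [v i j iv jv /negPf ne|e i j ie je]; last by rewrite ar_rec.
    by rewrite dg_rec // ne.
  by apply/matrixP => i j; rewrite mxE dg_rec // eqxx mx_natE.
Qed.

Let component_orthogonal u v x y : u != v ->
  diag_component u x -> diag_component v y -> x * y = 0.
Proof.
move=> uv [dx ax] [dy ay]; apply: A_eq => [w i j iw jw|e i j ie je].
  rewrite dgM dg0 big1 // => e _; have [wu|wu] := eqVneq w u; last by rewrite dx ?mul0r.
  by rewrite (dy w) ?mulr0 // wu.
rewrite ar0 /ar rmorphM.
exact: (arrow_coordM0 X_type X_mul X_disj X_occ).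
Qed.

Let dg_sum (I : finType) (f : I -> A) u i j : dg (\sum_v f v) u i j = \sum_v dg (f v) u i j.
Proof. by apply: (big_morph (fun x => dg x u i j)) => [x y|]; rewrite ?dgD ?dg0. Qed.
Let ar_sum (I : finType) (f : I -> A) u i j : ar (\sum_v f v) u i j = \sum_v ar (f v) u i j.
Proof. by apply: (big_morph (fun x => ar x u i j)) => [x y|]; rewrite ?arD ?ar0. Qed.

Let component_direct (a : 'I_k -> A) : (forall u, diag_component u (a u)) ->
  \sum_u a u = 0 -> forall u, a u = 0.
Proof.
move=> ca a0 u; apply: (@diag_mx_inj u) => //; first by case: (component_subalgebra u).
apply/matrixP => i j; rewrite !mxE dg0 -(dg0 u i j) -a0 dg_sum (bigD1 u) //= big1 ?addr0 //.
by move=> v ne; have [h _] := ca v; rewrite h // eq_sym.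
Qed.

Lemma sum_of_diag_components x : sum_of_components diag_component x <-> arrow_vanish x.
Proof.
split=> [[a ca ->] e i j ie je|ax].
  by rewrite ar_sum big1 // => u _; have [_ h] := ca u; rewrite h.
exists (fun u => rec (fun v i j => if v == u then dg x v i j else 0) (fun _ _ _ => 0)).
  move=> u; split=> [v i j iv jv /negPf ne|e i j ie je]; last by rewrite ar_rec.
  by rewrite dg_rec // ne.
apply: A_eq => [u i j iu ju|e i j ie je].
  rewrite dg_sum (bigD1 u) //= dg_rec // eqxx big1 ?addr0 // => v ne.
  by rewrite dg_rec // eq_sym (negPf ne).
by rewrite ax // ar_sum big1 // => u _; rewrite ar_rec.
Qed.

Let semisimple_subalgebra : subalgebra (sum_of_components diag_component).
Proof.
split=> [|x y|x y|a x]; rewrite !sum_of_diag_components.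
- by move=> e i j ie je; exact: ar1.
- by move=> ax ay e i j ie je; rewrite arD ax ?ay ?addr0.
- move=> ax ay; rewrite /arrow_vanish /ar rmorphM.
  exact: (arrow_coordM0 X_type X_mul X_disj X_occ).
- by move=> ax e i j ie je; rewrite arZ ax ?mulr0.
Qed.

Let wd_splitting x : exists y z : A,
  [/\ sum_of_components diag_component y, jacobson_radical z & x = y + z].
Proof.
exists (rec (dg x) (fun _ _ _ => 0)), (rec (fun _ _ _ => 0) (ar x)); split.
- by rewrite sum_of_diag_components => e i j ie je; rewrite ar_rec.
- by apply/jacobson_radicalP => u i j iu ju; rewrite dg_rec.
- by apply: A_eq => [u|e] i j iu ju; rewrite ?dgD ?arD ?dg_rec ?ar_rec ?addr0 ?add0r.
Qed.

Let wd_splitting_direct x :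
  sum_of_components diag_component x -> jacobson_radical x -> x = 0.
Proof.
rewrite sum_of_diag_components jacobson_radicalP => ax dx.
by apply: A_eq => [u|e] i j iu ju; rewrite ?dg0 ?ar0 ?dx ?ax.
Qed.

(** All fields are [K], as [R] is a [K]-algebra. It is transparent because [wd_size] and [wd_degree]
    must compute to [k] and [d] in the statements below. *)
Definition block_wedderburn : wedderburn_decomposition iota A.
Proof.
refine (@WedderburnDecomposition F K iota A k d (fun _ => setT) diag_component
  (pb_d_gt0 (p := B)) _ _ component_subalgebra component_iso component_orthogonal
  component_direct semisimple_subalgebra wd_splitting wd_splitting_direct).
- by move=> _; split.
- by move=> _; right.
Defined.

Let N := (\sum_r d (c r))%N.

Definition block_fun (x : A) : 'M[K]_N := block_mx_nat (fun r => d (c r)) (be x).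

Let beE x q i w j : be x q i w j =
  (q == w)%:R * dg x (c q) i j + \sum_e X e q w * ar x e i j.
Proof. exact: block_entryE. Qed.

Let block_funE x q i w j :
  block_fun x (tagnat.Rank q i) (tagnat.Rank w j) = be x q i w j.
Proof. exact: block_mx_natE. Qed.

Let block_fun_zmod : zmod_morphism block_fun.
Proof.
move=> x y; apply: block_mx_natP => q i w j.
rewrite block_funE [RHS]mxE [X in _ = _ + X]mxE !block_funE.
by apply: (addIr (be y q i w j)); rewrite subrK /be -block_entryD -rmorphD subrK.
Qed.

Let block_fun_monoid : monoid_morphism block_fun.
Proof.
split=> [|x y]; apply: block_mx_natP => q i w j; rewrite block_funE /be.
  rewrite rmorph1 block_entry1 ?ltn_ord // mxE -[_ == tagnat.Rank w j]val_eqE /=.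
  by rewrite tagnat.eq_Rank.
rewrite [RHS]mxE sum_Rank rmorphM (block_entryM X_type X_mul).
by apply: eq_bigr => p _; apply: eq_bigr => e _; rewrite !block_funE.
Qed.

Definition block_rmorphism : {rmorphism A -> 'M[K]_N} :=
  HB.pack block_fun
    (GRing.isZmodMorphism.Build A 'M[K]_N block_fun block_fun_zmod)
    (GRing.isMonoidMorphism.Build A 'M[K]_N block_fun block_fun_monoid).

Let block_fun_scale a x : block_rmorphism (a *: x) = iota a *: block_rmorphism x.
Proof.
apply: block_mx_natP => q i w j; rewrite [RHS]mxE !block_funE /be.
by rewrite psiZ block_entryZ.
Qed.

Let block_fun_inj : injective block_rmorphism.
Proof.
move=> x y exy; apply: (can_inj psiK); apply/eqP; rewrite -subr_eq0 -rmorphB; apply/eqP.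
apply: (block_entry_inj X_type X_disj X_occ c_surj) => q i w j iq jw.
rewrite -[LHS]/(be (x - y) q (Ordinal iq) w (Ordinal jw)) -block_funE.
by rewrite -[block_fun _]/(block_rmorphism (x - y)) rmorphB exy subrr mxE.
Qed.

Definition block_representation : representation iota A (\sum_r d (c r)) :=
  Representation block_fun_scale block_fun_inj.

Let blockE x q w i j : submxblock (block_representation x) q w i j = be x q i w j.
Proof. by rewrite mxE; exact: block_funE. Qed.

Let be_diag x q i j : be x q i q j = dg x (c q) i j.
Proof. exact: block_entry_diag. Qed.

Lemma diagonal_gluing q w : c q = c w ->
  proportional_gluing (d := fun r => d (c r)) (range block_representation) q q w w 1.
Proof.
move=> e; split; rewrite ?e // => _ [x _ <-] i j i' j' ei ej.
by rewrite !blockE mul1r !be_diag -ei -ej -e.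
Qed.

(** By disjointness both blocks are multiples of one and the same arrow coordinate. *)
Lemma arrow_gluing e q w q' w' : X e q w != 0 -> X e q' w' != 0 ->
  proportional_gluing (d := fun r => d (c r)) (range block_representation)
    q w q' w' (X e q' w' / X e q w).
Proof.
move=> nz nz'; have [sq tw _] := X_type nz; have [sq' tw' _] := X_type nz'.
split; rewrite ?sq ?sq' ?tw ?tw' // => _ [x _ <-] i j i' j' ei ej.
rewrite !blockE /be (block_entry_arrow X_type X_disj _ _ _ nz).
by rewrite (block_entry_arrow X_type X_disj _ _ _ nz') mulrA divfK // ei ej.
Qed.

Let Q := full_quiver_of (W := block_wedderburn) (c := c) block_representation.
Let G := gluing_generator (Q := Q) (range block_representation).

(* A matrix of the image is determined by its blocks at one diagonal position
   per component and one position per label: pivot M is the matrix of the image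
   with the same such blocks as M. *)
Lemma exists_pivots : exists pivot : 'M[K]_N -> 'M[K]_N,
  (forall M, range block_representation (pivot M)) /\
  forall i : 'I_(N * N), exists g : {mpoly K[N * N]},
    ideal_generated G ('X_i - g) /\
    forall M, g.@[fun j => mxvec M 0 j] = mxvec (pivot M) 0 i.
Proof.
have [dq dqP] := choice c_surj.
have [ap apP] : {f : 'I_m -> 'I_l * 'I_l & forall e, X e (f e).1 (f e).2 != 0}.
  apply: (@choice _ _ (fun e (p : 'I_l * 'I_l) => X e p.1 p.2 != 0)) => e.
  by have [x [y h]] := X_occ e; exists (x, y).
pose bl (M : 'M[K]_N) q w := @submxblock _ _ _ (fun r => d (c r)) (fun r => d (c r)) M q w.
pose D M u i j := mx_nat (bl M (dq u) (dq u)) i j.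
pose E M e i j := mx_nat (bl M (ap e).1 (ap e).2) i j / X e (ap e).1 (ap e).2.
pose pivot M := block_fun (rec (D M) (E M)).
have pivE M q i w j : pivot M (tagnat.Rank q i) (tagnat.Rank w j) =
    (q == w)%:R * D M (c q) i j + \sum_e X e q w * E M e i j.
  rewrite /pivot block_funE /be phiK; exact: block_reconstruct.
exists pivot; split; first by move=> M; exists (rec (D M) (E M)).
case/mxvec_indexP => a1 a2.
have var M a e : (mx_var K a e).@[fun j => mxvec M 0 j] = M a e by rewrite mevalXU mxvecE.
suff gen q w (i : 'I_(d (c q))) (j : 'I_(d (c w))) : exists g : {mpoly K[N * N]},
    ideal_generated G (mx_var K (tagnat.Rank q i) (tagnat.Rank w j) - g) /\
    forall M, g.@[fun j => mxvec M 0 j] = pivot M (tagnat.Rank q i) (tagnat.Rank w j).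
  have [g [Gg gM]] := gen _ _ (tagnat.sig2 a1) (tagnat.sig2 a2).
  rewrite !tagnat.sig2K in Gg gM; exists g; split=> // M.
  by rewrite gM mxvecE.
have [qw|ne] := eqVneq q w.
  subst w; have e := dqP (c q).
  pose i' := cast_ord (congr1 d (esym e)) i; pose j' := cast_ord (congr1 d (esym e)) j.
  (* The factor 1 gives the difference the shape of a [GluedEntries] generator. *)
  exists (1 *: mx_var K (tagnat.Rank (dq (c q)) i') (tagnat.Rank (dq (c q)) j')); split.
    apply: ideal_generated_gen.
    apply: (@GluedEntries K Q _ (dq (c q)) (dq (c q)) q q 1 i' j' i j) => //.
    by apply: diagonal_gluing.
  move=> M; rewrite scale1r var pivE eqxx mul1r big1 ?addr0 => [|e' _].
    by rewrite /D (@mx_nat_eq _ _ _ _ _ _ i' j') // mxE.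
  by have [->|/X_type[_ _]] := eqVneq (X e' q q) 0; rewrite ?mul0r ?ltnn.
have [[e nz]|none] := pselect (exists e, X e q w != 0).
  have [sq tw _] := X_type nz; have [sp tp _] := X_type (apP e).
  have eq1 : d (c q) = d (c (ap e).1) by rewrite sq sp.
  have eq2 : d (c w) = d (c (ap e).2) by rewrite tw tp.
  pose i' := cast_ord eq1 i; pose j' := cast_ord eq2 j.
  pose nu := X e q w / X e (ap e).1 (ap e).2.
  exists (nu *: mx_var K (tagnat.Rank (ap e).1 i') (tagnat.Rank (ap e).2 j')); split.
    apply: ideal_generated_gen.
    apply: (@GluedEntries K Q _ (ap e).1 (ap e).2 q w nu i' j' i j) => //.
    exact: arrow_gluing.
  move=> M; rewrite mevalZ var pivE (negPf ne) mul0r add0r (bigD1 e) //= big1 ?addr0.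
    by rewrite /E (@mx_nat_eq _ _ _ _ _ _ i' j') // mxE mulrA mulrAC.
  move=> e' ne'; have [->|nz'] := eqVneq (X e' q w) 0; first by rewrite mul0r.
  by rewrite (X_disj nz' nz) eqxx in ne'.
have X0 e : X e q w = 0 by apply/eqP; apply: contraT => nz; case: none; exists e.
exists 0; split.
  rewrite subr0; apply: ideal_generated_gen.
  apply: (@VanishingEntry K Q _ q w i j) => _ [x _ <-].
  by apply/matrixP => a b; rewrite blockE mxE /be block_entry_none.
move=> M; rewrite meval0 pivE (negPf ne) mul0r add0r big1 // => e _.
by rewrite X0 mul0r.
Qed.

Let gluingP r s r' s' nu : fq_gluing (f := Q) r s r' s' nu ->
  proportional_gluing (d := @fq_degree _ Q) (range block_representation) r s r' s' nu.
Proof. by []. Qed.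

(** Modulo the gluing ideal, [f] is congruent to its composite with the polynomial map [pivot]. That
    map takes values in the image, where [f] vanishes, so over an infinite [K] the composite is the
    zero polynomial. *)
Lemma block_relations : infinite_set [set: K] ->
  relations_are_consequences_of_gluing (Q := Q) (range block_representation).
Proof.
move=> infK f Xf; have [pivot [pivR gP]] := exists_pivots.
have [g {}gP] := choice gP.
pose lq := [tuple g i | i < N * N].
have f0 : f \mPo lq = 0.
  apply: mpoly_eval_eq0 => // v; rewrite comp_mpoly_meval.
  rewrite -(Xf (pivot (vec_mx (\row_i v i))) (pivR _)); apply: meval_eq => i.
  rewrite tnth_mktuple -(gP i).2; apply: meval_eq => j.
  by rewrite vec_mxK mxE.
have := @ideal_generated_comp K _ G lq f; rewrite f0 subr0; apply=> i.
by rewrite tnth_mktuple; exact: (gP i).1.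
Qed.

(** The equations [M = pivot M] follow from gluing, so they hold on the closure as well, and [pivot]
    takes its values in the image. *)
Lemma block_closed :
  zariski_closure (range block_representation) = range block_representation.
Proof.
rewrite eqEsubset; split=> [M clM|M RM f]; last exact.
have [pivot [pivR gP]] := exists_pivots.
suff -> : M = pivot M by exact: pivR.
apply/matrixP => a e; have [g [Gg /(_ M)]] := gP (mxvec_index a e).
rewrite mxvecE => <-.
have /clM := @gluing_generator_relation K Q _ gluingP _ Gg.
by rewrite /mx_eval mevalB mevalXU mxvecE => /eqP; rewrite subr_eq0 => /eqP.
Qed.

Lemma block_form : wedderburn_block_form (W := block_wedderburn) block_representation.
Proof.
split.
- exact: block_closed.
- exact: c_surj.
- move=> u x [dx ax] q w h; apply/matrixP => i j; rewrite blockE mxE beE.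
  rewrite (_ : \sum_e _ = 0) ?addr0.
    have [qw|_] := eqVneq q w; last by rewrite mul0r.
    rewrite mul1r; subst w; case: h => [|ne]; first by rewrite eqxx.
    by rewrite dx.
  rewrite big1 // => e _; have [->|/X_type[sq tw _]] := eqVneq (X e q w) 0.
    by rewrite mul0r.
  by rewrite ax ?mulr0 -?sq -?tw.
- move=> q; have bE x : submxblock (block_representation x) q q = diag_mx (c q) x.
    by apply/matrixP => i j; rewrite blockE be_diag mxE.
  split=> //.
  + by move=> x y _ _; rewrite !bE diag_mxD.
  + by move=> x y _ _; rewrite !bE diag_mxM.
  + by move=> a x _; rewrite !bE diag_mxZ.
  + by move=> x y cx cy; rewrite !bE; exact: diag_mx_inj.
- move=> x /jacobson_radicalP x0 q w le; apply/matrixP => i j; rewrite blockE mxE beE.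
  rewrite big1 ?addr0 => [|e _].
    have [qw|_] := eqVneq q w; last by rewrite mul0r.
    by subst w; rewrite mul1r x0.
  by have [->|/X_type[_ _]] := eqVneq (X e q w) 0; rewrite ?mul0r // ltnNge le.
- by move=> _ q w; exact: diagonal_gluing.
Qed.

End BlockRepresentation.

(** * The closure of a representation as a finite-dimensional algebra over [K] *)

Theorem theorem1p1 (F : fieldType) (K : closedFieldType)
    (iota : {rmorphism F -> K}) (A : algType F)
    (infF : infinite_set [set: F]) (affA : affine A) (piA : PI_algebra A)
    (n : nat) (rho : representation iota A n) :
  exists (W : wedderburn_decomposition iota (closure_algebra rho))
         (l : nat) (c : 'I_l -> 'I_(wd_size W))
         (rho' : representation iota (closure_algebra rho)
                   (\sum_r wd_degree (c r))),
    wedderburn_block_form rho' /\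
    relations_are_consequences_of_gluing
      (Q := full_quiver_of rho') (range rho').
Proof.
clear affA piA.
case: n rho => [|n] rho.
  (* In degree zero all matrices are equal, against [1 != 0] in [A]. *)
  have /eqP[] := oner_neq0 A; apply: (rep_inj (r := rho)).
  by apply/matrixP => -[].
have [U UP] : exists U : {vspace 'M[K]_n.+1}, forall M, M \in U <-> zariski_closure (range rho) M.
  apply: subspace_vspace.
  - by apply: sub_zariski_closure; exists 0; rewrite ?rmorph0.
  - exact: zariski_closureD.
  - by move=> a M; exact: zariski_closure_scale.
have U1 : 1 \in U by apply/UP; exact: zariski_closure1.
have Ua : is_aspace U.
  rewrite /is_aspace has_algid1 //=; apply/prodvP => M N /UP clM /UP clN.
  by apply/UP; exact: zariski_closureM.
(* [R] is the closure again, now with scalars in [K]; [psi] and [phi] are the identity on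
   matrices. *)
pose Ua' := ASpace Ua; pose R : falgType K := subvs_of Ua'.
have inU (x : closure_algebra rho) : val x \in U by apply/UP/in_closureP/valP.
pose psi (x : closure_algebra rho) : R := vsproj Ua' (val x).
have psiE x : vsval (psi x) = val x by rewrite vsprojK ?inU.
have phiP (y : R) : vsval y \in in_closure rho by apply/in_closureP/UP; exact: subvsP.
pose phi (y : R) : closure_algebra rho := ClosureAlgebra (phiP y).
have psi_zmod : zmod_morphism psi.
  by move=> x y; apply: val_inj; rewrite /= ?linearB /= -?/(psi _) !psiE.
have psi_monoid : monoid_morphism psi.
  split=> [|x y]; apply: val_inj; rewrite /= -?/(psi _) psiE.
    have /eqP a1 : algid Ua' == 1 by rewrite algid_eq1.
    exact: esym a1.
  by rewrite /= !psiE.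
pose psi_rm : {rmorphism closure_algebra rho -> R} :=
  HB.pack psi (GRing.isZmodMorphism.Build _ _ psi psi_zmod)
    (GRing.isMonoidMorphism.Build _ _ psi psi_monoid).
have psiZ a x : psi_rm (a *: x) = iota a *: psi_rm x.
  by apply: val_inj; rewrite /= -!/(psi _) !psiE.
have psiK : cancel psi_rm phi by move=> x; apply: val_inj; rewrite /= psiE.
have phiK : cancel phi psi_rm by move=> y; apply: val_inj; rewrite /= psiE.
have [B] := exists_peirce_basis R.
have [l [c [X [[X_type X_mul X_disj] [X_occ c_surj]]]]] := exists_labelled_quiver B.
exists (block_wedderburn psiZ psiK phiK X_type X_mul X_disj X_occ c_surj), l, c.
exists (block_representation psiZ psiK X_type X_mul X_disj X_occ c_surj); split.
  exact: block_form.
exact/block_relations/(infinite_set_image iota).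
Qed.
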